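(* Let $\Omega$ be a bounded domain in $\mathbb{R}^2$. Let $E$ be the Lamé operator $$Eu=\nabla\cdot\big(\lambda(x)\,(\operatorname{div}u)\,I+\mu(x)\,(\nabla u+(\nabla u)^T)\big)$$ with real valued coefficients $\lambda,\mu\in L^\infty(\Omega)$ such that $\operatorname{ess\,inf}_\Omega\mu>0$ and $\operatorname{ess\,inf}_\Omega(\lambda+2\mu)>0$. Suppose $$\left(1-\frac2p\right)^2<1-\operatorname*{ess\,sup}_{x\in\Omega}\left(\frac{\lambda+\mu}{\lambda+3\mu}\right)^2$$ with $p\ge2$, and that the $BMO$ norm of the function $\mu^2/(\lambda+3\mu)$ satisfies the inequality $$\left\|\mu^2(\lambda+3\mu)^{-1}\right\|_{BMO}\le\frac{\kappa}{2\,C_0}\left(1-\left(1-\frac2p\right)^2\right),$$ where the constants $\kappa$ and $C_0$ are as described in the context. Consider the Dirichlet problem $$u\in[\mathring{H}^1(\Omega)]^2,\qquad Eu=\operatorname{Div}F\ \text{ in }\Omega,\qquad u=0\ \text{ on }\partial\Omega,$$ where the matrix $F=\{F_{ij}\}$ is such that $$\int_\Omega|F|^2\,(\log(|F|+e))^{\frac{p-2}{p}}\,dx<+\infty .$$ Then the solution $u$ satisfies the inequality $$\int_\Omega|\nabla u|^2\,(|u|^{p-2}+1)\,dx<+\infty .$$ In particular, $$\int_\Omega|\nabla u|^2\,|u|^{p-2}\,dx\le K\,\big|\!\big|\!\big|\,|F|^2\,\big|\!\big|\!\big|_{\mathscr{L}_{\widetilde N}(\Omega)}^{\frac p2},\qquad\text{where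 }\ \widetilde N(t)=t\,(\log(t+e))^{\frac{p-2}{p}},$$ and the constant $K$ does not depend on $u$.
   Context: $\mathring{H}^1(\Omega)$ is the closure of $C_c^\infty(\Omega)$ in the $H^1$ norm. Summation over repeated indices is understood; $|F|=(\sum_{i,j}|F_{ij}|^2)^{1/2}$; $\operatorname{Div}F$ is the vector whose $j$-th component is $\partial_iF_{ij}$. The Dirichlet problem is understood in the weak sense: with $a^{hk}_{ij}=\lambda\delta_{ih}\delta_{jk}+\mu(\delta_{ij}\delta_{hk}+\delta_{ik}\delta_{hj})$, one has $\int_\Omega a^{hk}_{ij}\,\partial_ku_j\,\partial_hv_i\,dx=\int_\Omega F_{ij}\,\partial_iv_j\,dx$ for any $v\in[\mathring{H}^1(\Omega)]^2$. The constant $\kappa$: let $\delta$ be a real constant with $$0<\delta<1-\operatorname*{ess\,sup}_{x\in\Omega}\left(\frac{\lambda+\mu}{\lambda+3\mu}\right)^2-\left(1-\frac2p\right)^2;$$ then $\kappa$ is chosen such that $$0<\kappa<\frac{\delta}{2\left(1-(1-2/p)^2\right)}\min\Big\{\operatorname*{ess\,inf}_{\Omega}\mu,\ \operatorname*{ess\,inf}_{\Omega}(\lambda+2\mu)\Big\}.$$ The constant $C_0$ is the constant in the commutator inequality of Maz'ya and Verbitsky $$\Big|\sum_{k,j}\int_\Omega\partial_kf\,(v_k\,\partial_jv_j-v_j\,\partial_jv_k)\,dx\Big|\le C_0\,\|f\|_{BMO}\,\|\nabla v_1\|\,\|\nabla v_2\|,\qquad v\in[C_c^\infty(\Omega)]^2,$$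 where $\|\cdot\|$ is the $L^2$ norm and $\partial_kf$ is taken in the sense of distributions, which is applied with $f=\mu^2/(\lambda+3\mu)$. $BMO$ is the space of functions of bounded mean oscillation. Luxemburg norm: for a Young function $M$ on $[0,+\infty)$, $\mathscr{L}_M(\Omega)$ is the Orlicz space of measurable functions $w$ on $\Omega$ with $\int_\Omega M(\alpha|w|)\,dx<+\infty$ for some $\alpha>0$, and $|\!|\!|w|\!|\!|_{\mathscr{L}_M(\Omega)}=\inf\{\theta>0:\int_\Omega M(|w|/\theta)\,dx\le1\}$. *)

(* Defs.v *)
(* MathComp-Analysis, over an arbitrary R : realType; the plane is R * R. *)
From HB Require Export structures.
From mathcomp Require Export all_boot all_order all_algebra.
From mathcomp Require Export all_classical all_reals all_analysis.
From mathcomp Require Export ess_sup_inf.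

Set Implicit Arguments.
Unset Strict Implicit.
Unset Printing Implicit Defensive.

Export Order.TTheory GRing.Theory Num.Theory.
Export numFieldNormedType.Exports.

#[export] Set Implicit Arguments.
#[export] Unset Strict Implicit.
#[export] Unset Printing Implicit Defensive.

Local Open Scope classical_set_scope.
Local Open Scope ring_scope.

Section Plane.
Context {R : realType}.
Implicit Types (Omega Q K : set (R * R)) (f g phi : R * R -> R) (i h k : 'I_2).

Definition leb2 : {measure set (measurableTypeR R * measurableTypeR R) -> \bar R} :=
  (lebesgue_measure \x lebesgue_measure)%E.

Definition domain Omega := [/\ open Omega, connected Omega & Omega !=set0].

Definition axis i : R * R := if i == ord0 then (1, 0) else (0, 1).

(* Classical partial derivative (meaningful where [derivable]). *)
Definition pd i phi : R * R -> R := fun x => 'D_(axis i) (phi : R * R -> R^o) x.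

Fixpoint Ck (n : nat) phi : Prop :=
  continuous phi /\
  (if n is m.+1 then
     forall i, (forall x, derivable (phi : R * R -> R^o) x (axis i)) /\
               Ck m (pd i phi)
   else True).

Definition Cc_infty Omega phi :=
  [/\ forall n, Ck n phi,
      compact (closure [set x | phi x != 0]) &
      closure [set x | phi x != 0] `<=` Omega].

Definition loc_integrable Omega f :=
  measurable_fun Omega f /\
  forall K, K `<=` Omega -> compact K -> leb2.-integrable K (EFin \o f).

(* The functions under study are total on the plane, but only their values on
   Omega matter.  Measurability is Borel measurability, which loses nothing
   since every Lebesgue measurable function has a Borel representative. *)
Definition L2norm Omega f : \bar R :=
  ('N[leb2]_(2%:R%:E) [EFin \o (f \_ Omega)])%E.

Definition L2 Omega f := measurable_fun Omega f /\ (L2norm Omega f < +oo)%E.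

Definition Linfty Omega f :=
  measurable_fun Omega f /\
  ('N[leb2]_(+oo%E) [EFin \o (f \_ Omega)] < +oo)%E.

(* Essential bounds over Omega: the values off Omega are replaced by the
   neutral element, so that they do not contribute. *)
Definition ess_sup_on Omega f : \bar R :=
  ess_sup leb2 (patch (fun=> -oo%E) Omega (EFin \o f)).

Definition ess_inf_on Omega f : \bar R :=
  ess_inf leb2 (patch (fun=> +oo%E) Omega (EFin \o f)).

(* The pairing of the distribution d_k f with the test function phi. *)
Definition distr_pd Omega k f phi : R :=
  - \int[leb2]_(x in Omega) (f x * pd k phi x).

Definition is_weak_pd Omega i f g :=
  [/\ loc_integrable Omega f, loc_integrable Omega g &
      forall phi, Cc_infty Omega phi ->
        \int[leb2]_(x in Omega) (g x * phi x) = distr_pd Omega i f phi].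

(* A chosen representative of the weak derivative, which is unique almost
   everywhere in Omega when it exists; 0 when it does not. *)
Definition wpd Omega i f : R * R -> R :=
  xget (fun=> 0) [set g | is_weak_pd Omega i f g].

Definition H1 Omega f :=
  L2 Omega f /\
  forall i, is_weak_pd Omega i f (wpd Omega i f) /\ L2 Omega (wpd Omega i f).

Definition grad_norm Omega f : R * R -> R :=
  fun x => Num.sqrt (\sum_(i < 2) wpd Omega i f x ^+ 2).

Definition H1norm Omega f : \bar R :=
  ((L2norm Omega f `^ 2 + L2norm Omega (grad_norm Omega f) `^ 2) `^ 2^-1)%E.

Definition H10 Omega f :=
  H1 Omega f /\
  forall eps : R, 0 < eps ->
    exists2 phi, Cc_infty Omega phi & (H1norm Omega (f \- phi)%R < eps%:E)%E.

(* BMO(Omega): mean oscillations over the closed squares, with sides parallel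
   to the axes, that are contained in Omega. *)
Definition square (a b l : R) : set (R * R) :=
  `[a, a + l]%classic `*` `[b, b + l]%classic.

Definition mean Q f : R := (fine (leb2 Q))^-1 * \int[leb2]_(x in Q) f x.

Definition mean_osc Q f : \bar R :=
  ((fine (leb2 Q))^-1%:E * \int[leb2]_(x in Q) `|f x - mean Q f|%:E)%E.

Definition bmo_norm Omega f : \bar R :=
  ereal_sup [set mean_osc Q f | Q in
    [set Q | Q `<=` Omega /\ exists a b l : R, 0 < l /\ Q = square a b l]].

Definition BMO Omega f := loc_integrable Omega f /\ (bmo_norm Omega f < +oo)%E.

(* C0 is an admissible constant in the commutator inequality on Omega. *)
Definition commutator_constant Omega (C0 : R) :=
  forall f, BMO Omega f ->
  forall v : 'I_2 -> R * R -> R, (forall j, Cc_infty Omega (v j)) ->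
  (`| \sum_(k < 2) \sum_(j < 2)
        distr_pd Omega k f
          (fun x => v k x * pd j (v j) x - v j x * pd j (v k) x)%R |%R%:E
   <= C0%:E * bmo_norm Omega f *
      L2norm Omega (grad_norm Omega (v ord0)) *
      L2norm Omega (grad_norm Omega (v ord_max)))%E.

Definition vec_norm (u : 'I_2 -> R * R -> R) : R * R -> R :=
  fun x => Num.sqrt (\sum_(j < 2) u j x ^+ 2).

Definition mat_norm (F : 'I_2 -> 'I_2 -> R * R -> R) : R * R -> R :=
  fun x => Num.sqrt (\sum_(i < 2) \sum_(j < 2) F i j x ^+ 2).

Definition wgrad Omega (u : 'I_2 -> R * R -> R) : 'I_2 -> 'I_2 -> R * R -> R :=
  fun k j => wpd Omega k (u j).

(* The coefficients a^{hk}_{ij}. *)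
Definition lame_coef (lambda mu : R * R -> R) (h k i j : 'I_2) : R * R -> R :=
  fun x => lambda x * (i == h)%:R * (j == k)%:R
    + mu x * ((i == j)%:R * (h == k)%:R + (i == k)%:R * (h == j)%:R).

(* u is a weak solution in [H10(Omega)]^2 of E u = Div F, u = 0 on the
   boundary. *)
Definition dirichlet_solution Omega (lambda mu : R * R -> R)
    (F : 'I_2 -> 'I_2 -> R * R -> R) (u : 'I_2 -> R * R -> R) :=
  (forall j, H10 Omega (u j)) /\
  forall v : 'I_2 -> R * R -> R, (forall j, H10 Omega (v j)) ->
  \int[leb2]_(x in Omega)
     (\sum_(h < 2) \sum_(k < 2) \sum_(i < 2) \sum_(j < 2)
        lame_coef lambda mu h k i j x
        * wpd Omega k (u j) x * wpd Omega h (v i) x)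
  = \int[leb2]_(x in Omega)
     (\sum_(i < 2) \sum_(j < 2) F i j x * wpd Omega i (v j) x).

(* Infimum in the extended reals: +oo when w is not in the Orlicz space. *)
Definition luxemburg (M : R -> R) Omega (w : R * R -> R) : \bar R :=
  ereal_inf [set theta%:E | theta in
    [set theta : R | 0 < theta /\
       (\int[leb2]_(x in Omega) (M (`|w x| / theta))%:E <= 1)%E]].

Definition Ntilde (p t : R) : R := t * (ln (t + expR 1)) `^ ((p - 2) / p).

End Plane.

(* Main.v *)
(** The weak equation is tested with [v = Theta u], where [Theta] is a smooth,
    bounded and bounded below, truncation of [|u|^(p-2)], and compared with
    [w = Theta^(1/2) u].  The quadratic form obtained in this way is not coercive
    pointwise, but it becomes so, with constant [kappa (1 - (1 - 2/p)^2)], once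
    [4 f det (grad w)] is added, for [f = mu^2 / (lambda + 3 mu)].  The commutator
    in the inequality of Maz'ya and Verbitsky equals [-2 f det (grad w)] up to a
    divergence, so that the smallness of the BMO norm of [f] allows one to absorb
    the added term; hence [|grad w|^2] has integral at most [C] times the integral
    of [|F|^2 Theta].

    In the plane, a function with Dirichlet integral at most [X] satisfies
    Trudinger's exponential bound for [w^2 / X].  Young's inequality for the pair
    ([a log(a + e)^sigma], [exp]), with [sigma = (p - 2) / p], then bounds the
    integral of [|F|^2 Theta] by [C theta X^sigma] for every [theta] admissible in
    the Luxemburg norm of [|F|^2].  As [sigma < 1], this bounds [X] by
    [C theta^(p/2)], uniformly in the truncation, which is removed by Fatou's
    lemma. *)
Require Import Defs.
From mathcomp Require Import ring lra measurable_realfun.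

Local Open Scope classical_set_scope.
Local Open Scope ring_scope.

(** * Calculus in the plane *)

Section PlaneCalculus.
Context {R : realType}.
Implicit Types (f g h phi psi : R * R -> R) (x : R * R) (i j k : 'I_2) (n : nat).

(** The truncation must be bounded for $\Theta u$ to be a test function, and bounded below for its
    powers to be smooth. Its logarithmic derivative is at most that of $t$, so weighting changes the
    derivatives of the component along $u$ by a relative amount $m \le q = (p-2)/2$. In the energy
    form this costs a factor $1 - (m/(1+m))^2$ on those entries, and $m/(1+m) \le q/(1+q) = 1 -
    2/p$. The determinant is a null Lagrangian for constant $f$; the multiple $4f$ is chosen because
    it gives all mixed terms the same relative coefficient $(\lambda+\mu)/(\lambda+3\mu)$.
    Coercivity then amounts to the squares of these two numbers adding up to at most $1 - \delta$.

    Of the coercivity constant, half pays for the commutator, a quarter for the source, and a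
    quarter remains.

    Limits in $\mathring H^1$ go through test functions that converge almost everywhere, with their
    gradients, under an integrable bound; this serves the chain rule, the determinant and Fatou's
    lemma alike. Trudinger's bound comes from the inequality $\|\Phi\|_2^2 \le
    \|\partial_1\Phi\|_1\|\partial_2\Phi\|_1$, iterated over the level sets of a test function. *)

Definition dpd i phi x (d : R) := is_derive x (axis i) (phi : R * R -> R^o) d.

Lemma dpdE i phi x d : dpd i phi x d -> pd i phi x = d.
Proof. by case. Qed.

Lemma CkS n phi : Ck n.+1 phi -> Ck n phi.
Proof.
elim: n phi => [|n IH] phi [cphi H]; split => // i.
by have [dphi /IH] := H i.
Qed.

Lemma Ck_continuous n phi : Ck n phi -> continuous phi.
Proof. by case: n => [|n] []. Qed.

Lemma Ck_dpd n phi i x : Ck n.+1 phi -> dpd i phi x (pd i phi x).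
Proof. by move=> [_ /(_ i)[/(_ x) /derivableP]]. Qed.

Lemma Ck_pd n phi i : Ck n.+1 phi -> Ck n (pd i phi).
Proof. by move=> [_ /(_ i)[]]. Qed.

Lemma CkSI n phi (d : 'I_2 -> R * R -> R) : continuous phi ->
  (forall i x, dpd i phi x (d i x)) -> (forall i, Ck n (d i)) -> Ck n.+1 phi.
Proof.
move=> cphi dphi Cd; split => // i; split=> [x|].
  by have /@ex_derive := dphi i x.
by have -> : pd i phi = d i by apply/funext => x; exact/dpdE/dphi.
Qed.

Lemma dpd_cst i (c : R) x : dpd i (fun=> c) x 0.
Proof. exact: is_derive_cst. Qed.

Lemma Ck_cst n (c : R) : Ck n (fun=> c : R).
Proof.
elim: n c => [|n IH] c; first by split => //; exact: cst_continuous.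
apply: (@CkSI _ _ (fun _ _ => 0)) => //; first exact: cst_continuous.
by move=> i x; exact: dpd_cst.
Qed.

Lemma dpd_lin i (f : {linear (R * R)%type -> R^o}) x :
  dpd i f x (f (axis i)).
Proof.
have E : (fun t : R => t^-1 *: ((f \o shift x) (t *: axis i) - f x)) @ 0^' --> f (axis i).
  apply: (@cvg_trans _ ((fun=> f (axis i)) @ 0^')); last exact: cvg_cst.
  apply: near_eq_cvg; near=> t.
  have -> : (f \o shift x) (t *: axis i) = t *: f (axis i) + f x.
    by rewrite /= linearD linearZ.
  rewrite addrK scalerA mulVf ?scale1r //.
  by near: t; exact: nbhs_dnbhs_neq.
by split; [apply/cvg_ex; exists (f (axis i))|apply/cvg_lim].
Unshelve. all: by end_near. Qed.

Lemma dpd_fst i x : dpd i fst x (i == ord0)%:R.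
Proof.
have -> : (i == ord0)%:R = (axis i).1 :> R by rewrite /axis; case: ifP.
exact: (dpd_lin i (fst : {linear (R * R)%type -> R^o})).
Qed.

Lemma dpd_snd i x : dpd i snd x (i == ord_max)%:R.
Proof.
have -> : (i == ord_max)%:R = (axis i).2 :> R.
  by rewrite /axis; case: (eqVneq i ord0) => [->//|/=]; case: i => -[|[|]].
exact: (dpd_lin i (snd : {linear (R * R)%type -> R^o})).
Qed.

Lemma Ck_fst n : Ck n (fst : R * R -> R).
Proof.
have c : continuous (fst : R * R -> R) by move=> x; exact: cvg_fst.
case: n => [|n]; first by split.
by apply: (CkSI c (fun i x => dpd_fst i x)) => i; exact: Ck_cst.
Qed.

Lemma Ck_snd n : Ck n (snd : R * R -> R).
Proof.
have c : continuous (snd : R * R -> R) by move=> x; exact: cvg_snd.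
case: n => [|n]; first by split.
by apply: (CkSI c (fun i x => dpd_snd i x)) => i; exact: Ck_cst.
Qed.

Lemma dpdD i f g x a b : dpd i f x a -> dpd i g x b ->
  dpd i (fun y => f y + g y) x (a + b).
Proof. by move=> fa gb; exact: is_deriveD. Qed.

Lemma dpdB i f g x a b : dpd i f x a -> dpd i g x b ->
  dpd i (fun y => f y - g y) x (a - b).
Proof. by move=> fa gb; exact: is_deriveB. Qed.

Lemma dpdM i f g x a b : dpd i f x a -> dpd i g x b ->
  dpd i (fun y => f y * g y) x (f x * b + g x * a).
Proof. by move=> fa gb; exact: is_deriveM. Qed.

Lemma CkD n f g : Ck n f -> Ck n g -> Ck n (fun y => f y + g y).
Proof.
elim: n f g => [|n IH] f g Cf Cg.
  by split=> // x; apply: continuousD; [exact: (Ck_continuous Cf)|exact: (Ck_continuous Cg)].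
apply: (@CkSI _ _ (fun i y => pd i f y + pd i g y)).
- by move=> x; apply: continuousD; [exact: (Ck_continuous Cf)|exact: (Ck_continuous Cg)].
- by move=> i x; exact: dpdD (Ck_dpd i x Cf) (Ck_dpd i x Cg).
- by move=> i; apply: IH; [exact: (Ck_pd i Cf)|exact: (Ck_pd i Cg)].
Qed.

Lemma CkM n f g : Ck n f -> Ck n g -> Ck n (fun y => f y * g y).
Proof.
elim: n f g => [|n IH] f g Cf Cg.
  by split=> // x; apply: continuousM; [exact: (Ck_continuous Cf)|exact: (Ck_continuous Cg)].
apply: (@CkSI _ _ (fun i y => f y * pd i g y + g y * pd i f y)).
- by move=> x; apply: continuousM; [exact: (Ck_continuous Cf)|exact: (Ck_continuous Cg)].
- by move=> i x; exact: dpdM (Ck_dpd i x Cf) (Ck_dpd i x Cg).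
- by move=> i; apply: CkD; apply: IH; (exact: (Ck_pd i Cg) || exact: (Ck_pd i Cf) || exact: (CkS Cf) || exact: (CkS Cg)).
Qed.

Lemma CkZ n (c : R) f : Ck n f -> Ck n (fun y => c * f y).
Proof. by move=> Cf; apply: CkM => //; exact: Ck_cst. Qed.

Lemma CkB n f g : Ck n f -> Ck n g -> Ck n (fun y => f y - g y).
Proof.
move=> Cf Cg; have := CkD Cf (CkZ (-1) Cg).
by under eq_fun do rewrite mulN1r.
Qed.

(** Along the line through [x] in the direction [axis i], both derivatives become derivatives at 0
    of functions of one variable, where the usual chain rule applies. *)
Lemma dpd_comp i (F : R -> R) h x (a b : R) : dpd i h x a ->
  is_derive (h x) 1 F b -> dpd i (fun y => F (h y)) x (b * a).
Proof.
move=> [hd ha] Fb.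
have line : forall g, 'D_(axis i) (g : R * R -> R^o) x
    = 'D_1 (fun t : R => g (t *: axis i + x)) 0.
  move=> g; rewrite /derive; set f1 := (fun t => _); set f2 := (fun t => _).
  suff -> : f1 = f2 by [].
  by apply/funext => t; rewrite /f1 /f2 /= addr0 scale0r add0r [_%:A]mulr1.
have dl : is_derive (0 : R) 1 (fun t : R => h (t *: axis i + x)) a.
  by apply: DeriveDef; [exact: (derivable1P (h : R * R -> R^o) x (axis i)).1|rewrite -line; exact: ha].
have Fb' : is_derive ((fun t : R => h (t *: axis i + x)) 0) 1 F b.
  by rewrite scale0r add0r.
have [c1 c2] := is_derive1_comp Fb' dl.
apply: DeriveDef; first exact: (derivable1P ((fun y => F (h y)) : R * R -> R^o) x (axis i)).2.
by rewrite line; rewrite -[RHS]c2.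
Qed.

(* Induction on the order of [Ck] requires the derivative of the outer function to
   belong to the same class. *)
Definition smooth_class (D : set R) (C : set (R -> R)) :=
  forall F, C F -> exists2 F', C F' & forall t, D t -> is_derive t 1 F (F' t).

Lemma Ck_comp (D : set R) (C : set (R -> R)) (F : R -> R) h n :
  smooth_class D C -> C F -> (forall x, D (h x)) -> Ck n h ->
  Ck n (fun y => F (h y)).
Proof.
move=> SC; elim: n F => [|n IH] F CF Dh Ch; have [F' CF' dF] := SC _ CF;
  have cFh : continuous (fun y => F (h y)).
- move=> x; apply: (@continuous_comp _ _ _ h F); first exact: (Ck_continuous Ch).
  apply: differentiable_continuous; apply/derivable1_diffP.
  by have /@ex_derive := dF _ (Dh x).
- by split.
- move=> x; apply: (@continuous_comp _ _ _ h F); first exact: (Ck_continuous Ch).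
  apply: differentiable_continuous; apply/derivable1_diffP.
  by have /@ex_derive := dF _ (Dh x).
- apply: (@CkSI _ _ (fun i y => F' (h y) * pd i h y)) => // [i x|i].
    by apply: dpd_comp; [exact: (Ck_dpd _ _ Ch)|exact: dF].
  apply: CkM; last exact: (Ck_pd i Ch).
  by apply: IH => //; exact: CkS.
Qed.

(** The scalar factor closes the class under derivation: $(c\,t^a)' = (ca)\,t^{a-1}$. *)
Lemma smooth_class_powR : smooth_class [set t | 0 < t]
  [set F | exists c a : R, F = fun t => c * t `^ a].
Proof.
move=> _ [c [a ->]]; exists (fun t => (c * a) * t `^ (a - 1)).
  by exists (c * a), (a - 1).
move=> t /= t0; have := is_derive1_powR a t0 => d.
apply: (@is_derive_eq _ _ _ (fun t => c *: t `^ a)).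
by rewrite -mulrA.
Qed.

Lemma Ck_powR (a : R) h n : (forall x, 0 < h x) -> Ck n h -> Ck n (fun y => h y `^ a).
Proof.
move=> h0 Ch; have := @Ck_comp _ _ (fun t => 1 * t `^ a) _ _ smooth_class_powR _ h0 Ch.
have -> : (fun y => h y `^ a) = (fun y => 1 * h y `^ a).
  by apply/funext => y; rewrite mul1r.
by apply; exists 1, a.
Qed.

Lemma dpd_powR i (a : R) h x d : 0 < h x -> dpd i h x d ->
  dpd i (fun y => h y `^ a) x (a * h x `^ (a - 1) * d).
Proof. by move=> hx hd; exact: (dpd_comp hd (is_derive1_powR a hx)). Qed.

End PlaneCalculus.

(** * Test functions, smooth cutoffs and the symmetry of second derivatives *)

Section TestFunctions.
Context {R : realType}.
Implicit Types (f g h phi psi : R * R -> R) (x : R * R) (i j k : 'I_2) (n : nat).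
Implicit Types (Omega K : set (R * R)).

Lemma Cc_inftyI Omega K phi : (forall n, Ck n phi) -> compact K ->
  K `<=` Omega -> (forall x, ~ K x -> phi x = 0) -> Cc_infty Omega phi.
Proof.
move=> Cphi cK KO phi0.
have clK : closed K by apply: compact_closed => //; exact: norm_hausdorff.
have sK : closure [set x | phi x != 0] `<=` K.
  rewrite (closure_id K).1 //; apply: closureS => x /= xn0.
  by apply: contrapT => /phi0 px; rewrite px eqxx in xn0.
split => //; last exact: subset_trans KO.
by apply: (subclosed_compact _ cK sK); exact: closed_closure.
Qed.

Lemma Cc_infty_supp Omega phi : Cc_infty Omega phi ->
  exists K, [/\ compact K, K `<=` Omega & forall x, ~ K x -> phi x = 0].
Proof.
move=> [_ cK KO]; exists (closure [set x | phi x != 0]); split => // x.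
by move=> nx; apply/eqP/negP => /negP xn0; apply: nx; exact: subset_closure.
Qed.

Lemma Cc_infty_Ck Omega phi n : Cc_infty Omega phi -> Ck n phi.
Proof. by case. Qed.

Lemma Cc_infty_continuous Omega phi : Cc_infty Omega phi -> continuous phi.
Proof. by case=> /(_ 0) []. Qed.

Lemma Cc_infty_dpd Omega phi i x : Cc_infty Omega phi -> dpd i phi x (pd i phi x).
Proof. by case=> /(_ 1) /(Ck_dpd i x). Qed.

Lemma Cc_infty_pd Omega phi i : Cc_infty Omega phi -> Cc_infty Omega (pd i phi).
Proof.
move=> Cphi; have [K [cK KO K0]] := Cc_infty_supp Cphi.
apply: (@Cc_inftyI _ K) => // [n|x nKx]; first exact: Ck_pd (Cc_infty_Ck n.+1 Cphi).
have clK : closed K by apply: compact_closed => //; exact: norm_hausdorff.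
rewrite /pd (@near_eq_derive _ _ _ _ (cst 0)) ?derive_cst//.
by near do apply: K0; rewrite -/(~` K); apply: open_nbhs_nbhs; split => //; exact: closed_openC.
Unshelve. all: by end_near. Qed.

Lemma Cc_inftyM Omega phi psi : Cc_infty Omega phi -> (forall n, Ck n psi) ->
  Cc_infty Omega (fun x => phi x * psi x).
Proof.
move=> Cphi Cpsi; have [K [cK KO K0]] := Cc_infty_supp Cphi.
apply: (@Cc_inftyI _ K) => // [n|x /K0 ->]; last by rewrite mul0r.
by apply: CkM => //; exact: (Cc_infty_Ck n Cphi).
Qed.

Lemma Cc_infty_comp2 Omega (Phi : R -> R -> R) phi psi :
  Cc_infty Omega phi -> Cc_infty Omega psi -> Phi 0 0 = 0 ->
  (forall n, Ck n (fun x => Phi (phi x) (psi x))) ->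
  Cc_infty Omega (fun x => Phi (phi x) (psi x)).
Proof.
move=> Cphi Cpsi Phi0 CPhi; have [K [cK KO K0]] := Cc_infty_supp Cphi.
have [K' [cK' KO' K0']] := Cc_infty_supp Cpsi.
apply: (@Cc_inftyI _ (K `|` K')) => // [||x /not_orP[/K0 -> /K0' ->]//].
  exact: compactU.
by rewrite subUset.
Qed.

Lemma Cc_inftyD Omega phi psi : Cc_infty Omega phi -> Cc_infty Omega psi ->
  Cc_infty Omega (fun x => phi x + psi x).
Proof.
move=> Cphi Cpsi; apply: (@Cc_infty_comp2 _ (fun a b => a + b)) => //.
  by rewrite addr0.
by move=> n; exact: CkD (Cc_infty_Ck n Cphi) (Cc_infty_Ck n Cpsi).
Qed.

(** Raise $y/n \le 1 + y/n \le e^{y/n}$ to the power $n$. *)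
Lemma expR_ge_exprn n (y : R) : 0 <= y -> y ^+ n <= n%:R ^+ n * expR y.
Proof.
case: n => [|n] y0; first by rewrite !expr0 mul1r -{1}expR0 ler_expR.
have : (y / n.+1%:R) ^+ n.+1 <= expR (y / n.+1%:R) ^+ n.+1.
  rewrite lerXn2r ?nnegrE ?expR_ge0 ?divr_ge0//.
  by rewrite (le_trans _ (expR_ge1Dx _)) // lerDr.
rewrite -expRM_natl mulrCA divff ?pnatr_eq0// mulr1 expr_div_n.
by rewrite ler_pdivrMr ?exprn_gt0// mulrC.
Qed.

Lemma horner_expRN_bounded (P : {poly R}) :
  exists C : R, forall y, 0 <= y -> `|P.[y]| * expR (- y) <= C.
Proof.
exists (\sum_(i < size P) `|P`_i| * i%:R ^+ i) => y y0.
rewrite horner_coef (le_trans (ler_wpM2r (expR_ge0 _) (ler_norm_sum _ _ _)))//.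
rewrite mulr_suml ler_sum// => i _; rewrite normrM -mulrA ler_wpM2l//.
rewrite ger0_norm ?exprn_ge0// expRN ler_pdivrMr ?expR_gt0//.
exact: expR_ge_exprn.
Qed.

(* [exp (-1/t)] is smooth because its derivatives all have this form. *)
Definition flat (P : {poly R}) (t : R) : R :=
  if 0 < t then P.[t^-1] * expR (- t^-1) else 0.

(** Quadratic smallness at the origin is what makes the derivative vanish there. It follows from the
    boundedness of $y^2|P(y)|e^{-y}$ at $y = 1/t$. *)
Lemma flat_quadratic (P : {poly R}) : exists C : R, forall t, `|flat P t| <= C * t ^+ 2.
Proof.
have [C HC] := horner_expRN_bounded ('X^2 * P); exists C => t.
rewrite /flat; case: ifPn => [t0|_]; last first.
  rewrite normr0 mulr_ge0 ?sqr_ge0//; apply: le_trans (HC 0 (lexx _)).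
  by rewrite mulr_ge0 ?expR_ge0.
have := HC t^-1; rewrite invr_ge0 (ltW t0) => /(_ isT).
rewrite hornerM hornerXn normrM normrX (ger0_norm (_ : 0 <= t^-1)) ?invr_ge0 ?(ltW t0)//.
rewrite normrM (ger0_norm (expR_ge0 _)) -mulrA exprVn.
by rewrite mulrC ler_pdivrMr ?exprn_gt0// .
Qed.

(** For $t > 0$ the derivative of $P(1/t)e^{-1/t}$ is $t^{-2}(P - P')(1/t)\,e^{-1/t}$, which is the
    function attached to the polynomial $X^2(P - P')$. At 0 the difference quotient tends to 0 by
    [flat_quadratic]. *)
Lemma smooth_class_flat : smooth_class setT [set F | exists P, F = flat P].
Proof.
move=> _ [P ->]; exists (flat ('X^2 * (P - P^`()))); first by eexists.
move=> t _; have [t0|t0|<-] := ltgtP 0 t.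
- rewrite /flat t0.
  set D := (X in is_derive _ _ _ X).
  suff H : is_derive t 1 (fun s : R => P.[s^-1] * expR (- s^-1)) D.
    apply: near_eq_is_derive H.
    near=> s; rewrite ifT//; near: s; exact: lt_nbhsr.
  have dV : is_derive t 1 (fun s : R => s^-1) (- t ^- 2).
    have := @is_deriveV R id t 1 1 => /(_ (lt0r_neq0 t0) (is_derive_id _ _)).
    by rewrite scaler1.
  have d1 : is_derive t 1 (fun s => P.[s^-1]) (P^`().[t^-1] * - t ^- 2).
    exact: (is_derive1_comp (is_derive_poly P t^-1) dV).
  have d2 : is_derive t 1 (fun s => expR (- s^-1)) (expR (- t^-1) * - - t ^- 2).
    have dN : is_derive t 1 (fun s : R => - s^-1) (- - t ^- 2) by exact: is_deriveN.
    exact: (@is_derive1_comp _ expR (fun s => - s^-1) t _ _ (is_derive_expR _) dN).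
  have := is_deriveM d1 d2; move/is_derive_eq; apply.
  rewrite /D hornerM hornerXn hornerD hornerN /GRing.scale /= opprK exprVn; ring.
- rewrite /flat.
  rewrite ifF; last by rewrite ltNge ltW.
  have H : is_derive t 1 (cst 0 : R -> R) 0 by exact: is_derive_cst.
  apply: near_eq_is_derive H.
  near=> s; rewrite ltNge ltW//=; near: s; exact: lt_nbhsl.
- have -> : flat ('X^2 * (P - P^`())) 0 = 0 by rewrite /flat ltxx.
  have [C [C0 HC]] : exists C : R, 0 < C /\ forall t, `|flat P t| <= C * t ^+ 2.
    have [C HC] := flat_quadratic P; exists (`|C| + 1); split => [|s].
      by rewrite ltr_wpDl.
    rewrite (le_trans (HC s))// ler_wpM2r ?sqr_ge0//.
    by rewrite (le_trans (ler_norm C))// lerDl.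
  have E : (fun s : R => s^-1 *: ((flat P \o shift 0) (s *: 1) - flat P 0)) @ 0^' --> 0.
    apply/cvgr0Pnorm_lt => e e0; near=> s.
    have s0 : s != 0 by near: s; exact: nbhs_dnbhs_neq.
    rewrite /= addr0 [s%:A]mulr1 [flat P 0]/flat ltxx subr0 normrZ normfV.
    rewrite mulrC ltr_pdivrMr ?normr_gt0//.
    rewrite (le_lt_trans (HC s))// -real_normK ?num_real// expr2 mulrA.
    rewrite ltr_pM2r ?normr_gt0//.
    rewrite mulrC -ltr_pdivlMr//; near: s.
    by apply: dnbhs0_lt; rewrite divr_gt0.
  by split; [apply/cvg_ex; exists 0|apply/cvg_lim].
Unshelve. all: by end_near. Qed.

Definition flat1 : R -> R := flat 1.

Lemma flat1E t : 0 < t -> flat1 t = expR (- t^-1).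
Proof. by move=> t0; rewrite /flat1 /flat t0 hornerC mul1r. Qed.

Lemma flat1_le0 t : t <= 0 -> flat1 t = 0.
Proof. by move=> t0; rewrite /flat1 /flat ltNge t0. Qed.

Lemma flat1_ge0 t : 0 <= flat1 t.
Proof.
by have [/flat1_le0->|/flat1E->] := leP t 0; rewrite ?expR_ge0.
Qed.

Lemma flat1_le1 t : flat1 t <= 1.
Proof.
have [/flat1_le0->//|t0] := leP t 0; rewrite flat1E// -expR0 ler_expR oppr_le0.
by rewrite invr_ge0 ltW.
Qed.

Lemma Ck_flat1 n h : Ck n h -> Ck n (fun x => flat1 (h x)).
Proof.
move=> Ch; apply: (Ck_comp smooth_class_flat) => //; by exists 1.
Qed.

Lemma flat1_cvg t : 0 < t -> flat1 (n.+1%:R * t) @[n --> \oo] --> (1 : R).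
Proof.
move=> t0; have -> : (fun n => flat1 (n.+1%:R * t)) = (fun n => expR (- (n.+1%:R^-1 * t^-1))).
  by apply/funext => n; rewrite flat1E ?mulr_gt0// invfM.
rewrite -[X in _ --> X]expR0; apply: continuous_cvg; first exact: continuous_expR.
rewrite -oppr0; apply: cvgN; rewrite -[X in _ --> X](mul0r t^-1).
by apply: cvgM; [exact: cvg_harmonic|exact: cvg_cst].
Qed.

(** A product of four one-sided cutoffs: it vanishes off the open box, is bounded by 1 and tends
    pointwise to the indicator of that box. By dominated convergence, testing against these
    functions amounts to integrating over boxes. *)
Definition box_bump (a b c d : R) n (x : R * R) : R :=
  flat1 (n.+1%:R * (x.1 - a)) * flat1 (n.+1%:R * (b - x.1)) *
  (flat1 (n.+1%:R * (x.2 - c)) * flat1 (n.+1%:R * (d - x.2))).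

Lemma box_bump_Ck a b c d n m : Ck m (box_bump a b c d n).
Proof.
by rewrite /box_bump; do !apply: CkM; apply: Ck_flat1; apply: CkZ; apply: CkB;
  (exact: Ck_cst || exact: Ck_fst || exact: Ck_snd).
Qed.

Lemma box_bump_out a b c d n x :
  ~ (`]a, b[%classic `*` `]c, d[%classic) x -> box_bump a b c d n x = 0.
Proof.
rewrite /box_bump => nx.
have [xa|xa] := leP x.1 a.
  by rewrite (@flat1_le0 (_ * (x.1 - a))) ?mul0r// mulr_ge0_le0// subr_le0.
have [xb|xb] := leP b x.1.
  by rewrite (@flat1_le0 (_ * (b - x.1))) ?mulr0 ?mul0r// mulr_ge0_le0// subr_le0.
have [xc|xc] := leP x.2 c.
  by rewrite (@flat1_le0 (_ * (x.2 - c))) ?mul0r ?mulr0// mulr_ge0_le0// subr_le0.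
have [xd|xd] := leP d x.2.
  by rewrite (@flat1_le0 (_ * (d - x.2))) ?mulr0// mulr_ge0_le0// subr_le0.
by exfalso; apply: nx; split; rewrite /= in_itv /= ?xa ?xb ?xc ?xd.
Qed.

Lemma box_bump_cvg a b c d x :
  box_bump a b c d n x @[n --> \oo] --> (\1_(`]a, b[%classic `*` `]c, d[%classic) x : R).
Proof.
have [xin|xout] := pselect ((`]a, b[%classic `*` `]c, d[%classic) x).
  have -> : (\1_(`]a, b[%classic `*` `]c, d[%classic) x : R) = (1 * 1) * (1 * 1).
    by rewrite indicE mem_set// !mulr1.
  case: xin; rewrite /= !in_itv /= => /andP[? ?] /andP[? ?].
  by apply: cvgM; apply: cvgM; apply: flat1_cvg; rewrite subr_gt0.
rewrite indicE memNset//=; under eq_fun do rewrite box_bump_out//.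
exact: cvg_cst.
Qed.

Lemma box_bump_norm_le1 a b c d n x : `|box_bump a b c d n x| <= 1.
Proof.
rewrite ger0_norm /box_bump; last by rewrite !mulr_ge0 ?flat1_ge0.
by rewrite -(mulr1 1) ler_pM ?mulr_ge0 ?flat1_ge0// mulr_ile1 ?flat1_ge0 ?flat1_le1.
Qed.

Lemma box_bump_Cc Omega a b c d n : `[a, b]%classic `*` `[c, d]%classic `<=` Omega ->
  Cc_infty Omega (box_bump a b c d n).
Proof.
move=> sO; apply: (@Cc_inftyI _ (`[a, b]%classic `*` `[c, d]%classic)) => //.
- by move=> m; exact: box_bump_Ck.
- by apply: compact_setX; exact: segment_compact.
- move=> x nx; apply: box_bump_out => -[x1 x2]; apply: nx; split;
    exact: subset_itv_oo_cc.
Qed.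

Lemma dpd_slice0 phi (s y d : R) : dpd ord0 phi (s, y) d ->
  is_derive s 1 (fun t => phi (t, y)) d.
Proof.
move=> [hd <-].
have E : (fun t : R => t^-1 *: (((phi : R * R -> R^o) \o shift (s, y)) (t *: axis ord0) - phi (s, y)))
  = (fun t : R => t^-1 *: (((fun t => phi (t, y)) \o shift s) (t *: 1) - phi (s, y))).
  apply/funext => t /=; congr (_ *: (phi _ - _)).
  by rewrite /axis /= [LHS]surjective_pairing /= [t *: 0]mulr0 add0r.
split; first by move: hd; rewrite /derivable E.
by rewrite /derive E.
Qed.

Lemma dpd_slice1 phi (s y d : R) : dpd ord_max phi (s, y) d ->
  is_derive y 1 (fun t => phi (s, t)) d.
Proof.
move=> [hd <-].
have E : (fun t : R => t^-1 *: (((phi : R * R -> R^o) \o shift (s, y)) (t *: axis ord_max) - phi (s, y)))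
  = (fun t : R => t^-1 *: (((fun t => phi (s, t)) \o shift y) (t *: 1) - phi (s, y))).
  apply/funext => t /=; congr (_ *: (phi _ - _)).
  by rewrite /axis /= [LHS]surjective_pairing /= [t *: 0]mulr0 add0r.
split; first by move: hd; rewrite /derivable E.
by rewrite /derive E.
Qed.

Lemma MVT_derive (F dF : R -> R) (a b : R) : a < b ->
  (forall t : R, is_derive t 1 F (dF t)) ->
  exists2 c, a < c < b & F b - F a = dF c * (b - a).
Proof.
move=> ab dFd; have [|c cab ->] := @MVT R F dF a b ab (fun t _ => dFd t); last by exists c.
apply: derivable_within_continuous => t _.
by have /@ex_derive := dFd t.
Qed.

(** This is the limiting step for mixed derivatives: two applications of the mean value theorem
    yield equal values at two different intermediate points, and only continuity brings them to the
    same point. *)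
Lemma continuous_eq_of_near (A B : R * R -> R) (x y : R) :
  continuous A -> continuous B ->
  (forall h : R, 0 < h -> exists P Q : R * R,
    [/\ x < P.1 < x + h, y < P.2 < y + h, x < Q.1 < x + h, y < Q.2 < y + h
      & A P = B Q]) -> A (x, y) = B (x, y).
Proof.
move=> cA cB key.
apply/eqP; rewrite -subr_eq0 -normr_le0; apply/ler_addgt0Pr => e e0; rewrite add0r.
have e2 : 0 < e / 2 by rewrite divr_gt0.
have /nbhs_ballP[r1 r10 Hr1] : \forall z \near (x, y), `|A (x, y) - A z| < e / 2.
  exact: (@cvgr_dist_lt _ _ _ _ _ _ _ (cA (x, y))).
have /nbhs_ballP[r2 r20 Hr2] : \forall z \near (x, y), `|B (x, y) - B z| < e / 2.
  exact: (@cvgr_dist_lt _ _ _ _ _ _ _ (cB (x, y))).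
have dist (a b r : R) : a < b < a + Num.min r1 r2 -> Num.min r1 r2 <= r -> `|a - b| < r.
  move=> /andP[ab ba] rr; rewrite ltr0_norm; last by rewrite subr_lt0.
  by rewrite opprB ltrBlDl (lt_le_trans ba) // lerD2l.
have [|P [Q [P1 P2 Q1 Q2 E]]] := key (Num.min r1 r2).
  by rewrite lt_min; apply/andP; split; [exact: r10|exact: r20].
have HP : `|A (x, y) - A P| < e / 2.
  apply: Hr1; split; rewrite -ball_normE /=; [apply: dist P1 _|apply: dist P2 _];
    by rewrite ge_min lexx.
have HQ : `|B (x, y) - B Q| < e / 2.
  apply: Hr2; split; rewrite -ball_normE /=; [apply: dist Q1 _|apply: dist Q2 _];
    by rewrite ge_min lexx orbT.
have -> : A (x, y) - B (x, y) = (A (x, y) - A P) - (B (x, y) - B Q).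
  by rewrite E; ring.
rewrite (le_trans (ler_normB _ _))//; lra.
Qed.

(** The second difference of [phi] over a square of side $h$, divided by $h^2$, is by the mean value
    theorem used twice a value of either mixed derivative in that square. The order in which the two
    variables are treated decides which one; then $h$ is taken arbitrarily small. *)
Lemma pd_symm phi x : Ck 2 phi ->
  pd ord0 (pd ord_max phi) x = pd ord_max (pd ord0 phi) x.
Proof.
case: x => x y C2.
have C1 i : Ck 1 (pd i phi) by exact: Ck_pd C2.
set A := pd ord_max (pd ord0 phi); set B := pd ord0 (pd ord_max phi).
have cA : continuous A by exact: (Ck_continuous (Ck_pd ord_max (C1 ord0))).
have cB : continuous B by exact: (Ck_continuous (Ck_pd ord0 (C1 ord_max))).
have key (h : R) : 0 < h -> exists P Q : R * R,
  [/\ x < P.1 < x + h, y < P.2 < y + h, x < Q.1 < x + h, y < Q.2 < y + h & A P = B Q].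
  move=> h0.
  have xh : x < x + h by rewrite ltrDl.
  have yh : y < y + h by rewrite ltrDl.
  have [c cx Ec] := @MVT_derive (fun s => phi (s, y + h) - phi (s, y))
    (fun s => pd ord0 phi (s, y + h) - pd ord0 phi (s, y)) x (x + h) xh
    (fun t => is_deriveB (dpd_slice0 (Ck_dpd ord0 (t, y + h) C2)) (dpd_slice0 (Ck_dpd ord0 (t, y) C2))).
  have [d dy Ed] := @MVT_derive (fun s => pd ord0 phi (c, s)) (fun s => A (c, s)) y (y + h) yh
    (fun t => dpd_slice1 (Ck_dpd ord_max (c, t) (C1 ord0))).
  have [c' cy' Ec'] := @MVT_derive (fun s => phi (x + h, s) - phi (x, s))
    (fun s => pd ord_max phi (x + h, s) - pd ord_max phi (x, s)) y (y + h) yh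
    (fun t => is_deriveB (dpd_slice1 (Ck_dpd ord_max (x + h, t) C2)) (dpd_slice1 (Ck_dpd ord_max (x, t) C2))).
  have [d' dx' Ed'] := @MVT_derive (fun s => pd ord_max phi (s, c')) (fun s => B (s, c')) x (x + h) xh
    (fun t => dpd_slice0 (Ck_dpd ord0 (t, c') (C1 ord_max))).
  exists (c, d), (d', c'); split; [exact: cx|exact: dy|exact: dx'|exact: cy'|].
  rewrite Ed in Ec; rewrite Ed' in Ec'.
  have E : A (c, d) * (y + h - y) * (x + h - x) = B (d', c') * (x + h - x) * (y + h - y).
    rewrite -Ec -Ec'; ring.
  move: E; rewrite ![_ + h - _]addrAC !subrr !add0r.
  by move=> /(mulIf (lt0r_neq0 h0))/(mulIf (lt0r_neq0 h0)).
apply/esym; exact: continuous_eq_of_near cA cB key.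
Qed.

End TestFunctions.

(** * Plane Lebesgue measure and integration by parts *)

Section PlaneMeasure.
Context {R : realType}.
Implicit Types (f g h phi psi : R * R -> R) (x : R * R) (i j k : 'I_2) (n : nat).
Implicit Types (Omega K A : set (R * R)).
Local Notation leb := (@lebesgue_measure R).
(* Definitions over [R * R] use the default Borel structure of [R], whereas
   [leb2] lives on [measurableTypeR R]: the two structures are convertible. *)
Local Notation TT := (measurableTypeR R * measurableTypeR R)%type.

Definition obox (a b c d : R) : set (R * R) := `]a, b[%classic `*` `]c, d[%classic.
Definition cbox (a b c d : R) : set (R * R) := `[a, b]%classic `*` `[c, d]%classic.

Lemma measurable_obox a b c d : measurable (obox a b c d : set TT).
Proof. by apply: measurableX; exact: measurable_itv. Qed.

Lemma measurable_cbox a b c d : measurable (cbox a b c d : set TT).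
Proof. by apply: measurableX; exact: measurable_itv. Qed.

Lemma obox_sub_cbox a b c d : obox a b c d `<=` cbox a b c d.
Proof. by move=> y [y1 y2]; split; exact: subset_itv_oo_cc. Qed.

Lemma leb2_cbox_lty a b c d : (leb2 (cbox a b c d) < +oo)%E.
Proof.
have -> : leb2 (cbox a b c d) = (leb `[a, b]%classic * leb `[c, d]%classic)%E.
  by rewrite -product_measure1E//; exact: measurable_itv.
by rewrite !lebesgue_measure_itv /=; case: ifP; case: ifP;
  rewrite ?mul0e ?mule0 -?EFinM ltry.
Qed.

Lemma compact_cbox a b c d : compact (cbox a b c d).
Proof. by apply: compact_setX; exact: segment_compact. Qed.

(** Boxes with rational corners suffice. The closed boxes are required to lie in [A] as well, since
    a bump of the open box must be a test function of [A]. *)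
Lemma open_eq_bigcup_obox A : open A -> exists a b c d : nat -> R,
  (forall n, cbox (a n) (b n) (c n) (d n) `<=` A) /\
  A = \bigcup_n obox (a n) (b n) (c n) (d n).
Proof.
move=> oA.
pose B (q : rat * rat * (rat * rat)) : R * R * (R * R) :=
  ((ratr q.1.1, ratr q.1.2), (ratr q.2.1, ratr q.2.2)).
pose ok q := cbox (B q).1.1 (B q).1.2 (B q).2.1 (B q).2.2 `<=` A.
(* Integers that encode no admissible box are sent to the box with sides from 1 to 0, which is empty
   even when closed. *)
pose e n : R * R * (R * R) := if unpickle n is Some q then
  if asbool (ok q) then B q else ((1, 0), (1, 0)) else ((1, 0), (1, 0)).
exists (fun n => (e n).1.1), (fun n => (e n).1.2), (fun n => (e n).2.1), (fun n => (e n).2.2).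
have okn n : cbox (e n).1.1 (e n).1.2 (e n).2.1 (e n).2.2 `<=` A.
  have E : cbox (1 : R) 0 1 0 `<=` A.
    by move=> y [/=]; rewrite in_itv /= => /andP[y1 y2]; have := le_trans y1 y2; rewrite ler10.
  rewrite /e; case: unpickle => [q|]; last exact: E.
  by case: asboolP => // _; exact: E.
split=> //; rewrite eqEsubset; split => [y Ay|y [n _ /obox_sub_cbox/okn]//].
have /nbhs_ballP[r r0 Hr] : nbhs y A by apply: open_nbhs_nbhs; split.
have near1 (t : R) : exists p q : rat, t - r < ratr p < t /\ t < ratr q < t + r.
  have tr : t - r < t by rewrite ltrBlDr ltrDl; exact: r0.
  have rt : t < t + r by rewrite ltrDl; exact: r0.
  have [p] := rat_in_itvoo tr; have [q] := rat_in_itvoo rt.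
  by rewrite !in_itv /= => tq tp; exists p, q.
have [p1 [q1 [/andP[a1 a2] /andP[a3 a4]]]] := near1 y.1.
have [p2 [q2 [/andP[b1 b2] /andP[b3 b4]]]] := near1 y.2.
pose Q := ((p1, q1), (p2, q2)).
have okQ : ok Q.
  move=> z [/=]; rewrite !in_itv /= => /andP[z1 z2] /andP[z3 z4].
  apply: Hr; split; rewrite -ball_normE /= ltr_norml; apply/andP; split; lra.
exists (pickle Q) => //; rewrite /e pickleK; case: asboolP => // _.
by split; rewrite /= in_itv /= ?a2 ?a3 ?b2 ?b3.
Qed.

Lemma open_measurable_plane A : open A -> measurable (A : set TT).
Proof.
move=> /open_eq_bigcup_obox[a [b [c [d [_ ->]]]]].
by apply: bigcup_measurable => n _; exact: measurable_obox.
Qed.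

Lemma compact_measurable_plane K : compact K -> measurable (K : set TT).
Proof.
move=> cK; rewrite -[K]setCK; apply: measurableC; apply: open_measurable_plane.
by apply: closed_openC; apply: compact_closed => //; exact: norm_hausdorff.
Qed.

Lemma continuous_measurable_plane (D : set TT) f : continuous f -> measurable_fun D (f : TT -> R).
Proof.
move=> cf; apply: measurable_funTS.
apply: (measurability _ (RGenOpens.measurableE R)) => _ [_ [s [t ->]] <-].
rewrite setTI; apply: open_measurable_plane.
by move/continuousP : cf; apply; exact: interval_open.
Qed.

Lemma bounded_sub_cbox K : bounded_set K -> exists M : R, 0 < M /\
  forall x, K x -> - M < x.1 < M /\ - M < x.2 < M.
Proof.
move=> [M [Mr HM]]; exists (`|M| + 2); split; first by rewrite ltr_wpDl.
move=> x /(HM (`|M| + 1)) Hx.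
have /Hx : M < `|M| + 1 by rewrite (le_lt_trans (ler_norm _))// ltrDl.
rewrite /= prod_normE /= ge_max => /andP[]; rewrite !ler_norml => /andP[? ?] /andP[? ?].
by split; apply/andP; split; lra.
Qed.

Lemma bounded_leb2_lty A : measurable (A : set TT) -> bounded_set A -> (leb2 A < +oo)%E.
Proof.
move=> mA /bounded_sub_cbox[M [M0 HM]].
apply: le_lt_trans (leb2_cbox_lty (- M) M (- M) M).
apply: le_measure; rewrite ?inE//; first exact: measurable_cbox.
by move=> x /HM[/andP[a b] /andP[c d]]; split; rewrite /= in_itv /= ?(ltW a) ?(ltW b) ?(ltW c) ?(ltW d).
Qed.

(** Vanishing off the open box includes the boundary, where primitives are evaluated in the
    fundamental theorem of calculus. *)
Lemma Cc_infty_cbox Omega phi : Cc_infty Omega phi -> exists M : R, 0 < M /\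
  forall x, ~ cbox (- M) M (- M) M x \/ ~ obox (- M) M (- M) M x -> phi x = 0.
Proof.
move=> /Cc_infty_supp[K [cK _ K0]].
have [M [M0 HM]] := bounded_sub_cbox (compact_bounded cK).
exists M; split => // x H; apply: K0 => /HM[/andP[a b] /andP[c d]].
by case: H; apply; split; rewrite /= in_itv /= ?a ?b ?c ?d ?(ltW a) ?(ltW b) ?(ltW c) ?(ltW d).
Qed.

Lemma Cc_infty_bounded Omega phi : Cc_infty Omega phi ->
  exists M : R, 0 <= M /\ forall x, `|phi x| <= M.
Proof.
move=> Cphi; have [K [cK _ K0]] := Cc_infty_supp Cphi.
have : compact (phi @` K).
  apply: continuous_compact => //; apply: continuous_subspaceT.
  exact: Cc_infty_continuous Cphi.
move=> /compact_bounded[M [Mr HM]]; exists (`|M| + 1); split; first by rewrite addr_ge0.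
move=> x; have [/K0 ->|/contrapT Kx] := pselect (~ K x); first by rewrite normr0 addr_ge0.
by apply: (HM (`|M| + 1)); [rewrite (le_lt_trans (ler_norm _))// ltrDl|exists x].
Qed.

Lemma Cc_infty_measurable Omega phi (D : set TT) : Cc_infty Omega phi ->
  measurable_fun D (phi : TT -> R).
Proof. by move=> Cphi; apply: continuous_measurable_plane; exact: Cc_infty_continuous Cphi. Qed.

Lemma Cc_infty_integrable Omega phi (D : set TT) : measurable D -> Cc_infty Omega phi ->
  leb2.-integrable D (EFin \o phi).
Proof.
move=> mD Cphi; apply: (integrableS measurableT) => //.
have [M [M0 HM]] := Cc_infty_cbox Cphi.
have -> : EFin \o phi = (EFin \o phi) \_ (cbox (- M) M (- M) M).
  apply/funext => x; rewrite patchE; case: ifPn => // /negP; rewrite inE => nx /=.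
  by rewrite HM//; left.
apply/(integrable_mkcond _ (measurable_cbox (- M) M (- M) M)).
apply: measurable_bounded_integrable.
- exact: measurable_cbox.
- exact: leb2_cbox_lty.
- exact: Cc_infty_measurable Cphi.
- have [N [N0 HN]] := Cc_infty_bounded Cphi.
  by exists N; split; rewrite ?num_real// => t Nt y _ /=; rewrite (le_trans (HN y))// ltW.
Qed.

Lemma line_FTC (F f : R -> R) (a b : R) : a <= b -> (forall t : R, is_derive t 1 F (f t)) ->
  continuous f -> (\int[leb]_(t in `[a, b]) (f t)%:E = (F b - F a)%:E)%E.
Proof.
rewrite le_eqVlt => /orP[/eqP <-|ab] dF cf.
  by rewrite set_itv1 integral_set1 subrr.
rewrite (continuous_FTC2 (F := F) ab) ?EFinB//.
- exact: continuous_subspaceT.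
- have cF : continuous F.
    move=> t; apply: differentiable_continuous; apply/derivable1_diffP.
    by have /@ex_derive := dF t.
  split; first by move=> t _; have /@ex_derive := dF t.
    by apply: cvg_at_right_filter; exact: cF.
  by apply: cvg_at_left_filter; exact: cF.
- by move=> t _; rewrite derive1E; have /@derive_val := dF t.
Qed.

Lemma line_integral_eq0 (F f : R -> R) (M : R) : 0 < M ->
  (forall t : R, is_derive t 1 F (f t)) -> continuous f -> F M = 0 -> F (- M) = 0 ->
  (forall t, ~ `[- M, M]%classic t -> f t = 0) -> (\int[leb]_t (f t)%:E = 0)%E.
Proof.
move=> M0 dF cf FM FNM f0.
have -> : (fun t => (f t)%:E) = (fun t => (f t)%:E) \_ `[- M, M].
  apply/funext => t; rewrite patchE; case: ifPn => // /negP; rewrite inE => nt.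
  by rewrite f0.
rewrite -integral_mkcond (line_FTC _ dF) ?FM ?FNM ?subrr//.
by rewrite (@le_trans _ _ 0)// ?oppr_le0 ltW.
Qed.

Lemma line_abs_le (F f : R -> R) (M s : R) :
  (forall t : R, is_derive t 1 F (f t)) -> continuous f -> F (- M) = 0 ->
  (forall t, t < - M -> F t = 0) ->
  (`|F s|%:E <= \int[leb]_t `|f t|%:E)%E.
Proof.
move=> dF cf FNM F0.
have [sM|Ms] := ltP s (- M).
  by rewrite F0// normr0; apply: integral_ge0 => t _; rewrite lee_fin.
have mf : measurable_fun setT f by exact: continuous_measurable_fun.
have -> : F s = F s - F (- M) by rewrite FNM subr0.
rewrite -abse_EFin -(line_FTC Ms dF cf).
apply: (le_trans (le_abse_integral _ _ _)) => //.
  by apply/measurable_EFinP; exact: measurable_funTS.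
apply: ge0_subset_integral => //.
by do 2 apply: measurableT_comp => //.
Qed.

Lemma Cc_infty_slice0 Omega phi y : Cc_infty Omega phi ->
  continuous (fun s => phi (s, y)).
Proof.
move=> Cphi s; apply: differentiable_continuous; apply/derivable1_diffP.
by have /@ex_derive := dpd_slice0 (Cc_infty_dpd ord0 (s, y) Cphi).
Qed.

Lemma Cc_infty_slice1 Omega phi s : Cc_infty Omega phi ->
  continuous (fun y => phi (s, y)).
Proof.
move=> Cphi y; apply: differentiable_continuous; apply/derivable1_diffP.
by have /@ex_derive := dpd_slice1 (Cc_infty_dpd ord_max (s, y) Cphi).
Qed.

Lemma ord2P (P : 'I_2 -> Prop) : P ord0 -> P ord_max -> forall i, P i.
Proof.
move=> P0 P1 i; case: (eqVneq i ord0) => [->//|i0].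
by have -> : i = ord_max by apply/val_inj; case: i i0 => -[|[|]].
Qed.

Lemma integral_pd_eq0 Omega phi i : Cc_infty Omega phi ->
  (\int[leb2]_x (pd i phi x)%:E = 0)%E.
Proof.
move=> Cphi; have Cd := Cc_infty_pd _ Cphi.
have id k : leb2.-integrable setT (EFin \o pd k phi).
  by apply: Cc_infty_integrable (Cd k).
have [M [M0 HM]] := Cc_infty_cbox Cphi.
have [M' [M'0 HM']] := Cc_infty_cbox (Cd i).
(* One radius for both functions: [phi] must vanish at the end points of the segment, and its
   derivative outside the segment. *)
pose N := Num.max M M'.
have MN : M <= N by rewrite le_max lexx.
have M'N : M' <= N by rewrite le_max lexx orbT.
have N0 : 0 < N by rewrite (lt_le_trans M0).
elim/ord2P: i M' HM' M'0 N MN M'N N0 => M' HM' M'0 N MN M'N N0.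
- rewrite -(integral21_prod_meas1 (id ord0)) /= integral0_eq// => y _.
  apply: (line_integral_eq0 (F := fun s => phi (s, y)) N0).
  + by move=> t; apply: dpd_slice0; exact: Cc_infty_dpd Cphi.
  + exact: Cc_infty_slice0 (Cd ord0).
  + by apply: HM; right => -[/=]; rewrite in_itv /= => /andP[_]; rewrite ltNge MN.
  + by apply: HM; right => -[/=]; rewrite in_itv /= => /andP[]; rewrite ltrN2 ltNge MN.
  + move=> t nt; apply: HM'; left => -[/=]; rewrite in_itv /= => /andP[a b] _; apply: nt.
    by rewrite /= in_itv /= (le_trans b M'N) (le_trans _ a)// lerN2.
- rewrite -(integral12_prod_meas1 (id ord_max)) /= integral0_eq// => s _.
  apply: (line_integral_eq0 (F := fun y => phi (s, y)) N0).
  + by move=> t; apply: dpd_slice1; exact: Cc_infty_dpd Cphi.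
  + exact: Cc_infty_slice1 (Cd ord_max).
  + by apply: HM; right => -[_ /=]; rewrite in_itv /= => /andP[_]; rewrite ltNge MN.
  + by apply: HM; right => -[_ /=]; rewrite in_itv /= => /andP[]; rewrite ltrN2 ltNge MN.
  + move=> t nt; apply: HM'; left => -[/= _]; rewrite in_itv /= => /andP[a b]; apply: nt.
    by rewrite /= in_itv /= (le_trans b M'N) (le_trans _ a)// lerN2.
Qed.

Lemma integral_Cc_infty Omega phi : Cc_infty Omega phi ->
  \int[leb2]_(x in Omega) phi x = \int[leb2]_x phi x.
Proof.
move=> /Cc_infty_supp[K [_ KO K0]]; rewrite Rintegral_mkcond; congr (Rintegral _ _ _).
apply/funext => x; rewrite patchE; case: ifPn => // /negP; rewrite inE => nx.
by rewrite K0// => /KO.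
Qed.

(** The two sides differ by the integral of a derivative of the test function [phi * psi], which is
    0. *)
Lemma Cc_infty_is_weak_pd Omega i phi : measurable (Omega : set TT) ->
  Cc_infty Omega phi -> is_weak_pd Omega i phi (pd i phi).
Proof.
move=> mO Cphi; have Cd := Cc_infty_pd i Cphi.
have loc psi : Cc_infty Omega psi -> loc_integrable Omega psi.
  move=> Cpsi; split; first by apply: (Cc_infty_measurable (D := Omega) Cpsi).
  by move=> K _ cK; apply: Cc_infty_integrable Cpsi; exact: compact_measurable_plane.
split; [exact: loc|exact: loc|] => psi Cpsi.
rewrite /distr_pd; apply/eqP; rewrite -addr_eq0; apply/eqP.
have C1 : Cc_infty Omega (fun x => pd i phi x * psi x).
  by apply: Cc_inftyM Cd _ => n; exact: Cc_infty_Ck Cpsi.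
have C2 : Cc_infty Omega (fun x => phi x * pd i psi x).
  by apply: Cc_inftyM Cphi _ => n; exact: Cc_infty_Ck (Cc_infty_pd i Cpsi).
rewrite -RintegralD//; [|exact: (Cc_infty_integrable mO C1)|exact: (Cc_infty_integrable mO C2)].
have -> : (fun x => pd i phi x * psi x + phi x * pd i psi x)
    = pd i (fun x => phi x * psi x).
  apply/funext => x; rewrite (dpdE (dpdM (Cc_infty_dpd i x Cphi) (Cc_infty_dpd i x Cpsi))).
  by rewrite addrC; congr (_ + _); rewrite mulrC.
have C3 : Cc_infty Omega (fun x => phi x * psi x).
  by apply: Cc_inftyM Cphi _ => n; exact: Cc_infty_Ck Cpsi.
rewrite integral_Cc_infty; last exact: Cc_infty_pd.
by rewrite /Rintegral (integral_pd_eq0 _ C3).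
Qed.

End PlaneMeasure.

(** * Weak derivatives and H10 *)

Section WeakUniqueness.
Context {R : realType}.
Implicit Types (f g h phi psi : R * R -> R) (x : R * R) (i j k : 'I_2) (n : nat).
Implicit Types (Omega K : set (R * R)).
Local Notation leb := (@lebesgue_measure R).
Local Notation TT := (measurableTypeR R * measurableTypeR R)%type.

Lemma ae_mono (P Q : TT -> Prop) : (forall x, P x -> Q x) ->
  {ae leb2, forall x, P x} -> {ae leb2, forall x, Q x}.
Proof. by move=> PQ; exact: (@filterS _ _ (ae_filter_ringOfSetsType leb2)). Qed.

Lemma ae_mono2 (P Q S : TT -> Prop) : (forall x, P x -> Q x -> S x) ->
  {ae leb2, forall x, P x} -> {ae leb2, forall x, Q x} -> {ae leb2, forall x, S x}.
Proof. by move=> PQS; exact: (@filterS2 _ _ (ae_filter_ringOfSetsType leb2)). Qed.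

(** The sets over which a signed integral vanishes form a Dynkin system, so a generating family
    stable under intersection suffices. The map [t] is left general in order to vary one coordinate
    at a time with [fst] and [snd], and then the whole point with [id]. *)
Lemma integral_preimage_eq0 d (T : measurableType d) (G : set (set T)) (t : TT -> T)
    (S : set TT) (g : TT -> R) :
  measurable_fun setT t -> measurable S -> leb2.-integrable S (EFin \o g) ->
  @measurable _ T = <<s G >> -> setI_closed G ->
  (\int[leb2]_(x in S) (g x)%:E = 0)%E ->
  (forall A, G A -> (\int[leb2]_(x in t @^-1` A `&` S) (g x)%:E = 0)%E) ->
  forall A, measurable A -> (\int[leb2]_(x in t @^-1` A `&` S) (g x)%:E = 0)%E.
Proof.
move=> mt mS ig GE GI gS gG A mA.
have mtA B : measurable B -> measurable (t @^-1` B `&` S).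
  by move=> mB; apply: measurableI => //; rewrite -[X in measurable X]setTI; exact: mt.
have igA B : measurable B -> leb2.-integrable (t @^-1` B `&` S) (EFin \o g).
  move=> mB; apply: integrableS ig => //; exact: mtA.
apply: (dynkin_induction (P := fun A => (\int[leb2]_(x in t @^-1` A `&` S) (g x)%:E = 0)%E) GE GI).
- by rewrite preimage_setT setTI.
- by move=> B /gG.
- move=> B mB B0.
  have E : S = (t @^-1` B `&` S) `|` (t @^-1` (~` B) `&` S).
    by rewrite -setIUl -preimage_setU setUv preimage_setT setTI.
  have : (\int[leb2]_(x in (t @^-1` B `&` S) `|` (t @^-1` (~` B) `&` S)) (g x)%:E = 0)%E.
    by rewrite -E.
  rewrite integral_setU ?B0 ?add0e//.
  + exact: mtA.
  + by apply: mtA; exact: measurableC.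
  + by rewrite -E; exact: measurable_int ig.
  + by apply/disj_setPS => y [[By _] [nBy _]]; exact: nBy.
- move=> F mF tF F0.
  have E : t @^-1` (\bigcup_k F k) `&` S = \bigcup_k (t @^-1` (F k) `&` S).
    by rewrite preimage_bigcup setI_bigcupl.
  rewrite E integral_bigcup.
  + by rewrite eseries0// => n _ _; exact: F0.
  + apply/trivIsetP => m n _ _ mn.
    rewrite setIACA setIid -preimage_setI.
    by move/trivIsetP : tF => /(_ m n Logic.I Logic.I mn) ->; rewrite preimage_set0 set0I.
  + by move=> n; exact: mtA.
  + by rewrite -E; apply: igA; exact: bigcup_measurable.
- by rewrite -GE.
Qed.

Lemma setI_closed_ray : setI_closed (@RGenOInfty.G R).
Proof.
move=> _ _ [a ->] [b ->]; exists (Num.max a b); apply/seteqP; split => y /=;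
  rewrite !in_itv /= !andbT gt_max; [by move=> [-> ->]|by move=> /andP[]].
Qed.

Lemma preimage_rays_obox (a b c d s t : R) :
  snd @^-1` `]t, +oo[%classic `&` (fst @^-1` `]s, +oo[%classic `&` obox a b c d)
  = obox (Num.max s a) b (Num.max t c) d.
Proof.
apply/seteqP; split => -[y z] /=; rewrite /obox /= !in_itv /= !andbT !gt_max.
  by move=> [tz [sy [/andP[-> ->] /andP[-> ->]]]]; rewrite tz sy.
by move=> [/andP[/andP[-> ->] ->] /andP[/andP[-> ->] ->]].
Qed.

Lemma preimage_ray_fst_obox (a b c d s : R) :
  fst @^-1` `]s, +oo[%classic `&` obox a b c d = obox (Num.max s a) b c d.
Proof.
apply/seteqP; split => -[y z] /=; rewrite /obox /= !in_itv /= !andbT !gt_max.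
  by move=> [-> [/andP[-> ->] ->]].
by move=> [/andP[/andP[-> ->] ->] ->].
Qed.

Lemma preimage_ray_snd_obox (a b c d t : R) :
  snd @^-1` `]t, +oo[%classic `&` obox a b c d = obox a b (Num.max t c) d.
Proof.
apply/seteqP; split => -[y z] /=; rewrite /obox /= !in_itv /= !andbT !gt_max.
  by move=> [-> [/andP[-> ->] /andP[-> ->]]].
by move=> [/andP[-> ->] /andP[/andP[-> ->] ->]].
Qed.

(** Truncating a box from below and from the left tests [g] against products of rays. A Dynkin
    argument in the first coordinate, one in the second and one on the rectangles extend this to all
    measurable subsets of the box, and a function with zero integral over all of them vanishes
    almost everywhere. *)
Lemma integral_obox_ae_eq0 (g : TT -> R) (a b c d : R) :
  leb2.-integrable (obox a b c d) (EFin \o g) ->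
  (forall s t, (\int[leb2]_(x in obox (Num.max s a) b (Num.max t c) d) (g x)%:E = 0)%E) ->
  {ae leb2, forall x, obox a b c d x -> g x = 0}.
Proof.
move=> ig g0.
have mQ := measurable_obox a b c d.
have mray (t : R) : measurable (`]t, +oo[%classic : set (measurableTypeR R)).
  exact: measurable_itv.
have whole : (\int[leb2]_(x in obox a b c d) (g x)%:E = 0)%E.
  by have := g0 a c; rewrite !maxxx.
have half1 s : (\int[leb2]_(x in fst @^-1` `]s, +oo[%classic `&` obox a b c d) (g x)%:E = 0)%E.
  by have := g0 s c; rewrite maxxx preimage_ray_fst_obox.
have step1 t (A : set (measurableTypeR R)) : measurable A ->
    (\int[leb2]_(x in fst @^-1` A `&` (snd @^-1` `]t, +oo[%classic `&` obox a b c d)) (g x)%:E = 0)%E.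
  apply: (@integral_preimage_eq0 _ _ (@RGenOInfty.G R) fst) => //.
  - apply: measurableI => //; rewrite -[X in measurable X]setTI; exact: measurable_snd.
  - apply: integrableS ig => //.
    apply: measurableI => //; rewrite -[X in measurable X]setTI; exact: measurable_snd.
  - exact: RGenOInfty.measurableE.
  - exact: setI_closed_ray.
  - by have := g0 a t; rewrite maxxx preimage_ray_snd_obox.
  - by move=> _ [s ->]; rewrite setICA preimage_rays_obox.
have step2 (A B : set (measurableTypeR R)) : measurable A -> measurable B ->
    (\int[leb2]_(x in snd @^-1` B `&` (fst @^-1` A `&` obox a b c d)) (g x)%:E = 0)%E.
  move=> mA; apply: (@integral_preimage_eq0 _ _ (@RGenOInfty.G R) snd) => //.
  - apply: measurableI => //; rewrite -[X in measurable X]setTI; exact: measurable_fst.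
  - apply: integrableS ig => //.
    apply: measurableI => //; rewrite -[X in measurable X]setTI; exact: measurable_fst.
  - exact: RGenOInfty.measurableE.
  - exact: setI_closed_ray.
  - apply: (@integral_preimage_eq0 _ _ (@RGenOInfty.G R) fst) => //.
    + exact: RGenOInfty.measurableE.
    + exact: setI_closed_ray.
    + by move=> _ [s ->]; exact: half1.
  - by move=> _ [t ->]; rewrite setICA; exact: step1.
have step3 (E : set TT) : measurable E ->
    (\int[leb2]_(x in id @^-1` E `&` obox a b c d) (g x)%:E = 0)%E.
  pose G := [set A `*` B | A in @measurable _ (measurableTypeR R) & B in @measurable _ (measurableTypeR R)].
  apply: (@integral_preimage_eq0 _ _ G id) => //.
  - exact: measurable_prod_measurableType.
  - move=> _ _ [A1 mA1 [B1 mB1 <-]] [A2 mA2 [B2 mB2 <-]].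
    exists (A1 `&` A2); first exact: measurableI.
    by exists (B1 `&` B2); [exact: measurableI|rewrite setXI].
  - move=> _ [A mA [B mB <-]].
    have -> : id @^-1` (A `*` B) `&` obox a b c d = snd @^-1` B `&` (fst @^-1` A `&` obox a b c d).
      by apply/seteqP; split => y; [move=> [[y1 y2] y3]; split|move=> [y1 [y2 y3]]; split].
    exact: step2.
have : ae_eq leb2 (obox a b c d) (EFin \o g) (cst 0%E).
  apply: integral_ae_eq => // E EQ mE.
  by have := step3 _ mE; rewrite preimage_id (setIidl EQ) => ->; rewrite integral0.
by apply: ae_mono => x /= + xQ => /(_ xQ)[].
Qed.

Lemma loc_integrable_test Omega g phi : measurable (Omega : set TT) ->
  loc_integrable Omega g -> Cc_infty Omega phi ->
  leb2.-integrable Omega (EFin \o (fun x => g x * phi x)).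
Proof.
move=> mO [mg ig] Cphi; have [K [cK KO K0]] := Cc_infty_supp Cphi.
have mK := compact_measurable_plane cK.
have -> : EFin \o (fun x => g x * phi x) = (EFin \o (fun x => g x * phi x)) \_ K.
  apply/funext => x; rewrite patchE; case: ifPn => // /negP; rewrite inE => nx /=.
  by rewrite K0// mulr0.
apply: (integrableS measurableT) => //.
apply/(integrable_mkcond _ mK).
have := @integrableMr _ _ _ leb2 K mK phi (EFin \o g) (Cc_infty_measurable Cphi).
have [M [M0 HM]] := Cc_infty_bounded Cphi.
have bnd : [bounded phi x | x in K].
  by exists M; split; rewrite ?num_real// => t Mt y _ /=; rewrite (le_trans (HM y))// ltW.
move=> /(_ bnd (ig _ KO cK)); apply: eq_integrable => // x _ /=.
by rewrite mulrC.
Qed.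

(** The fundamental lemma of the calculus of variations: bumps converging to indicators give zero
    integrals over all boxes whose closure lies in [Omega], and countably many such boxes cover
    [Omega]. *)
Lemma test_integral_ae_eq0 Omega g : open Omega -> loc_integrable Omega g ->
  (forall phi, Cc_infty Omega phi -> \int[leb2]_(x in Omega) (g x * phi x) = 0) ->
  {ae leb2, forall x, Omega x -> g x = 0}.
Proof.
move=> oO lg g0; have mO := open_measurable_plane oO.
have box0 (a b c d : R) : cbox a b c d `<=` Omega -> (\int[leb2]_(x in obox a b c d) (g x)%:E = 0)%E.
  move=> sO.
  have mC := measurable_cbox a b c d.
  have iC : leb2.-integrable (cbox a b c d) (EFin \o g).
    by apply: lg.2 => //; exact: compact_cbox.
  pose f_ n x := ((g x * box_bump a b c d n x)%:E : \bar R).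
  have Cb n : Cc_infty Omega (box_bump a b c d n) by exact: box_bump_Cc.
  have mg : measurable_fun (cbox a b c d) (g : TT -> R) by have /measurable_int/measurable_EFinP := iC.
  have f_0 n : (\int[leb2]_(x in cbox a b c d) f_ n x = 0)%E.
    have <- : (\int[leb2]_(x in Omega) f_ n x = \int[leb2]_(x in cbox a b c d) f_ n x)%E.
      rewrite integral_mkcond [RHS]integral_mkcond; congr (integral _ _ _).
      apply/funext => x; rewrite !patchE; case: ifPn => xO; case: ifPn => // xC.
        move/negP: xC; rewrite inE => xC; rewrite /f_ box_bump_out ?mulr0// => xo.
        by apply: xC; exact: obox_sub_cbox.
      by move: xC; rewrite inE => /sO; move/negP : xO; rewrite inE.
    have := g0 _ (Cb n); rewrite /Rintegral => /eqP.
    rewrite fine_eq0 => [/eqP//|].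
    exact: integrable_fin_num (loc_integrable_test mO lg (Cb n)).
  have [] := @dominated_convergence _ _ _ leb2 _ mC f_
    (fun x => (g x * \1_(obox a b c d) x)%:E) (fun x => `|g x|%:E).
  - move=> n; apply/measurable_EFinP; apply: measurable_funM => //.
    exact: Cc_infty_measurable (Cb n).
  - apply/measurable_EFinP; apply: measurable_funM => //.
    by apply: measurable_indic; exact: measurable_obox.
  - apply: aeW => x _; apply: cvg_EFin; first by near=> n.
    by apply: cvgM; [exact: cvg_cst|exact: box_bump_cvg].
  - by have := integrable_abse iC.
  - apply: aeW => x n _ /=; rewrite lee_fin normrM.
    by rewrite -[leRHS]mulr1 ler_wpM2l// box_bump_norm_le1.
  move=> _ _; under eq_fun do rewrite f_0.
  move=> /(cvg_lim (@ereal_hausdorff _)); rewrite lim_cst; last exact: ereal_hausdorff.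
  move=> /esym E; rewrite -[RHS]E.
  rewrite [LHS]integral_mkcond [RHS]integral_mkcond; congr (integral _ _ _).
  apply/funext => x; rewrite !patchE indicE.
  case: ifPn => xo; last by case: ifPn => _ //; rewrite mulr0.
  by rewrite mulr1 ifT// inE; apply: obox_sub_cbox; rewrite inE in xo.
have [a [b [c [d [sO EO]]]]] := open_eq_bigcup_obox oO.
have H n : {ae leb2, forall x, obox (a n) (b n) (c n) (d n) x -> g x = 0}.
  apply: integral_obox_ae_eq0.
    apply: integrableS (lg.2 _ (sO n) (@compact_cbox _ _ _ _ _)) => //.
    + exact: measurable_cbox.
    + exact: measurable_obox.
    + exact: obox_sub_cbox.
  move=> s t; apply: box0 => y [y1 y2]; apply: (sO n); split.
    by move: y1; rewrite /= !in_itv /= ge_max => /andP[/andP[_ ->]].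
  by move: y2; rewrite /= !in_itv /= ge_max => /andP[/andP[_ ->]].
have := ae_foralln H; apply: ae_mono => x Hx; rewrite EO => -[n _ xn].
exact: Hx xn.
Unshelve. all: by end_near. Qed.

Lemma is_weak_pd_unique Omega i f g1 g2 : open Omega ->
  is_weak_pd Omega i f g1 -> is_weak_pd Omega i f g2 ->
  {ae leb2, forall x, Omega x -> g1 x = g2 x}.
Proof.
move=> oO [_ l1 w1] [_ l2 w2]; have mO := open_measurable_plane oO.
suff : {ae leb2, forall x, Omega x -> g1 x - g2 x = 0}.
  by apply: ae_mono => x /[apply] /eqP; rewrite subr_eq0 => /eqP.
apply: test_integral_ae_eq0 => //.
  split; first by apply: measurable_funB; [exact: l1.1|exact: l2.1].
  move=> K KO cK; have mK := compact_measurable_plane cK.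
  by have := integrableB mK (l1.2 _ KO cK) (l2.2 _ KO cK); apply: eq_integrable.
move=> phi Cphi.
under eq_Rintegral do rewrite mulrBl.
rewrite RintegralB//; [|exact: loc_integrable_test..].
by rewrite w1// w2// subrr.
Qed.

End WeakUniqueness.

(** * Square integrability and dominated approximation by test functions *)

Section Approximation.
Context {R : realType}.
Implicit Types (f g h phi psi u : R * R -> R) (x : R * R) (i j k : 'I_2) (n : nat).
Implicit Types (Omega K A : set (R * R)).
Local Notation TT := (measurableTypeR R * measurableTypeR R)%type.

Definition sqint Omega f : \bar R := (\int[leb2]_(x in Omega) (f x ^+ 2)%:E)%E.

Lemma sqint_ge0 Omega f : (0 <= sqint Omega f)%E.
Proof. by apply: integral_ge0 => x _; rewrite lee_fin sqr_ge0. Qed.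

Lemma L2normE Omega f : L2norm Omega f = (sqint Omega f `^ 2^-1)%E.
Proof.
rewrite /L2norm unlock /sqint [in RHS]integral_mkcond; congr ((integral _ _ _) `^ _)%E.
apply/funext => x /=; rewrite !patchE; case: ifPn => _ /=.
  by rewrite (@powR_mulrn _ _ 2)// real_normK ?num_real.
by rewrite (_ : point = 0 :> R)// normr0 powR0.
Qed.

Lemma poweR_half_sqr (a : \bar R) : (0 <= a)%E -> ((a `^ 2^-1) `^ 2 = a)%E.
Proof.
case: a => [r| |]//; last by rewrite poweRyr// poweRyr.
by rewrite lee_fin => r0; rewrite !poweR_EFin -powRrM mulVf// powRr1.
Qed.

Lemma poweR_half_lty (a : \bar R) : (0 <= a)%E -> (a `^ 2^-1 < +oo)%E = (a < +oo)%E.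
Proof.
case: a => [r| |]//; last by rewrite poweRyr.
by rewrite lee_fin => r0; rewrite poweR_EFin !ltry.
Qed.

Lemma poweR_half_lt (a : \bar R) (e : R) : (0 <= a)%E -> 0 < e ->
  (a `^ 2^-1 < e%:E)%E = (a < (e ^+ 2)%:E)%E.
Proof.
case: a => [r| |]//; last by rewrite poweRyr// ltNge leey ltNge leey.
rewrite lee_fin => r0 e0; rewrite poweR_EFin !lte_fin powR12_sqrt//.
rewrite -[in RHS](sqr_sqrtr r0) ltr_pXn2r// nnegrE; [exact: sqrtr_ge0|exact: ltW].
Qed.

Lemma L2norm_lty Omega f : (L2norm Omega f < +oo)%E = (sqint Omega f < +oo)%E.
Proof. by rewrite L2normE poweR_half_lty ?sqint_ge0. Qed.

Lemma H1norm_lt Omega f (e : R) : 0 < e -> (H1norm Omega f < e%:E)%E =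
  (sqint Omega f + sqint Omega (grad_norm Omega f) < (e ^+ 2)%:E)%E.
Proof.
move=> e0; rewrite /H1norm !L2normE !poweR_half_sqr ?sqint_ge0//.
by rewrite poweR_half_lt// adde_ge0 ?sqint_ge0.
Qed.

Lemma grad_norm_sqr Omega f x :
  grad_norm Omega f x ^+ 2 = wpd Omega ord0 f x ^+ 2 + wpd Omega ord_max f x ^+ 2.
Proof.
rewrite sqr_sqrtr; last by rewrite sumr_ge0// => i _; exact: sqr_ge0.
by rewrite big_ord_recl big_ord1; congr (_ + wpd _ _ _ _ ^+ 2); apply/val_inj.
Qed.

Lemma measurable_sqr (D : set TT) f : measurable_fun D (f : TT -> R) ->
  measurable_fun D (fun x => (f x ^+ 2)%:E : \bar R).
Proof. by move=> mf; apply/measurable_EFinP; exact: measurable_funX. Qed.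

Lemma integrable_sqr Omega f : measurable (Omega : set TT) ->
  measurable_fun (Omega : set TT) (f : TT -> R) ->
  leb2.-integrable Omega (EFin \o (fun x => f x ^+ 2)) <-> (sqint Omega f < +oo)%E.
Proof.
move=> mO mf; split=> [/integrableP[_]|fo].
  by under eq_integral do rewrite /= ger0_norm ?sqr_ge0//.
apply/integrableP; split; first exact: measurable_sqr.
by under eq_integral do rewrite /= ger0_norm ?sqr_ge0//.
Qed.

Lemma integrable_dominated Omega f (D : TT -> R) : measurable (Omega : set TT) ->
  measurable_fun (Omega : set TT) (f : TT -> R) ->
  leb2.-integrable Omega (EFin \o D) ->
  {ae leb2, forall x, Omega x -> `|f x| <= D x} ->
  leb2.-integrable Omega (EFin \o f).
Proof.
move=> mO mf iD fD; apply/integrableP; split; first exact/measurable_EFinP.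
have iDa : leb2.-integrable Omega (abse \o (EFin \o D)) by exact: integrable_abse.
apply: le_lt_trans (integrable_lty mO iDa).
apply: ae_ge0_le_integral => //.
- by do 2 apply: measurableT_comp => //.
- by move=> x _ /=; rewrite lee_fin.
- exact: measurable_int iDa.
- apply: ae_mono fD => x /[apply] /=; rewrite lee_fin => fD.
  by rewrite (le_trans fD)// ler_norm.
Qed.

Lemma dominated_convergenceR Omega (f_ : nat -> R * R -> R) f (D : TT -> R) :
  measurable (Omega : set TT) ->
  (forall n, measurable_fun (Omega : set TT) (f_ n : TT -> R)) ->
  measurable_fun (Omega : set TT) (f : TT -> R) ->
  leb2.-integrable Omega (EFin \o D) ->
  {ae leb2, forall x, Omega x -> f_ n x @[n --> \oo] --> f x} ->
  {ae leb2, forall x, Omega x -> forall n, `|f_ n x| <= D x} ->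
  [/\ leb2.-integrable Omega (EFin \o f), forall n, leb2.-integrable Omega (EFin \o f_ n) &
   (\int[leb2]_(x in Omega) (f_ n x)) @[n --> \oo] --> (\int[leb2]_(x in Omega) (f x) : R)].
Proof.
move=> mO mf_ mf iD f_f fD.
have i_ n : leb2.-integrable Omega (EFin \o f_ n).
  by apply: integrable_dominated iD _ => //; apply: ae_mono fD => x /[apply].
have [] := @dominated_convergence _ _ _ leb2 _ mO (fun n => EFin \o f_ n) (EFin \o f) (EFin \o D).
- by move=> n; exact/measurable_EFinP.
- exact/measurable_EFinP.
- by apply: ae_mono f_f => x /[apply] H; apply: cvg_EFin => //; near=> n.
- exact: iD.
- by apply: ae_mono fD => x H n /H /(_ n); rewrite /= lee_fin.
move=> if_ _ H; split => //.
by apply: fine_cvg; rewrite fineK ?integrable_fin_num.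
Unshelve. all: by end_near. Qed.

Lemma is_weak_pdB Omega i u v g h : measurable (Omega : set TT) ->
  is_weak_pd Omega i u g -> is_weak_pd Omega i v h ->
  is_weak_pd Omega i (fun x => u x - v x) (fun x => g x - h x).
Proof.
move=> mO [lu lg wu] [lv lh wv].
have lB a b : loc_integrable Omega a -> loc_integrable Omega b ->
    loc_integrable Omega (fun x => a x - b x).
  move=> la lb; split; first by apply: measurable_funB; [exact: la.1|exact: lb.1].
  move=> K KO cK; have mK := compact_measurable_plane cK.
  by have := integrableB mK (la.2 _ KO cK) (lb.2 _ KO cK); apply: eq_integrable.
split; [exact: lB|exact: lB|] => phi Cphi.
have Cd := Cc_infty_pd i Cphi.
under eq_Rintegral do rewrite mulrBl.
rewrite RintegralB//; [|exact: loc_integrable_test..].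
rewrite wu// wv// /distr_pd; under [in RHS]eq_Rintegral do rewrite mulrBl.
rewrite RintegralB//; [|exact: loc_integrable_test..].
by rewrite opprB opprK addrC.
Qed.

Lemma wpdP Omega i u g : is_weak_pd Omega i u g -> is_weak_pd Omega i u (wpd Omega i u).
Proof. by move=> ug; rewrite /wpd; apply: (@xgetPex _ (fun=> 0) [set g | is_weak_pd Omega i u g]); exists g. Qed.

Lemma wpd_ae Omega i u g : open Omega -> is_weak_pd Omega i u g ->
  {ae leb2, forall x, Omega x -> wpd Omega i u x = g x}.
Proof. by move=> oO ug; exact: (is_weak_pd_unique oO (wpdP ug) ug). Qed.

Lemma wpd_Cc Omega i phi : open Omega -> Cc_infty Omega phi ->
  {ae leb2, forall x, Omega x -> wpd Omega i phi x = pd i phi x}.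
Proof.
by move=> oO Cphi; apply: wpd_ae => //; apply: Cc_infty_is_weak_pd => //;
  exact: open_measurable_plane.
Qed.

(* Membership in H10 in a form that passes to nonlinear functions of u, and to
   the commutator inequality, by dominated convergence. *)
Definition approximable Omega u (g : 'I_2 -> R * R -> R) :=
  exists (phi_ : nat -> R * R -> R) (D : R * R -> R),
  [/\ forall n, Cc_infty Omega (phi_ n),
      leb2.-integrable Omega (EFin \o D),
      {ae leb2, forall x, Omega x -> phi_ n x @[n --> \oo] --> u x /\
         forall i, pd i (phi_ n) x @[n --> \oo] --> g i x} &
      {ae leb2, forall x, Omega x -> forall n,
         phi_ n x ^+ 2 <= D x /\ forall i, pd i (phi_ n) x ^+ 2 <= D x}].

Lemma cvg_sqr (a_ : nat -> R) (a : R) : a_ n @[n --> \oo] --> a ->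
  a_ n ^+ 2 @[n --> \oo] --> a ^+ 2.
Proof. by move=> aa; under eq_fun do rewrite expr2; rewrite expr2; exact: cvgM. Qed.

Lemma cvg_sqr_bound (a_ : nat -> R) (a D : R) : a_ n @[n --> \oo] --> a ->
  (forall n, a_ n ^+ 2 <= D) -> a ^+ 2 <= D.
Proof.
move=> aa aD; have : a_ n ^+ 2 @[n --> \oo] --> a ^+ 2 by exact: cvg_sqr.
move=> c; have cc : cvgn (fun n => a_ n ^+ 2) by apply/cvg_ex; exists (a ^+ 2).
rewrite -(cvg_lim _ c)//; apply: limr_le => //; near=> n; exact: aD.
Unshelve. all: by end_near.
Qed.

Lemma ler_mul_sqr (a b : R) : `|a * b| <= a ^+ 2 + b ^+ 2.
Proof.
rewrite normrM -(real_normK (num_real a)) -(real_normK (num_real b)).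
have := sqr_ge0 (`|a| - `|b|); have := mulr_ge0 (normr_ge0 a) (normr_ge0 b); nra.
Qed.

Lemma L2_loc_integrable Omega f : measurable (Omega : set TT) ->
  measurable_fun (Omega : set TT) (f : TT -> R) -> (sqint Omega f < +oo)%E ->
  loc_integrable Omega f.
Proof.
move=> mO mf fo; split => // K KO cK.
have mK := compact_measurable_plane cK.
have i1 : leb2.-integrable K (EFin \o (fun x => f x ^+ 2)).
  by apply: (integrableS mO mK KO); apply/integrable_sqr.
have i2 : leb2.-integrable K (EFin \o (cst 1 : R * R -> R)).
  apply: measurable_bounded_integrable => //.
    by apply: bounded_leb2_lty => //; exact: compact_bounded.
  by exists 1; split; rewrite ?num_real// => t t1 y _ /=; rewrite normr1 ltW.
apply: (integrable_dominated (D := fun x => f x ^+ 2 + 1)) => //.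
- exact: measurable_funS mf.
- by have := integrableD mK i1 i2; apply: eq_integrable.
- by apply: aeW => x _; have := ler_mul_sqr (f x) 1; rewrite mulr1 expr1n.
Qed.

Lemma test_integral_cvg Omega (D : TT -> R) psi (a_ : nat -> R * R -> R) (a : R * R -> R) :
  measurable (Omega : set TT) -> leb2.-integrable Omega (EFin \o D) ->
  Cc_infty Omega psi ->
  (forall n, measurable_fun (Omega : set TT) (a_ n : TT -> R)) -> measurable_fun Omega a ->
  {ae leb2, forall x, Omega x -> a_ n x @[n --> \oo] --> a x} ->
  {ae leb2, forall x, Omega x -> forall n, a_ n x ^+ 2 <= D x} ->
  (\int[leb2]_(x in Omega) (a_ n x * psi x)) @[n --> \oo] --> (\int[leb2]_(x in Omega) (a x * psi x) : R).
Proof.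
move=> mO iD Cpsi ma_ ma ca Da.
have mpsi : measurable_fun (Omega : set TT) (psi : TT -> R) by exact: Cc_infty_measurable Cpsi.
have ipsi : leb2.-integrable Omega (EFin \o (fun x => psi x * psi x)).
  have CC : Cc_infty Omega (fun x => psi x * psi x).
    by apply: (Cc_inftyM Cpsi) => n; exact: Cc_infty_Ck Cpsi.
  exact: Cc_infty_integrable CC.
have [] := @dominated_convergenceR Omega (fun n x => a_ n x * psi x)
  (fun x => a x * psi x) (fun x => D x + psi x * psi x) mO.
- by move=> n; apply: measurable_funM.
- by apply: measurable_funM => //.
- by have := integrableD mO iD ipsi; apply: eq_integrable.
- by apply: ae_mono ca => x /[apply] c; apply: cvgM => //; exact: cvg_cst.
- apply: ae_mono Da => x /[apply] c n; rewrite (le_trans (ler_mul_sqr _ _))//.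
  by rewrite -expr2 lerD2r.
by [].
Qed.

(** Under the common bound, dominated convergence carries the integration by parts formula to the
    limit, so that [g] is the weak gradient, and makes the squared $H^1$ distance to the test
    functions tend to 0. *)
Lemma approximable_H10 Omega u (g : 'I_2 -> R * R -> R) : open Omega ->
  measurable_fun Omega u -> (forall i, measurable_fun Omega (g i)) ->
  approximable Omega u g ->
  H10 Omega u /\ (forall i, {ae leb2, forall x, Omega x -> wpd Omega i u x = g i x}).
Proof.
move=> oO mu mg [phi_ [D [Cphi iD cphi bphi]]].
have mO := open_measurable_plane oO.
have uD : {ae leb2, forall x, Omega x -> u x ^+ 2 <= D x /\ forall i, g i x ^+ 2 <= D x}.
  apply: ae_mono2 cphi bphi => x cx bx xO; have [c1 c2] := cx xO.
  by split=> [|i]; [apply: cvg_sqr_bound c1 _ => n; have [] := bx xO n|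
    apply: cvg_sqr_bound (c2 i) _ => n; have [_] := bx xO n].
have D0 : {ae leb2, forall x, Omega x -> 0 <= D x}.
  by apply: ae_mono uD => x + xO => /(_ xO)[uD _]; rewrite (le_trans _ uD)// sqr_ge0.
have sq f : measurable_fun Omega f -> {ae leb2, forall x, Omega x -> f x ^+ 2 <= D x} ->
    (sqint Omega f < +oo)%E.
  move=> mf fD; apply/integrable_sqr => //; apply: integrable_dominated iD _ => //.
    exact: measurable_funX.
  by apply: ae_mono fD => x /[apply]; rewrite ger0_norm ?sqr_ge0.
have su : (sqint Omega u < +oo)%E.
  by apply: sq => //; apply: ae_mono uD => x /[apply] -[].
have sg i : (sqint Omega (g i) < +oo)%E.
  by apply: sq => //; apply: ae_mono uD => x /[apply] -[_].
have lu : loc_integrable Omega u by exact: L2_loc_integrable.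
have lg i : loc_integrable Omega (g i) by exact: L2_loc_integrable mO (mg i) (sg i).
have mphi n (E : set TT) : measurable_fun E (phi_ n : TT -> R).
  exact: Cc_infty_measurable (Cphi n).
have mdphi i n (E : set TT) : measurable_fun E (pd i (phi_ n) : TT -> R).
  exact: Cc_infty_measurable (Cc_infty_pd i (Cphi n)).
have lim psi (a_ : nat -> R * R -> R) (a : R * R -> R) := @test_integral_cvg Omega D psi a_ a mO iD.
have wu i : is_weak_pd Omega i u (g i).
  split => // psi Cpsi; have Cdpsi := Cc_infty_pd i Cpsi.
  have c1 := lim psi (fun n => pd i (phi_ n)) (g i) Cpsi (fun n => mdphi i n _) (mg i).
  have {}c1 : (\int[leb2]_(x in Omega) (pd i (phi_ n) x * psi x)) @[n --> \oo]
      --> (\int[leb2]_(x in Omega) (g i x * psi x) : R).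
    apply: c1; first by apply: ae_mono cphi => x /[apply] -[_].
    by apply: ae_mono bphi => x /[apply] + n => /(_ n)[_].
  have c2 := lim (pd i psi) phi_ u Cdpsi (fun n => mphi n _) mu.
  have {}c2 : (\int[leb2]_(x in Omega) (phi_ n x * pd i psi x)) @[n --> \oo]
      --> (\int[leb2]_(x in Omega) (u x * pd i psi x) : R).
    apply: c2; first by apply: ae_mono cphi => x /[apply] -[].
    by apply: ae_mono bphi => x /[apply] + n => /(_ n)[].
  have E : (fun n => \int[leb2]_(x in Omega) (pd i (phi_ n) x * psi x))
     = (fun n => - \int[leb2]_(x in Omega) (phi_ n x * pd i psi x)).
    by apply/funext => n; have [_ _ ->] := Cc_infty_is_weak_pd i mO (Cphi n).
  rewrite E in c1.
  apply: (cvg_unique _ c1); first exact: Rhausdorff.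
  by rewrite /distr_pd; apply: cvgN.
have wg i := wpd_ae oO (wu i).
have mw i : measurable_fun Omega (wpd Omega i u) by have [_ []] := wpdP (wu i).
split => //; split.
  split; first by split; rewrite ?L2norm_lty.
  move=> i; split; first exact: wpdP (wu i).
  split; first exact: mw.
  rewrite L2norm_lty; apply: sq; first exact: mw.
  by apply: ae_mono2 uD (wg i) => x a b xO; rewrite (b xO); have [_ ->] := a xO.
move=> eps eps0.
(* The density of the squared $H^1$ distance. Each of its three squares is at most $4D$, whence the
   bound by $12D$. *)
pose E n x := (u x - phi_ n x) ^+ 2 + ((g ord0 x - pd ord0 (phi_ n) x) ^+ 2 +
  (g ord_max x - pd ord_max (phi_ n) x) ^+ 2).
have i12 : leb2.-integrable Omega (EFin \o (fun x => 12 * D x)).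
  by have := integrableZl mO 12 iD; apply: eq_integrable.
have mE n : measurable_fun (Omega : set TT) (E n : TT -> R).
  rewrite /E; apply: measurable_funD; [|apply: measurable_funD]; apply: measurable_funX;
    apply: measurable_funB; [exact: mu|exact: mphi|exact: (mg ord0)|exact: mdphi|
      exact: (mg ord_max)|exact: mdphi].
have [] := @dominated_convergenceR Omega E (cst 0) (fun x => 12 * D x) mO.
- exact: mE.
- exact: measurable_cst.
- exact: i12.
- apply: ae_mono cphi => x /[apply] -[c1 c2].
  have s0 (a_ : nat -> R) (a : R) : a_ n @[n --> \oo] --> a -> (a - a_ n) ^+ 2 @[n --> \oo] --> (0 : R).
    move=> aa; have -> : 0 = (a - a) ^+ 2 :> R by rewrite subrr expr0n.
    by apply: cvg_sqr; apply: cvgB => //; exact: cvg_cst.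
  have -> : cst 0 x = 0 + (0 + 0) :> R by rewrite !addr0.
  by apply: cvgD; [|apply: cvgD]; exact: s0.
- apply: ae_mono2 uD bphi => x a b xO n; have [a1 a2] := a xO; have [b1 b2] := b xO n.
  have s4 (s t d : R) : s ^+ 2 <= d -> t ^+ 2 <= d -> (s - t) ^+ 2 <= 4 * d.
    by move=> sd td; have := sqr_ge0 (s + t); nra.
  rewrite ger0_norm /E ?addr_ge0 ?sqr_ge0//.
  have := s4 _ _ _ a1 b1; have := s4 _ _ _ (a2 ord0) (b2 ord0).
  by have := s4 _ _ _ (a2 ord_max) (b2 ord_max); lra.
move=> _ iE; have -> : \int[leb2]_(x in Omega) (cst 0 x) = 0 :> R.
  by rewrite /Rintegral integral0_eq.
move=> /cvgr0Pnorm_lt /(_ (eps ^+ 2)).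
rewrite exprn_gt0// => /(_ isT)[N _ HN].
exists (phi_ N); first exact: Cphi.
rewrite H1norm_lt//.
have w i : is_weak_pd Omega i (u \- phi_ N) (fun x => g i x - pd i (phi_ N) x).
  by apply: is_weak_pdB => //; exact: Cc_infty_is_weak_pd.
have wa i := wpd_ae oO (w i).
have mwa i : measurable_fun (Omega : set TT) (wpd Omega i (u \- phi_ N)  : TT -> R).
  by have [_ []] := wpdP (w i).
have mgn : measurable_fun (Omega : set TT)
    (fun x => (grad_norm Omega (u \- phi_ N) x ^+ 2)%:E : \bar R).
  under eq_fun do rewrite grad_norm_sqr; apply/measurable_EFinP.
  by apply: measurable_funD; apply: measurable_funX; exact: mwa.
rewrite -ge0_integralD; last first.
- exact: mgn.
- by move=> x _; rewrite lee_fin sqr_ge0.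
- by apply: measurable_sqr; apply: measurable_funB.
- by move=> x _; rewrite lee_fin sqr_ge0.
- by [].
have -> : (\int[leb2]_(x in Omega) (((u \- phi_ N) x ^+ 2)%:E + (grad_norm Omega (u \- phi_ N) x ^+ 2)%:E)
    = \int[leb2]_(x in Omega) (E N x)%:E)%E.
  apply: ge0_ae_eq_integral => //.
  - apply: emeasurable_funD.
      by apply: measurable_sqr; apply: measurable_funB.
    exact: mgn.
  - by apply/measurable_EFinP; exact: mE.
  - by move=> x _; rewrite adde_ge0 ?lee_fin ?sqr_ge0.
  - by move=> x _; rewrite lee_fin /E !addr_ge0 ?sqr_ge0.
  - apply: ae_mono2 (wa ord0) (wa ord_max) => x a b xO.
    by rewrite -EFinD grad_norm_sqr a// b.
have := HN N (leqnn N); rewrite /= /Rintegral => H.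
rewrite -[X in (X < _)%E]fineK ?lte_fin; last exact: integrable_fin_num (iE N).
exact: le_lt_trans (ler_norm _) H.
Qed.

End Approximation.

(** * Dominated approximating sequences in $\mathring H^1$ and the chain rule *)

Section Chain.
Context {R : realType}.
Implicit Types (f g h phi psi u : R * R -> R) (x : R * R) (i j k : 'I_2) (n : nat).
Implicit Types (Omega K A : set (R * R)).
Local Notation TT := (measurableTypeR R * measurableTypeR R)%type.

Lemma cvg0_of_sqr_le (a_ b_ : nat -> R) : b_ n @[n --> \oo] --> 0 ->
  (forall n, a_ n ^+ 2 <= b_ n) -> a_ n @[n --> \oo] --> 0.
Proof.
move=> b0 ab; apply/cvgr0Pnorm_lt => e e0.
have /cvgr0Pnorm_lt /(_ (e ^+ 2)) := b0; rewrite exprn_gt0// => /(_ isT).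
apply: filterS => n bn; rewrite -(@ltr_pXn2r _ 2)// ?nnegrE ?(ltW e0)//.
by rewrite real_normK ?num_real// (le_lt_trans (ab n))// (le_lt_trans (ler_norm _)).
Qed.

Lemma summable_term (E : nat -> R) : (forall n, 0 <= E n) ->
  (\sum_(n <oo) (E n)%:E < +oo)%E ->
  E n @[n --> \oo] --> 0 /\ forall n, E n <= fine (\sum_(n <oo) (E n)%:E)%E.
Proof.
move=> E0 Eoo; set S := (\sum_(n <oo) (E n)%:E)%E.
have S0 : (0 <= S)%E by apply: nneseries_ge0 => n _ _; rewrite lee_fin.
have Sfin : S \is a fin_num by rewrite ge0_fin_numE.
have part N : \sum_(0 <= k < N) E k <= fine S.
  rewrite -lee_fin fineK// -sumEFin; apply: nneseries_lim_ge => n _ _.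
  by rewrite lee_fin.
split; last first.
  move=> n; apply: le_trans (part n.+1); rewrite big_nat_recr//= lerDr.
  by apply: sumr_ge0 => k _.
apply: cvg_series_cvg_0; apply: nondecreasing_is_cvgn.
  by apply/nondecreasing_seqP => n; rewrite /series /= big_nat_recr//= lerDl.
by exists (fine S) => _ [N _ <-]; exact: part.
Qed.

Lemma sqr_le_of_dist (S a b c a' b' c' : R) :
  (a - a') ^+ 2 + ((b - b') ^+ 2 + (c - c') ^+ 2) <= S ->
  [/\ a' ^+ 2 <= 2 * (S + (a ^+ 2 + (b ^+ 2 + c ^+ 2))),
      b' ^+ 2 <= 2 * (S + (a ^+ 2 + (b ^+ 2 + c ^+ 2))) &
      c' ^+ 2 <= 2 * (S + (a ^+ 2 + (b ^+ 2 + c ^+ 2)))].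
Proof.
have key (s t : R) : t ^+ 2 <= 2 * ((s - t) ^+ 2 + s ^+ 2).
  by have := sqr_ge0 (2 * s - t); nra.
have := key a a'; have := key b b'; have := key c c'.
have := sqr_ge0 (a - a'); have := sqr_ge0 (b - b'); have := sqr_ge0 (c - c').
have := sqr_ge0 a; have := sqr_ge0 b; have := sqr_ge0 c.
by move=> *; split; lra.
Qed.

(** As in the Riesz-Fischer theorem, approximations chosen with summable distances converge almost
    everywhere, and the sum of all the squared distances supplies the integrable bound. *)
Lemma H10_approximable Omega u : open Omega -> H10 Omega u ->
  approximable Omega u (fun i => wpd Omega i u).
Proof.
move=> oO [[[mu su] Hd] Happ]; have mO := open_measurable_plane oO.
rewrite L2norm_lty in su.
have wu i := (Hd i).1.
have mw i : measurable_fun (Omega : set TT) (wpd Omega i u : TT -> R) by have [_ []] := Hd i.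
have sw i : (sqint Omega (wpd Omega i u) < +oo)%E by have [_ [_]] := Hd i; rewrite L2norm_lty.
(* These numbers have sum 1, and being at most 1 they also bound their own squares. *)
pose eps n : R := 1 / (2 ^ n.+1)%:R.
have eps0 n : 0 < eps n by rewrite divr_gt0// ltr0n expn_gt0.
have /choice[phi_ Hphi] n : exists phi, Cc_infty Omega phi /\ (H1norm Omega (u \- phi)%R < (eps n)%:E)%E.
  by have [phi Cphi Hphi] := Happ _ (eps0 n); exists phi.
have Cphi n := (Hphi n).1.
have mphi n : measurable_fun (Omega : set TT) (phi_ n : TT -> R).
  exact: Cc_infty_measurable (Cphi n).
have mdphi i n : measurable_fun (Omega : set TT) (pd i (phi_ n) : TT -> R).
  exact: Cc_infty_measurable (Cc_infty_pd i (Cphi n)).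
pose E n x := (u x - phi_ n x) ^+ 2 + ((wpd Omega ord0 u x - pd ord0 (phi_ n) x) ^+ 2 +
  (wpd Omega ord_max u x - pd ord_max (phi_ n) x) ^+ 2).
have E0 n x : 0 <= E n x by rewrite /E !addr_ge0 ?sqr_ge0.
have mE n : measurable_fun (Omega : set TT) (E n : TT -> R).
  rewrite /E; apply: measurable_funD; [|apply: measurable_funD]; apply: measurable_funX;
    apply: measurable_funB; [exact: mu|exact: mphi|exact: (mw ord0)|exact: mdphi|
      exact: (mw ord_max)|exact: mdphi].
have mEE n : measurable_fun (Omega : set TT) (fun x => (E n x)%:E : \bar R).
  by apply/measurable_EFinP; exact: mE.
have iE n : (\int[leb2]_(x in Omega) (E n x)%:E <= (eps n)%:E)%E.
  have w i : is_weak_pd Omega i (u \- phi_ n) (fun x => wpd Omega i u x - pd i (phi_ n) x).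
    by apply: is_weak_pdB => //; exact: Cc_infty_is_weak_pd.
  have wa i := wpd_ae oO (w i).
  have mwa i : measurable_fun (Omega : set TT) (wpd Omega i (u \- phi_ n)  : TT -> R).
    by have [_ []] := wpdP (w i).
  have mgn : measurable_fun (Omega : set TT)
      (fun x => (grad_norm Omega (u \- phi_ n) x ^+ 2)%:E : \bar R).
    under eq_fun do rewrite grad_norm_sqr; apply/measurable_EFinP.
    by apply: measurable_funD; apply: measurable_funX; exact: mwa.
  have := (Hphi n).2; rewrite H1norm_lt// -ge0_integralD; last first.
  - exact: mgn.
  - by move=> x _; rewrite lee_fin sqr_ge0.
  - by apply: measurable_sqr; apply: measurable_funB.
  - by move=> x _; rewrite lee_fin sqr_ge0.
  - by [].
  move=> H; apply: (@le_trans _ _ ((eps n ^+ 2)%:E)); last first.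
    rewrite lee_fin expr2 ler_piMr ?(ltW (eps0 n))//.
    by rewrite ler_pdivrMr ?ltr0n ?expn_gt0// mul1r ler1n expn_gt0.
  apply: le_trans (ltW H); apply: ae_ge0_le_integral => //.
  - by move=> x _; rewrite lee_fin.
  - by move=> x _; rewrite adde_ge0 ?lee_fin ?sqr_ge0.
  - apply: emeasurable_funD; last exact: mgn.
    by apply: measurable_sqr; apply: measurable_funB.
  - apply: ae_mono2 (wa ord0) (wa ord_max) => x a b xO.
    by rewrite -EFinD grad_norm_sqr a// b.
(* Integrable, hence finite almost everywhere. At such a point the terms tend to 0, which is the
   convergence, and each term is at most the sum, which is the domination. *)
pose S x : \bar R := (\sum_(n <oo) (E n x)%:E)%E.
have S0 x : (0 <= S x)%E by apply: nneseries_ge0 => n _ _; rewrite lee_fin.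
have mS : measurable_fun (Omega : set TT) S.
  by apply: ge0_emeasurable_sum => // k x _ _; rewrite lee_fin.
have iS : leb2.-integrable Omega S.
  apply/integrableP; split => //.
  under eq_integral do rewrite gee0_abs//.
  rewrite integral_nneseries//; last by move=> n x _; rewrite lee_fin.
  apply: (@le_lt_trans _ _ 1%E); last exact: ltry.
  apply: le_trans (epsilon_trick0 xpredT ler01).
  by apply: lee_nneseries => // n _ _; apply: integral_ge0 => x _; rewrite lee_fin.
have ifS : leb2.-integrable Omega (EFin \o (fine \o S)).
  apply: (le_integrable mO _ _ iS).
    by apply/measurable_EFinP; apply: measurableT_comp.
  move=> x _ /=; rewrite (gee0_abs (S0 x)) ger0_norm ?fine_ge0//.
  by have := S0 x; case: (S x) => //= _; rewrite leey.
have isq f : measurable_fun (Omega : set TT) (f : TT -> R) -> (sqint Omega f < +oo)%E ->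
    leb2.-integrable Omega (EFin \o (fun x => f x ^+ 2)).
  by move=> mf sf; apply/integrable_sqr.
pose D x := 2 * (fine (S x) + (u x ^+ 2 + (wpd Omega ord0 u x ^+ 2 + wpd Omega ord_max u x ^+ 2))).
have iD : leb2.-integrable Omega (EFin \o D).
  have i2 := integrableD mO (isq _ (mw ord0) (sw ord0)) (isq _ (mw ord_max) (sw ord_max)).
  have i3 := integrableD mO (isq _ mu su) i2.
  have := integrableZl mO 2 (integrableD mO ifS i3).
  by apply: eq_integrable.
have Sfin := integrable_ae mO iS.
exists phi_, D; split => //.
- apply: ae_mono Sfin => x /[apply] Sx.
  have Sx' : (S x < +oo)%E by rewrite -ge0_fin_numE.
  have [cE _] := summable_term (fun n => E0 n x) Sx'.
  have lim (a : R) (a_ : nat -> R) : (forall n, (a - a_ n) ^+ 2 <= E n x) -> a_ n @[n --> \oo] --> a.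
    move=> aE.
    have H : (fun n => a_ n - a) @ \oo --> (0 : R).
      by apply: cvg0_of_sqr_le cE _ => n; rewrite -sqrrN opprB.
    have H2 : (fun n => (a_ n - a) + a) @ \oo --> (0 + a : R).
      by apply: cvgD; [exact: H|exact: cvg_cst].
    have E1 : (fun n => (a_ n - a) + a) = a_ by apply/funext => n; rewrite subrK.
    by rewrite E1 add0r in H2.
  split; first by apply: lim => n; rewrite lerDl addr_ge0 ?sqr_ge0.
  elim/ord2P; apply: lim => n; rewrite /E.
    by rewrite addrCA lerDl addr_ge0 ?sqr_ge0.
  by rewrite addrA lerDr addr_ge0 ?sqr_ge0.
- apply: ae_mono Sfin => x /[apply] Sx n.
  have Sx' : (S x < +oo)%E by rewrite -ge0_fin_numE.
  have [_ bE] := summable_term (fun n => E0 n x) Sx'.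
  have {}bE := bE n; rewrite -/(S x) in bE.
  by have [d1 d2 d3] := sqr_le_of_dist bE; split; [exact: d1|elim/ord2P; [exact: d2|exact: d3]].
Qed.

Definition continuous2 (F : R -> R -> R) := continuous (fun z : R * R => F z.1 z.2).

Lemma continuous2_cvg (F : R -> R -> R) (a_ b_ : nat -> R) (a b : R) : continuous2 F ->
  a_ n @[n --> \oo] --> a -> b_ n @[n --> \oo] --> b ->
  F (a_ n) (b_ n) @[n --> \oo] --> F a b.
Proof.
move=> cF ca cb.
have := @continuous_cvg _ _ _ _ _ (fun n => (a_ n, b_ n)) _ (a, b) (cF (a, b)).
by move=> H; exact: (H \oo _ (cvg_pair ca cb)).
Qed.

(** The functions [u] and [v] are measurable on [D] only. They are extended by 0 off [D] before
    being composed with a function measurable on the whole plane. *)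
Lemma continuous2_measurable (F : R -> R -> R) (D : set TT) u v : measurable D -> continuous2 F ->
  measurable_fun D (u : TT -> R) -> measurable_fun D (v : TT -> R) ->
  measurable_fun D (fun x => F (u x) (v x) : R).
Proof.
move=> mD cF mu mv.
have mF : measurable_fun setT ((fun z => F z.1 z.2) : TT -> R) by exact: continuous_measurable_plane.
have mp : measurable_fun setT (fun x => ((u \_ D) x, (v \_ D) x) : TT).
  by apply: measurable_fun_pair; exact/(measurable_restrictT _ mD).
apply: eq_measurable_fun (measurable_funTS (measurableT_comp mF mp)) => x xD /=.
by rewrite !patchE xD.
Qed.

Lemma ler_sqr_lincomb (L s t a b : R) : `|s| <= L -> `|t| <= L ->
  (s * a + t * b) ^+ 2 <= 2 * L ^+ 2 * (a ^+ 2 + b ^+ 2).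
Proof.
move=> sL tL.
have s2 : s ^+ 2 <= L ^+ 2 by rewrite -(real_normK (num_real s)) lerXn2r// nnegrE (le_trans _ sL).
have t2 : t ^+ 2 <= L ^+ 2 by rewrite -(real_normK (num_real t)) lerXn2r// nnegrE (le_trans _ tL).
have sa : s ^+ 2 * a ^+ 2 <= L ^+ 2 * a ^+ 2 by rewrite ler_wpM2r// sqr_ge0.
have tb : t ^+ 2 * b ^+ 2 <= L ^+ 2 * b ^+ 2 by rewrite ler_wpM2r// sqr_ge0.
have := sqr_ge0 (s * a - t * b); nra.
Qed.

(** [F0] and [F1] are the partial derivatives of [F]. Composing the two approximating sequences with
    [F] gives one for the composite: continuity yields its limits, and the bounds by [L] make it
    dominated by a multiple of [Du + Dv]. *)
Lemma approximable_comp Omega (F F0 F1 : R -> R -> R) (L : R) u v gu gv :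
  (forall phi psi, Cc_infty Omega phi -> Cc_infty Omega psi ->
    Cc_infty Omega (fun x => F (phi x) (psi x)) /\
    forall i x, pd i (fun x => F (phi x) (psi x)) x =
      F0 (phi x) (psi x) * pd i phi x + F1 (phi x) (psi x) * pd i psi x) ->
  continuous2 F -> continuous2 F0 -> continuous2 F1 ->
  (forall a b, F a b ^+ 2 <= 2 * L ^+ 2 * (a ^+ 2 + b ^+ 2)) ->
  (forall a b, `|F0 a b| <= L) -> (forall a b, `|F1 a b| <= L) -> open Omega ->
  approximable Omega u gu -> approximable Omega v gv ->
  approximable Omega (fun x => F (u x) (v x))
    (fun i x => F0 (u x) (v x) * gu i x + F1 (u x) (v x) * gv i x).
Proof.
move=> HF cF cF0 cF1 FL F0L F1L oO.
move=> [phi_ [Du [Cphi iDu cu bu]]] [psi_ [Dv [Cpsi iDv cv bv]]].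
have mO := open_measurable_plane oO.
exists (fun n x => F (phi_ n x) (psi_ n x)), (fun x => 2 * L ^+ 2 * (Du x + Dv x)).
split.
- by move=> n; exact: (HF _ _ (Cphi n) (Cpsi n)).1.
- by have := integrableZl mO (2 * L ^+ 2) (integrableD mO iDu iDv); apply: eq_integrable.
- apply: ae_mono2 cu cv => x a b xO; have [a1 a2] := a xO; have [b1 b2] := b xO.
  split; first exact: continuous2_cvg.
  move=> i; under eq_fun do rewrite (HF _ _ (Cphi _) (Cpsi _)).2.
  by apply: cvgD; apply: cvgM => //; exact: continuous2_cvg.
- apply: ae_mono2 bu bv => x a b xO n; have [a1 a2] := a xO n; have [b1 b2] := b xO n.
  have L2 : 0 <= 2 * L ^+ 2 by rewrite mulr_ge0// sqr_ge0.
  split; first by rewrite (le_trans (FL _ _))// ler_wpM2l// lerD.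
  move=> i; rewrite (HF _ _ (Cphi n) (Cpsi n)).2.
  by rewrite (le_trans (ler_sqr_lincomb _ _ (F0L _ _) (F1L _ _)))// ler_wpM2l// lerD.
Qed.

End Chain.

(** * The commutator inequality *)

Section Commutator.
Context {R : realType}.
Implicit Types (f g h phi psi u : R * R -> R) (x : R * R) (i j k : 'I_2) (n : nat).
Implicit Types (Omega K A : set (R * R)).
Local Notation TT := (measurableTypeR R * measurableTypeR R)%type.

Lemma sum_ord2 (F : 'I_2 -> R) : \sum_(i < 2) F i = F ord0 + F ord_max.
Proof. by rewrite big_ord_recl big_ord1; congr (_ + F _); apply/val_inj. Qed.

Definition mdet (G : 'I_2 -> 'I_2 -> R * R -> R) x : R :=
  G ord0 ord0 x * G ord_max ord_max x - G ord0 ord_max x * G ord_max ord0 x.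

(** With [G k j] standing for $\partial_k v_j$, the squares are grouped by the component $j$, as the
    sum of two squared gradients. *)
Definition mnorm2 (G : 'I_2 -> 'I_2 -> R * R -> R) x : R :=
  (G ord0 ord0 x ^+ 2 + G ord_max ord0 x ^+ 2) +
  (G ord0 ord_max x ^+ 2 + G ord_max ord_max x ^+ 2).

(** The diagonal terms vanish identically. In the two others, differentiating the products produces
    second derivatives that cancel by symmetry, and the remaining first order terms add up to twice
    the determinant. *)
Lemma commutator_eq_det Omega f (v : 'I_2 -> R * R -> R) : measurable (Omega : set TT) ->
  loc_integrable Omega f -> (forall j, Cc_infty Omega (v j)) ->
  \sum_(k < 2) \sum_(j < 2) distr_pd Omega k f
     (fun x => v k x * pd j (v j) x - v j x * pd j (v k) x) =
  - (2 * \int[leb2]_(x in Omega) (f x * mdet (fun k j => pd k (v j)) x)).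
Proof.
move=> mO lf Cv.
pose d k j := distr_pd Omega k f (fun x => v k x * pd j (v j) x - v j x * pd j (v k) x).
have -> : \sum_(k < 2) \sum_(j < 2) distr_pd Omega k f
     (fun x => v k x * pd j (v j) x - v j x * pd j (v k) x) =
  (d ord0 ord0 + d ord0 ord_max) + (d ord_max ord0 + d ord_max ord_max).
  rewrite -[RHS](sum_ord2 (fun k => d k ord0 + d k ord_max)).
  by apply: eq_bigr => k _; exact: sum_ord2 (d k).
have Cd i j : Cc_infty Omega (pd i (v j)) by exact: Cc_infty_pd.
have diag k : d k k = 0.
  rewrite /d /distr_pd; have -> : (fun x => v k x * pd k (v k) x - v k x * pd k (v k) x) = fun=> 0.
    by apply/funext => x; rewrite subrr.
  apply/eqP; rewrite oppr_eq0; apply/eqP; rewrite -[RHS](Rintegral_set0 leb2 f).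
  rewrite /Rintegral integral_set0 integral0_eq// => x _.
  by rewrite (dpdE (dpd_cst k 0 x)) mulr0.
have E2 (a b c e : R) : a = 0 -> e = 0 -> (a + b) + (c + e) = b + c.
  by move=> -> ->; rewrite add0r addr0.
transitivity (d ord0 ord_max + d ord_max ord0).
  exact: E2 (diag ord0) (diag ord_max).
have CM a b : Cc_infty Omega a -> Cc_infty Omega b -> Cc_infty Omega (fun x => a x * b x).
  by move=> Ca Cb; apply: (Cc_inftyM Ca) => n; exact: Cc_infty_Ck Cb.
have CB a b : Cc_infty Omega a -> Cc_infty Omega b -> Cc_infty Omega (fun x => a x - b x).
  move=> Ca Cb; apply: (Cc_infty_comp2 (Phi := fun a b => a - b)) => //; first by rewrite subrr.
  by move=> n; apply: CkB; [exact: Cc_infty_Ck Ca|exact: Cc_infty_Ck Cb].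
have Ch k j : Cc_infty Omega (fun x => v k x * pd j (v j) x - v j x * pd j (v k) x).
  by apply: CB; apply: CM.
rewrite /d /distr_pd -opprD -RintegralD//; last 2 first.
- exact: loc_integrable_test (Cc_infty_pd _ (Ch _ _)).
- exact: loc_integrable_test (Cc_infty_pd _ (Ch _ _)).
have i2 : leb2.-integrable Omega (EFin \o (fun x => f x * mdet (fun k j => pd k (v j)) x)).
  apply: loc_integrable_test => //; rewrite /mdet.
  by apply: CB; apply: CM; exact: Cd.
rewrite -RintegralZl//; congr (- _); apply: eq_Rintegral => x _.
have D k j i : dpd i (fun x => v k x * pd j (v j) x - v j x * pd j (v k) x) x
    ((v k x * pd i (pd j (v j)) x + pd j (v j) x * pd i (v k) x)
     - (v j x * pd i (pd j (v k)) x + pd j (v k) x * pd i (v j) x)).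
  by apply: dpdB; apply: dpdM; exact: Cc_infty_dpd.
rewrite !(dpdE (D _ _ _)) /mdet.
have S j : pd ord0 (pd ord_max (v j)) x = pd ord_max (pd ord0 (v j)) x.
  by apply: pd_symm; exact: Cc_infty_Ck (Cv j).
rewrite (S ord0) (S ord_max); clear.
move: (pd ord_max (pd ord0 (v ord0)) x) (pd ord_max (pd ord0 (v ord_max)) x)
  (pd ord0 (v ord0) x) (pd ord_max (v ord0) x) (pd ord0 (v ord_max) x)
  (pd ord_max (v ord_max) x) (v ord0 x) (v ord_max x) (f x) => *; ring.
Qed.

Lemma mnorm2_ge0 (G : 'I_2 -> 'I_2 -> R * R -> R) x : 0 <= mnorm2 G x.
Proof. by rewrite /mnorm2 !addr_ge0 ?sqr_ge0. Qed.

Lemma sqrtr_AGM (s t : R) : 0 <= s -> 0 <= t -> 2 * (Num.sqrt s * Num.sqrt t) <= s + t.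
Proof.
move=> s0 t0; have := sqr_ge0 (Num.sqrt s - Num.sqrt t).
by rewrite sqrrB !sqr_sqrtr// -mulr_natl; lra.
Qed.

Lemma double_le_trans (c I a b m : R) : 0 <= c -> 2 * I <= c * a * b -> 2 * (a * b) <= m ->
  4 * I <= c * m.
Proof. by move=> c0 Iab /(ler_wpM2l c0); lra. Qed.

Lemma mnorm2_le_bound (a b c d D : R) : a ^+ 2 <= D -> b ^+ 2 <= D -> c ^+ 2 <= D -> d ^+ 2 <= D ->
  (a ^+ 2 + b ^+ 2) + (c ^+ 2 + d ^+ 2) <= 4 * D.
Proof. lra. Qed.

Lemma mdet_le_bound (a b c d D : R) : a ^+ 2 <= D -> b ^+ 2 <= D -> c ^+ 2 <= D -> d ^+ 2 <= D ->
  `|a * b - c * d| <= 4 * D.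
Proof.
move=> *; rewrite (le_trans (ler_normB _ _))//.
by have := ler_mul_sqr a b; have := ler_mul_sqr c d; lra.
Qed.

(** The commutator is twice the integral of [f] against the determinant, and the product of the two
    gradient norms is at most half the sum of their squares; hence the factor 4. *)
Lemma commutator_det_bound Omega (C0 B : R) f (v : 'I_2 -> R * R -> R) : open Omega ->
  0 < C0 -> 0 <= B -> commutator_constant Omega C0 -> BMO Omega f ->
  (bmo_norm Omega f <= B%:E)%E -> (forall j, Cc_infty Omega (v j)) ->
  4 * `|\int[leb2]_(x in Omega) (f x * mdet (fun k j => pd k (v j)) x)|
  <= C0 * B * \int[leb2]_(x in Omega) (mnorm2 (fun k j => pd k (v j)) x).
Proof.
move=> oO C00 B0 comm bf fB Cv; have mO := open_measurable_plane oO.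
have := comm f bf v Cv; rewrite commutator_eq_det//; last exact: bf.1.
rewrite normrN normrM (ger0_norm (_ : 0 <= 2))//.
set I := `|_|.
have Cd i j : Cc_infty Omega (pd i (v j)) by exact: Cc_infty_pd.
have CM a b : Cc_infty Omega a -> Cc_infty Omega b -> Cc_infty Omega (fun x => a x * b x).
  by move=> Ca Cb; apply: (Cc_inftyM Ca) => n; exact: Cc_infty_Ck Cb.
pose e j x := pd ord0 (v j) x ^+ 2 + pd ord_max (v j) x ^+ 2.
have Ce j : Cc_infty Omega (e j).
  by apply: Cc_inftyD; apply: CM.
have ie j : leb2.-integrable Omega (EFin \o e j) by exact: Cc_infty_integrable (Ce j).
pose s j : R := \int[leb2]_(x in Omega) (e j x).
have e0 j x : 0 <= e j x by rewrite addr_ge0 ?sqr_ge0.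
have s0 j : 0 <= s j by apply: Rintegral_ge0 => x _.
have mw i j : measurable_fun (Omega : set TT) (wpd Omega i (v j) : TT -> R).
  by have [_ []] := wpdP (Cc_infty_is_weak_pd i mO (Cv j)).
have sqE j : sqint Omega (grad_norm Omega (v j)) = (s j)%:E.
  rewrite /s /Rintegral fineK; last exact: integrable_fin_num (ie j).
  apply: ge0_ae_eq_integral => //.
  - under eq_fun do rewrite grad_norm_sqr; apply/measurable_EFinP.
    by apply: measurable_funD; apply: measurable_funX; exact: mw.
  - exact: measurable_int (ie j).
  - by move=> x _; rewrite lee_fin sqr_ge0.
  - by move=> x _; rewrite lee_fin.
  - apply: ae_mono2 (wpd_Cc ord0 oO (Cv j)) (wpd_Cc ord_max oO (Cv j)) => x a b xO.
    by rewrite grad_norm_sqr a// b.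
have nE j : L2norm Omega (grad_norm Omega (v j)) = (Num.sqrt (s j))%:E.
  by rewrite L2normE sqE poweR_EFin powR12_sqrt.
rewrite !nE => H.
have H2 : ((2 * I)%:E <= (C0 * B * Num.sqrt (s ord0) * Num.sqrt (s ord_max))%:E)%E.
  apply: (le_trans H); rewrite !EFinM.
  do 2 (apply: lee_wpmul2r; first by rewrite lee_fin sqrtr_ge0).
  by apply: lee_wpmul2l => //; rewrite lee_fin ltW.
rewrite lee_fin in H2.
have -> : \int[leb2]_(x in Omega) (mnorm2 (fun k j => pd k (v j)) x) = s ord0 + s ord_max.
  by rewrite /s -RintegralD.
have am := sqrtr_AGM (s0 ord0) (s0 ord_max).
have CB0 : 0 <= C0 * B by rewrite mulr_ge0// ltW.
exact: (double_le_trans CB0 H2 am).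
Qed.

(** The commutator inequality is available for test functions. As [f] is bounded, [f] times the
    determinant is dominated along the approximating sequences, so both sides pass to the limit. *)
Lemma approximable_det_bound Omega (C0 B M : R) f (v : 'I_2 -> R * R -> R)
    (G : 'I_2 -> 'I_2 -> R * R -> R) : open Omega ->
  0 < C0 -> 0 <= B -> commutator_constant Omega C0 -> BMO Omega f ->
  (bmo_norm Omega f <= B%:E)%E ->
  {ae leb2, forall x, Omega x -> `|f x| <= M} ->
  (forall k j, measurable_fun Omega (G k j)) ->
  (forall j, approximable Omega (v j) (fun k => G k j)) ->
  4 * `|\int[leb2]_(x in Omega) (f x * mdet G x)|
  <= C0 * B * \int[leb2]_(x in Omega) (mnorm2 G x).
Proof.
move=> oO C00 B0 comm bf fB fM mG appr; have mO := open_measurable_plane oO.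
have [p0 [D0 [Cp0 iD0 c0 b0]]] := appr ord0.
have [p1 [D1 [Cp1 iD1 c1 b1]]] := appr ord_max.
pose vn n j := if j == ord0 then p0 n else p1 n.
have Cvn n j : Cc_infty Omega (vn n j) by rewrite /vn; case: ifP.
pose Gn n k j := pd k (vn n j).
have mGn n k j : measurable_fun (Omega : set TT) (Gn n k j : TT -> R).
  exact: Cc_infty_measurable (Cc_infty_pd k (Cvn n j)).
have cG : {ae leb2, forall x, Omega x -> forall k j, Gn n k j x @[n --> \oo] --> G k j x}.
  apply: ae_mono2 c0 c1 => x a b xO k; elim/ord2P; first exact: (a xO).2.
  exact: (b xO).2.
pose D x := D0 x + D1 x.
have iD : leb2.-integrable Omega (EFin \o D).
  by have := integrableD mO iD0 iD1; apply: eq_integrable.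
have bG : {ae leb2, forall x, Omega x -> forall n k j, Gn n k j x ^+ 2 <= D x}.
  apply: ae_mono2 b0 b1 => x a b xO n k.
  have [a1 a2] := a xO n; have [b1' b2] := b xO n.
  have p : 0 <= D0 x by rewrite (le_trans _ a1)// sqr_ge0.
  have q : 0 <= D1 x by rewrite (le_trans _ b1')// sqr_ge0.
  by elim/ord2P; rewrite /D /Gn /vn /=; [rewrite (le_trans (a2 k))// lerDl|
    rewrite (le_trans (b2 k))// lerDr].
have mmn n : measurable_fun (Omega : set TT) (mnorm2 (Gn n) : TT -> R).
  by do ![apply: measurable_funD]; apply: measurable_funX; exact: mGn.
have mm : measurable_fun (Omega : set TT) (mnorm2 G : TT -> R).
  by do ![apply: measurable_funD]; apply: measurable_funX; exact: mG.
have mf : measurable_fun (Omega : set TT) (f : TT -> R) by exact: bf.1.1.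
have mdn n : measurable_fun (Omega : set TT) ((fun x => f x * mdet (Gn n) x) : TT -> R).
  apply: measurable_funM => //.
  by apply: measurable_funB; apply: measurable_funM; exact: mGn.
have md : measurable_fun (Omega : set TT) ((fun x => f x * mdet G x) : TT -> R).
  apply: measurable_funM => //.
  by apply: measurable_funB; apply: measurable_funM; exact: mG.
have i4 : leb2.-integrable Omega (EFin \o (fun x => 4 * D x)).
  by have := integrableZl mO 4 iD; apply: eq_integrable.
have iM : leb2.-integrable Omega (EFin \o (fun x => `|M| * (4 * D x))).
  by have := integrableZl mO `|M| i4; apply: eq_integrable.
have [] := @dominated_convergenceR _ Omega (fun n => mnorm2 (Gn n)) (mnorm2 G) (fun x => 4 * D x) mO mmn mm i4.
- apply: ae_mono cG => x /[apply] c.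
  by rewrite /mnorm2; apply: cvgD; apply: cvgD; apply: cvg_sqr; exact: c.
- apply: ae_mono bG => x /[apply] b n; rewrite ger0_norm ?mnorm2_ge0// /mnorm2.
  by apply: mnorm2_le_bound; exact: b.
move=> _ _ lim1.
have [] := @dominated_convergenceR _ Omega (fun n x => f x * mdet (Gn n) x)
  (fun x => f x * mdet G x) (fun x => `|M| * (4 * D x)) mO mdn md iM.
- apply: ae_mono cG => x /[apply] c.
  by apply: cvgM; [exact: cvg_cst|apply: cvgB; apply: cvgM; exact: c].
- apply: ae_mono2 bG fM => x b fMx xO n; rewrite normrM ler_pM//.
    by rewrite (le_trans (fMx xO))// ler_norm.
  have {}b := b xO n.
  by apply: mdet_le_bound; exact: b.
move=> _ _ lim2.
have l1 : (C0 * B * \int[leb2]_(x in Omega) mnorm2 (Gn n) x) @[n --> \oo] -->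
    (C0 * B * \int[leb2]_(x in Omega) mnorm2 G x : R).
  by apply: cvgM; [exact: cvg_cst|exact: lim1].
have l2 : (4 * `|\int[leb2]_(x in Omega) (f x * mdet (Gn n) x)|) @[n --> \oo] -->
    (4 * `|\int[leb2]_(x in Omega) (f x * mdet G x)| : R).
  by apply: cvgM; [exact: cvg_cst|apply: cvg_norm; exact: lim2].
apply: (ler_cvg_to l2 l1); near=> n.
exact: commutator_det_bound.
Unshelve. all: by end_near. Qed.

End Commutator.

(** * Exponential integrability *)

Section SmoothStep.
Context {R : realType}.
Implicit Types t : R.

Definition posq t : R := Num.max t 0 ^+ 2.

Lemma is_derive_posq t : is_derive t 1 posq (2 * Num.max t 0).
Proof.
have [t0|t0|->] := ltgtP t 0.
- rewrite mulr0; have H : is_derive t 1 (cst 0 : R -> R) 0 by exact: is_derive_cst.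
  apply: near_eq_is_derive H; near=> s.
  rewrite /posq max_r ?expr0n//= ltW//; near: s; exact: lt_nbhsl.
- have H : is_derive t 1 (fun s : R => s ^+ 2) (2 * t).
    have := @is_deriveX _ _ id 2 t 1 1 (is_derive_id _ _).
    move/is_derive_eq; apply.
    by rewrite /GRing.scale /= mulr1 expr1 mulr_natl.
  apply: near_eq_is_derive H; near=> s.
  rewrite /posq max_l// ltW//; near: s; exact: lt_nbhsr.
- have E : (fun s : R => s^-1 *: ((posq \o shift 0) (s *: 1) - posq 0)) @ 0^' --> 0.
    apply/cvgr0Pnorm_lt => e e0; near=> s.
    have s0 : s != 0 by near: s; exact: nbhs_dnbhs_neq.
    rewrite /= addr0 [s%:A]mulr1 [posq 0]/posq maxxx expr0n subr0 normrZ normfV.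
    rewrite mulrC ltr_pdivrMr ?normr_gt0//.
    have se : `|s| < e by near: s; exact: dnbhs0_lt.
    rewrite (@le_lt_trans _ _ (`|s| ^+ 2))//.
      rewrite /posq normrX lerXn2r ?nnegrE//.
      by case: (leP s 0) => [s0'|s0']; rewrite ?normr0.
    by rewrite expr2 ltr_pM2r ?normr_gt0.
  by rewrite mulr0; split; [apply/cvg_ex; exists 0|apply/cvg_lim].
Unshelve. all: by end_near. Qed.

(** A quadratic spline rising from 0 to 1 on the unit interval with slope at most 2. It is of class
    $C^1$, which is the regularity asked by the planar inequality below. *)
Definition step t : R := 2 * (posq t - 2 * posq (t - 2^-1) + posq (t - 1)).
Definition step' t : R :=
  4 * (Num.max t 0 - 2 * Num.max (t - 2^-1) 0 + Num.max (t - 1) 0).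

Lemma is_derive_step t : is_derive t 1 step (step' t).
Proof.
have shift_posq (c : R) : is_derive t 1 (fun s => posq (s - c)) (2 * Num.max (t - c) 0).
  have d : is_derive t 1 (fun s : R => s - c) 1.
    have := is_deriveB (is_derive_id t (1 : R)) (is_derive_cst c t (1 : R)).
    by rewrite subr0.
  have := @is_derive1_comp _ posq (fun s => s - c) t _ _ (is_derive_posq _) d.
  by rewrite mulr1.
have d1 := is_deriveZ 2 (shift_posq 2^-1).
have d2 := is_deriveD (is_deriveB (is_derive_posq t) d1) (shift_posq 1).
have := is_deriveZ 2 d2; move/is_derive_eq; apply.
by rewrite /step' /GRing.scale /=; ring.
Qed.

Lemma step_le0 t : t <= 0 -> step t = 0.
Proof.
move=> t0; rewrite /step /posq !max_r ?expr0n/=; [ring|lra..].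
Qed.

Lemma step_ge1 t : 1 <= t -> step t = 1.
Proof. by move=> t1; rewrite /step /posq !max_l; [field|lra..]. Qed.

Lemma step'_out t : ~~ (0 < t < 1) -> step' t = 0.
Proof.
rewrite negb_and -!leNgt => /orP[t0|t1]; rewrite /step'.
  by rewrite !max_r; [ring|lra..].
by rewrite !max_l; [field|lra..].
Qed.

Lemma step'_norm t : `|step' t| <= 2.
Proof.
have [/andP[t0 t1]|/step'_out->] := boolP (0 < t < 1); last by rewrite normr0.
rewrite /step' (@max_l _ _ t) ?(@max_r _ _ (t - 1)); [|lra..].
have [th|th] := leP t 2^-1.
  by rewrite max_r; [rewrite ger0_norm; lra|lra].
by rewrite max_l; [rewrite ger0_norm; lra|lra].
Qed.

Lemma continuous_step' : continuous step'.
Proof.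
pose m (c t : R) : R := Num.max (t - c) 0.
have cm c : continuous (m c).
  move=> t; apply: (@continuous_max _ _ (fun t => t - c) (cst 0)).
    by apply: continuousB; [exact: id|exact: cst_continuous].
  exact: cst_continuous.
have -> : step' = fun t => 4 * (m 0 t - 2 * m 2^-1 t + m 1 t).
  by apply/funext => t; rewrite /step' /m subr0.
move=> t; apply: cvgM; first exact: cvg_cst.
apply: cvgD; last exact: cm.
by apply: cvgB; [exact: cm|apply: cvgM; [exact: cvg_cst|exact: cm]].
Qed.

End SmoothStep.

(** * The planar Gagliardo-Nirenberg inequality *)

Section GagliardoNirenberg.
Context {R : realType}.
Implicit Types (f g h phi psi u : R * R -> R) (x : R * R) (i j k : 'I_2) (n : nat).
Implicit Types (Omega K A : set (R * R)).
Local Notation leb := (@lebesgue_measure R).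
Local Notation TT := (measurableTypeR R * measurableTypeR R)%type.

Lemma Ck1_measurable_pd Phi i : Ck 1 Phi -> measurable_fun setT (pd i Phi : TT -> R).
Proof.
by move=> C; apply: continuous_measurable_plane; exact: Ck_continuous (Ck_pd i C).
Qed.

(** Multiplying the two bounds gives $\Phi(s,y)^2 \le A(y)B(s)$, whose double integral factorises by
    Tonelli's theorem. *)
Lemma sq_integral_le_mul (A B : measurableTypeR R -> \bar R) (Phi : TT -> R) :
  (forall y, 0 <= A y)%E -> (forall s, 0 <= B s)%E ->
  measurable_fun setT A -> measurable_fun setT B -> measurable_fun setT Phi ->
  (forall s y, `|Phi (s, y)|%:E <= A y)%E -> (forall s y, `|Phi (s, y)|%:E <= B s)%E ->
  (\int[leb2]_x (Phi x ^+ 2)%:E <= (\int[leb]_y A y) * (\int[leb]_s B s))%E.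
Proof.
move=> A0 B0 mA mB mPhi PA PB.
have mprod : measurable_fun setT (fun z : TT => (B z.1 * A z.2)%E).
  apply: emeasurable_funM.
    exact: (measurableT_comp mB measurable_fst).
  exact: (measurableT_comp mA measurable_snd).
have prod0 (z : TT) : (0 <= B z.1 * A z.2)%E by exact: mule_ge0.
apply: (@le_trans _ _ (\int[leb2]_z (B z.1 * A z.2))%E).
  apply: ge0_le_integral.
  - by [].
  - by move=> z _; rewrite lee_fin sqr_ge0.
  - exact: measurable_sqr.
  - exact: mprod.
  - move=> [s y] _; rewrite -(real_normK (num_real _)) expr2 EFinM.
    by apply: lee_pmul; rewrite ?lee_fin.
rewrite /leb2 (fubini_tonelli1 _ mprod prod0) muleC.
have iA : (0 <= \int[leb]_y A y)%E by exact: integral_ge0.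
rewrite -ge0_integralZr//.
apply: ge0_le_integral => //.
- by move=> s _; apply: integral_ge0 => y _; exact: mule_ge0.
- exact: (measurable_fun_fubini_tonelli_F (m2 := leb) _ mprod prod0).
- by apply: emeasurable_funM => //.
- by move=> s _; rewrite /fubini_F /= ge0_integralZl.
Qed.

(** Integrating along the horizontal line bounds $|\Phi(s,y)|$ by a function of $y$ alone, and along
    the vertical line by a function of $s$ alone. *)
Lemma sq_integral_le_prod Phi (M : R) : Ck 1 Phi ->
  (forall x, ~ cbox (- M) M (- M) M x -> Phi x = 0) ->
  (\int[leb2]_x (Phi x ^+ 2)%:E <=
   (\int[leb2]_x `|pd ord0 Phi x|%:E) * (\int[leb2]_x `|pd ord_max Phi x|%:E))%E.
Proof.
(* [Phi] is known to vanish off the closed box only, so the lines start strictly outside it. *)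
move=> C1 Phi0; pose N := M + 1.
have MN : M < N by rewrite ltrDl.
have mabs i : measurable_fun setT (fun z : TT => `|pd i Phi z|%:E : \bar R).
  by apply/measurable_EFinP; apply: measurableT_comp => //; exact: Ck1_measurable_pd.
have abs0 i (z : TT) : (0 <= `|pd i Phi z|%:E)%E by rewrite lee_fin.
have cpd i : continuous (pd i Phi) by exact: Ck_continuous (Ck_pd i C1).
pose A (y : R) : \bar R := (\int[leb]_s `|pd ord0 Phi (s, y)|%:E)%E.
pose B (s : R) : \bar R := (\int[leb]_y `|pd ord_max Phi (s, y)|%:E)%E.
have A0 y : (0 <= A y)%E by apply: integral_ge0.
have B0 s : (0 <= B s)%E by apply: integral_ge0.
have mA : measurable_fun (setT : set (measurableTypeR R)) A.
  exact: (measurable_fun_fubini_tonelli_G (m1 := leb) _ (mabs ord0) (abs0 ord0)).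
have mB : measurable_fun (setT : set (measurableTypeR R)) B.
  exact: (measurable_fun_fubini_tonelli_F (m2 := leb) _ (mabs ord_max) (abs0 ord_max)).
have PA s y : (`|Phi (s, y)|%:E <= A y)%E.
  apply: (@line_abs_le _ (fun s => Phi (s, y)) (fun s => pd ord0 Phi (s, y)) N).
  - by move=> t; apply: dpd_slice0; exact: Ck_dpd C1.
  - move=> t; apply: (@continuous_comp _ _ _ (fun t => (t, y)) (pd ord0 Phi)); last exact: cpd.
    exact: (cvg_pair cvg_id (cvg_cst y)).
  - by apply: Phi0 => -[/=]; rewrite in_itv /= => /andP[]; rewrite lerN2 leNgt MN.
  - move=> t tN; apply: Phi0 => -[/=]; rewrite in_itv /= => /andP[Mt _] _.
    by move: tN; rewrite ltNge (le_trans _ Mt)// lerN2 ltW.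
have PB s y : (`|Phi (s, y)|%:E <= B s)%E.
  apply: (@line_abs_le _ (fun y => Phi (s, y)) (fun y => pd ord_max Phi (s, y)) N).
  - by move=> t; apply: dpd_slice1; exact: Ck_dpd C1.
  - move=> t; apply: (@continuous_comp _ _ _ (fun t => (s, t)) (pd ord_max Phi)); last exact: cpd.
    exact: (cvg_pair (cvg_cst s) cvg_id).
  - by apply: Phi0 => -[_ /=]; rewrite in_itv /= => /andP[]; rewrite lerN2 leNgt MN.
  - move=> t tN; apply: Phi0 => -[_ /=]; rewrite in_itv /= => /andP[Mt _].
    by move: tN; rewrite ltNge (le_trans _ Mt)// lerN2 ltW.
have mPhi : measurable_fun setT (Phi : TT -> R).
  by apply: continuous_measurable_plane; exact: Ck_continuous C1.
have E1 : (\int[leb]_y A y = \int[leb2]_x `|pd ord0 Phi x|%:E)%E.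
  by rewrite /leb2 (fubini_tonelli2 _ (mabs ord0) (abs0 ord0)).
have E2 : (\int[leb]_s B s = \int[leb2]_x `|pd ord_max Phi x|%:E)%E.
  by rewrite /leb2 (fubini_tonelli1 _ (mabs ord_max) (abs0 ord_max)).
rewrite -E1 -E2; exact: (sq_integral_le_mul A0 B0 mA mB mPhi PA PB).
Qed.

End GagliardoNirenberg.

(** * Measure of the level sets of a test function *)

Section LevelSets.
Context {R : realType}.
Implicit Types (f g h phi psi u : R * R -> R) (x : R * R) (i j k : 'I_2).
Implicit Types (Omega K A : set (R * R)).
Local Notation leb := (@lebesgue_measure R).
Local Notation TT := (measurableTypeR R * measurableTypeR R)%type.

Definition dens phi x : R := pd ord0 phi x ^+ 2 + pd ord_max phi x ^+ 2.

(** The value $t = I/d$ is the optimal one when $d > 0$. *)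
Lemma sqr_le_of_parametric (I d m : R) : 0 <= I -> 0 <= d -> 0 <= m ->
  (forall t, 0 < t -> 2 * I <= t * d + t^-1 * m) -> I ^+ 2 <= d * m.
Proof.
move=> I0 d0 m0 H; have [->|In0] := eqVneq I 0; first by rewrite expr0n mulr_ge0.
have Ip : 0 < I by rewrite lt_neqAle eq_sym In0.
have [d00|dn0] := eqVneq d 0.
  (* With $d = 0$ this $t$ gives $2I \le I\,m/(m+1) \le I$, which contradicts $I > 0$. *)
  have := H ((m + 1) / I); rewrite divr_gt0 ?ltr_wpDl// => /(_ isT).
  rewrite d00 mulr0 add0r mul0r invf_div mulrAC => H1.
  have : m / (m + 1) <= 1 by rewrite ler_pdivrMr ?ltr_wpDl// mul1r lerDl.
  rewrite -mulrA in H1; by move=> /(ler_wpM2l I0); lra.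
have dp : 0 < d by rewrite lt_neqAle eq_sym dn0.
have := H (I / d); rewrite divr_gt0// => /(_ isT).
rewrite divfK// invf_div => H1.
have : I <= d / I * m by lra.
move=> /(ler_wpM2r I0); rewrite -expr2.
by have -> : d / I * m * I = d * m by field.
Qed.

(** Cauchy-Schwarz against the constant 1, from the pointwise inequality $2g \le t g^2 + t^{-1}$
    integrated for every $t > 0$. *)
Lemma sqr_integral_le (L : set TT) (g G : TT -> R) : measurable L ->
  leb2.-integrable L (EFin \o g) -> leb2.-integrable L (EFin \o G) ->
  (leb2 L < +oo)%E -> (forall x, L x -> 0 <= g x) ->
  (forall x, L x -> g x ^+ 2 <= G x) ->
  (\int[leb2]_(x in L) g x) ^+ 2 <= (\int[leb2]_(x in L) G x) * fine (leb2 L).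
Proof.
move=> mL ig iG Loo g0 gG.
have Lfin : leb2 L \is a fin_num by rewrite ge0_fin_numE.
apply: sqr_le_of_parametric.
- exact: Rintegral_ge0.
- by apply: Rintegral_ge0 => x Lx; rewrite (le_trans _ (gG x Lx))// sqr_ge0.
- exact: fine_ge0.
move=> t t0.
have i1 : leb2.-integrable L (EFin \o (cst 1 : TT -> R)).
  apply: measurable_bounded_integrable => //.
  by exists 1; split; rewrite ?num_real// => s s1 y _ /=; rewrite normr1 ltW.
have -> : fine (leb2 L) = \int[leb2]_(x in L) (cst 1 x).
  by rewrite Rintegral_cst// mul1r.
rewrite -!RintegralZl// -RintegralD//; last 2 first.
- by have := integrableZl mL t iG; apply: eq_integrable.
- by have := integrableZl mL t^-1 i1; apply: eq_integrable.
apply: le_Rintegral => //.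
- by have := integrableZl mL 2 ig; apply: eq_integrable.
- have := integrableD mL (integrableZl mL t iG) (integrableZl mL t^-1 i1).
  by apply: eq_integrable.
move=> x Lx /=; apply: (@le_trans _ _ (t * g x ^+ 2 + t^-1 * 1)).
  rewrite mulr1 -subr_ge0.
  have -> : t * g x ^+ 2 + t^-1 - 2 * g x = (t * g x - 1) ^+ 2 * t^-1.
    by field; rewrite gt_eqF.
  by rewrite mulr_ge0 ?sqr_ge0// invr_ge0 ltW.
by rewrite lerD2r ler_wpM2l ?(ltW t0)// gG.
Qed.

Definition super Omega phi (a : R) : set TT := Omega `&` [set x | a <= phi x ^+ 2].
Definition layer Omega phi (a b : R) : set TT := Omega `&` [set x | a <= phi x ^+ 2 < b].

Lemma measurable_super Omega phi a : measurable (Omega : set TT) ->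
  measurable_fun (Omega : set TT) (phi : TT -> R) -> measurable (super Omega phi a).
Proof.
move=> mO mphi; have m2 : measurable_fun (Omega : set TT) (fun x : TT => phi x ^+ 2).
  exact: measurable_funX.
have := m2 mO `[a, +oo[%classic (measurable_itv _).
by congr measurable; apply/seteqP; split => x [xO /=]; rewrite in_itv /= andbT.
Qed.

Lemma measurable_layer Omega phi a b : measurable (Omega : set TT) ->
  measurable_fun (Omega : set TT) (phi : TT -> R) -> measurable (layer Omega phi a b).
Proof.
move=> mO mphi; have m2 : measurable_fun (Omega : set TT) (fun x : TT => phi x ^+ 2).
  exact: measurable_funX.
have := m2 mO `[a, b[%classic (measurable_itv _).
by congr measurable; apply/seteqP; split => x [xO /=]; rewrite in_itv /=.
Qed.

(** Since the slope of [step] is at most 2, the derivative of [Phi] is at most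
    $4|\phi||\partial_i\phi|/(b-a)$ on the layer and vanishes elsewhere; [K] bounds the factor
    $4|\phi|/(b-a)$ there. *)
Lemma cut_properties Omega phi (a b K : R) : Cc_infty Omega phi -> 0 <= a -> a < b ->
  0 <= K -> (forall s : R, s ^+ 2 < b -> 4 * `|s| <= K * (b - a)) ->
  let Phi x := step ((phi x ^+ 2 - a) / (b - a)) in
  [/\ Ck 1 Phi, forall x, phi x = 0 -> Phi x = 0,
      forall x, b <= phi x ^+ 2 -> Phi x = 1 &
      forall i x, `|pd i Phi x| <= if a <= phi x ^+ 2 < b then K * `|pd i phi x| else 0].
Proof.
move=> Cphi a0 ab K0 HK Phi; have ba0 : 0 < b - a by rewrite subr_gt0.
pose th x := (phi x ^+ 2 - a) / (b - a).
have Cth n : Ck n th.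
  have C1 := Cc_infty_Ck n Cphi.
  have := CkM (CkB (CkM C1 C1) (Ck_cst n a)) (Ck_cst n (b - a)^-1).
  exact.
have dth i x : dpd i th x (2 * phi x * pd i phi x / (b - a)).
  have d1 := Cc_infty_dpd i x Cphi.
  have := dpdM (dpdB (dpdM d1 d1) (dpd_cst i a x)) (dpd_cst i (b - a)^-1 x).
  rewrite mulr0 add0r subr0; congr (dpd _ _ _ _); by ring.
have dPhi i x : dpd i Phi x (step' (th x) * (2 * phi x * pd i phi x / (b - a))).
  exact: dpd_comp (dth i x) (is_derive_step (th x)).
have cPhi : continuous Phi.
  move=> x; apply: (@continuous_comp _ _ _ th step); first exact: (Ck_continuous (Cth 0)).
  apply: differentiable_continuous; apply/derivable1_diffP.
  by have /@ex_derive := is_derive_step (th x).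
split.
- apply: (CkSI cPhi dPhi) => i; apply: CkM.
    split => // x; apply: (@continuous_comp _ _ _ th step'); first exact: (Ck_continuous (Cth 0)).
    exact: continuous_step'.
  apply: CkM; last exact: Ck_cst.
  apply: CkM; last exact: Ck_pd (Cc_infty_Ck 1 Cphi).
  by apply: CkM; [exact: Ck_cst|exact: Cc_infty_Ck Cphi].
- move=> x p0; apply: step_le0; rewrite p0 expr0n sub0r mulNr oppr_le0.
  by rewrite divr_ge0// ltW.
- by move=> x bx; apply: step_ge1; rewrite ler_pdivlMr// mul1r lerD2r.
- move=> i x; rewrite (dpdE (dPhi i x)).
  case: ifPn => [/andP[ax xb]|out].
    have E : `|2 * phi x * pd i phi x / (b - a)| = 2 * `|phi x| * `|pd i phi x| / (b - a).
      by rewrite !normrM normfV (gtr0_norm ba0) (ger0_norm (_ : 0 <= 2)).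
    rewrite normrM E.
    apply: (@le_trans _ _ (2 * (2 * `|phi x| * `|pd i phi x| / (b - a)))).
      by apply: ler_wpM2r; [rewrite !mulr_ge0// invr_ge0 ltW|exact: step'_norm].
    rewrite !mulrA ler_pdivrMr//.
    have := HK _ xb; move/(ler_wpM2r (normr_ge0 (pd i phi x))).
    by move: (`|phi x|) (`|pd i phi x|) => s q; clear; lra.
  rewrite step'_out ?mul0r ?normr0//; apply: contra out => /andP[t0 t1].
  move: t0; rewrite pmulr_lgt0 ?invr_gt0// subr_gt0 => /ltW ->/=.
  by move: t1; rewrite ltr_pdivrMr// mul1r ltrD2r.
Qed.

Lemma mul_le_of_sqr_le (K p q d l m : R) : 0 <= d -> l <= m ->
  p ^+ 2 <= d * l -> q ^+ 2 <= d * l -> K * p * (K * q) <= K ^+ 2 * (d * m).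
Proof.
move=> d0 lm pl ql; have -> : K * p * (K * q) = K ^+ 2 * (p * q) by ring.
rewrite ler_wpM2l ?sqr_ge0// (@le_trans _ _ (d * l)) ?ler_wpM2l//.
by have := sqr_ge0 (p - q); nra.
Qed.

(* The planar inequality [sq_integral_le_prod] for a smooth step of [phi^2] between
   the levels [a] and [b]. *)
Lemma level_step Omega phi (a b K : R) : open Omega -> (leb2 Omega < +oo)%E ->
  Cc_infty Omega phi -> 0 <= a -> a < b ->
  0 <= K -> (forall s : R, s ^+ 2 < b -> 4 * `|s| <= K * (b - a)) ->
  fine (leb2 (super Omega phi b)) <=
    K ^+ 2 * ((\int[leb2]_(x in layer Omega phi a b) dens phi x) * fine (leb2 (super Omega phi a))).
Proof.
move=> oO Ooo Cphi a0 ab K0 HK; have mO := open_measurable_plane oO.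
have mphi : measurable_fun (Omega : set TT) (phi : TT -> R) by exact: Cc_infty_measurable Cphi.
have mS c := measurable_super c mO mphi.
have mL := measurable_layer a b mO mphi.
have [C1 Phi0 Phi1 dPhi] := cut_properties Cphi a0 ab K0 HK.
set Phi := (fun x => step _) in C1 Phi0 Phi1 dPhi.
have [M [M0 HM]] := Cc_infty_cbox Cphi.
have PhiM x : ~ cbox (- M) M (- M) M x -> Phi x = 0 by move=> nx; apply: Phi0; apply: HM; left.
have GN := sq_integral_le_prod C1 PhiM.
have subO c : super Omega phi c `<=` Omega by exact: subIsetl.
have Sfin c : leb2 (super Omega phi c) \is a fin_num.
  rewrite ge0_fin_numE//; apply: le_lt_trans Ooo; apply: le_measure; rewrite ?inE//.
set L := layer Omega phi a b in mL *.
have LS : L `<=` super Omega phi a by move=> x [xO /andP[ax _]]; split.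
have Lfin : leb2 L \is a fin_num.
  rewrite ge0_fin_numE//; apply: le_lt_trans Ooo; apply: le_measure; rewrite ?inE//.
  by move=> x [].
have Cd i : Cc_infty Omega (pd i phi) by exact: Cc_infty_pd.
have idf : leb2.-integrable L (EFin \o dens phi).
  apply: Cc_infty_integrable => //; apply: Cc_inftyD; apply: (Cc_inftyM (Cd _)) => n;
    exact: Cc_infty_Ck (Cd _).
have ia i : leb2.-integrable L (EFin \o (fun x => `|pd i phi x|)).
  by have := integrable_abse (Cc_infty_integrable mL (Cd i)); apply: eq_integrable.
pose P i := \int[leb2]_(x in L) `|pd i phi x|.
have P0 i : 0 <= P i by apply: Rintegral_ge0.
pose d := \int[leb2]_(x in L) dens phi x.
(* Cauchy-Schwarz on the layer. The measure of the layer is later bounded by that of the lower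
   superlevel set, which makes the estimate recursive. *)
have P2 i : P i ^+ 2 <= d * fine (leb2 L).
  apply: sqr_integral_le => //; first by rewrite -ge0_fin_numE.
  move=> x _; rewrite real_normK ?num_real// /dens.
  by elim/ord2P: i; [rewrite lerDl sqr_ge0|rewrite lerDr sqr_ge0].
have dPi i : (\int[leb2]_x `|pd i Phi x|%:E <= (K * P i)%:E)%E.
  rewrite EFinM /P /Rintegral fineK; last exact: integrable_fin_num (ia i).
  rewrite -ge0_integralZl//; last first.
    by apply/measurable_EFinP; have /measurable_int/measurable_EFinP := ia i.
  rewrite [leRHS]integral_mkcond; apply: ge0_le_integral => //.
  - by apply/measurable_EFinP; apply: measurableT_comp => //; exact: Ck1_measurable_pd.
  - apply/(measurable_restrictT _ mL); apply: emeasurable_funM => //.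
    by have /measurable_int := ia i.
  - move=> x _; rewrite patchE; case: ifPn => xL.
      have := dPhi i x; move: xL; rewrite inE => -[_ ->].
      by rewrite -EFinM lee_fin.
    have := dPhi i x; case: ifPn => [xab _|_]; last by rewrite lee_fin.
    (* A point whose level lies in the range but which is not in [L] lies outside [Omega], where the
       derivative of a test function vanishes. *)
    have [px|px] := eqVneq (pd i phi x) 0.
      have H := dPhi i x; rewrite xab px normr0 mulr0 in H.
      by rewrite lee_fin.
    exfalso; move/negP : xL; apply; rewrite inE; split => //.
    have [H [_ HO H0]] := Cc_infty_supp (Cd i); apply: HO; apply: contrapT => /H0 /eqP.
    by rewrite (negbTE px).
have m1 : (leb2 (super Omega phi b) <= \int[leb2]_x (Phi x ^+ 2)%:E)%E.
  rewrite -[X in (X <= _)%E]mul1e -integral_cst// integral_mkcond.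
  apply: ge0_le_integral => //.
  - by move=> x _; rewrite patchE; case: ifP => _ //; rewrite lee_fin.
  - by apply/(measurable_restrictT _ (mS b)); exact: measurable_cst.
  - by apply: measurable_sqr; apply: continuous_measurable_plane; exact: Ck_continuous C1.
  - move=> x _; rewrite patchE; case: ifPn => [|_]; last by rewrite lee_fin sqr_ge0.
    by rewrite inE => -[_ bx]; rewrite /Phi Phi1// expr1n.
have : (leb2 (super Omega phi b) <= ((K * P ord0) * (K * P ord_max))%:E)%E.
  apply: (le_trans m1); apply: (le_trans GN); rewrite EFinM.
  by apply: lee_pmul; rewrite ?integral_ge0//; exact: dPi.
rewrite -[X in (X <= _)%E]fineK// lee_fin => H; apply: (le_trans H).
have d0 : 0 <= d by apply: Rintegral_ge0 => x _; rewrite /dens addr_ge0 ?sqr_ge0.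
apply: (mul_le_of_sqr_le K d0 _ (P2 ord0) (P2 ord_max)).
apply: fine_le; [exact: Lfin|exact: Sfin|].
by apply: le_measure; rewrite ?inE.
Qed.

End LevelSets.

(** * Trudinger's inequality *)

Section Trudinger.
Context {R : realType}.
Implicit Types (f g h phi psi u : R * R -> R) (x : R * R) (i j k : 'I_2).
Implicit Types (Omega K A : set (R * R)).
Local Notation TT := (measurableTypeR R * measurableTypeR R)%type.

Lemma dens_ge0 phi x : 0 <= dens phi x.
Proof. by rewrite /dens addr_ge0 ?sqr_ge0. Qed.

Lemma dens_integrable Omega phi (D : set TT) : measurable D -> Cc_infty Omega phi ->
  leb2.-integrable D (EFin \o dens phi).
Proof.
move=> mD Cphi; have Cd i : Cc_infty Omega (pd i phi) by exact: Cc_infty_pd.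
have Cdd : Cc_infty Omega (dens phi).
  by apply: Cc_inftyD; apply: (Cc_inftyM (Cd _)) => n; exact: Cc_infty_Ck (Cd _).
exact: Cc_infty_integrable Cdd.
Qed.

Lemma sum_layers_le Omega phi (a : nat -> R) n : measurable (Omega : set TT) ->
  Cc_infty Omega phi -> (forall m, a m <= a m.+1) -> a 0%N = 0 ->
  \sum_(m < n) (\int[leb2]_(x in layer Omega phi (a m) (a m.+1)) dens phi x)
    <= \int[leb2]_(x in Omega) dens phi x.
Proof.
move=> mO Cphi ainc a0.
have mphi : measurable_fun (Omega : set TT) (phi : TT -> R) by exact: Cc_infty_measurable Cphi.
have mL b c := measurable_layer b c mO mphi.
have age m : 0 <= a m by elim: m => [|m IH]; rewrite ?a0// (le_trans IH).
have -> : \sum_(m < n) (\int[leb2]_(x in layer Omega phi (a m) (a m.+1)) dens phi x)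
    = \int[leb2]_(x in layer Omega phi 0 (a n)) dens phi x.
  elim: n => [|n IH].
    rewrite big_ord0 a0 (_ : layer Omega phi 0 0 = set0) ?Rintegral_set0//.
    by apply/seteqP; split => // x [_ /andP[l1 l2]]; have := le_lt_trans l1 l2; rewrite ltxx.
  rewrite big_ord_recr /= IH -Rintegral_setU//.
  - congr (Rintegral _ _ _); apply/seteqP; split => x; rewrite /layer /=.
      move=> [[xO /andP[l1 l2]]|[xO /andP[l1 l2]]]; split => //.
        by rewrite l1 (lt_le_trans l2).
      by rewrite l2 (le_trans _ l1).
    move=> [xO /andP[l1 l2]]; have [lt|ge] := ltP (phi x ^+ 2) (a n); first by left; rewrite l1.
    by right; split.
  - by apply: dens_integrable Cphi; exact: measurableU.
  - apply/disj_setPS => x [[_ /andP[_ l2]] [_ /andP[l1 _]]].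
    by have := lt_le_trans l2 l1; rewrite ltxx.
rewrite /Rintegral; apply: fine_le.
- exact: integrable_fin_num (dens_integrable (mL _ _) Cphi).
- exact: integrable_fin_num (dens_integrable mO Cphi).
apply: ge0_subset_integral => //.
- by have /measurable_int := dens_integrable mO Cphi.
- by move=> x _; rewrite lee_fin dens_ge0.
- by move=> x [].
Qed.

Lemma AGM_ord n (E : 'I_n -> R) : (forall m : 'I_n, 0 <= E m) ->
  \prod_(m < n) E m <= ((\sum_(m < n) E m) / n%:R) ^+ n.
Proof.
move=> E0; have := @leif_AGM _ 'I_n predT E.
by rewrite card_ord => /(_ (fun m _ => E0 m)) [].
Qed.

Lemma mul_step (c d l P m : R) : 0 <= c -> 0 <= d -> l <= P * m ->
  c * (d * l) <= P * (c * d) * m.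
Proof. by move=> c0 d0 /(ler_wpM2l (mulr_ge0 c0 d0)); nra. Qed.

(* The product of [level_step] over [n] levels; the layers are disjoint, so AM-GM
   bounds the product of their Dirichlet integrals. *)
Lemma super_decay Omega phi (h : R) n : open Omega -> (leb2 Omega < +oo)%E ->
  Cc_infty Omega phi -> 0 < h -> (0 < n)%N ->
  fine (leb2 (super Omega phi ((n%:R * h) ^+ 2))) <=
  (16 * (\int[leb2]_(x in Omega) dens phi x) / (n%:R * h ^+ 2)) ^+ n * fine (leb2 Omega).
Proof.
move=> oO Ooo Cphi h0 n0; have mO := open_measurable_plane oO.
pose a m : R := (m%:R * h) ^+ 2.
have ainc m : a m < a m.+1.
  by rewrite /a ltr_pXn2r// ?nnegrE ?mulr_ge0 ?(ltW h0)// ltr_pM2r// ltr_nat.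
have a0 : a 0%N = 0 by rewrite /a mul0r expr0n.
have age m : 0 <= a m by exact: sqr_ge0.
(* The levels are equally spaced in $|\phi|$, so $a_{m+1} - a_m = (2m+1)h^2$, while $|s| < (m+1)h
   \le (2m+1)h$ below the upper level. The constant 16 of the statement is $K^2h^2$. *)
pose K := 4 / h.
have K0 : 0 <= K by rewrite divr_ge0// ltW.
pose d m := \int[leb2]_(x in layer Omega phi (a m) (a m.+1)) dens phi x.
have d0 m : 0 <= d m by apply: Rintegral_ge0 => x _; exact: dens_ge0.
have stepm m : fine (leb2 (super Omega phi (a m.+1))) <=
    K ^+ 2 * (d m * fine (leb2 (super Omega phi (a m)))).
  apply: level_step => // s sa.
  have sh : `|s| < m.+1%:R * h.
    rewrite -(@ltr_pXn2r _ 2)// ?nnegrE ?mulr_ge0 ?(ltW h0)//.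
    by rewrite real_normK ?num_real.
  have -> : K * (a m.+1 - a m) = 4 * ((2 * m%:R + 1) * h).
    by rewrite /K /a -natr1; field; rewrite gt_eqF.
  rewrite ler_pM2l// (le_trans (ltW sh))// ler_pM2r// -natr1 lerD2r.
  by rewrite ler_peMl// ler1n.
have indm m : fine (leb2 (super Omega phi (a m))) <=
    \prod_(i < m) (K ^+ 2 * d i) * fine (leb2 (super Omega phi (a 0%N))).
  elim: m => [|m IH]; first by rewrite big_ord0 mul1r.
  apply: (le_trans (stepm m)); rewrite big_ord_recr.
  exact: mul_step (sqr_ge0 K) (d0 m) IH.
have E0 : super Omega phi (a 0%N) = Omega.
  by apply/seteqP; split => x; [case|move=> xO; split => //=; rewrite a0 sqr_ge0].
have := indm n; rewrite E0 -/(a n) => H; apply: (le_trans H).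
apply: ler_wpM2r; first exact: fine_ge0.
have Kd0 (i : 'I_n) : 0 <= K ^+ 2 * d i by rewrite mulr_ge0 ?sqr_ge0.
apply: (le_trans (AGM_ord Kd0)).
have s0 : 0 <= \sum_(i < n) K ^+ 2 * d i by exact: sumr_ge0.
have D0 : 0 <= \int[leb2]_(x in Omega) dens phi x by apply: Rintegral_ge0 => x _; exact: dens_ge0.
have nh : 0 < n%:R * h ^+ 2 by rewrite mulr_gt0 ?ltr0n// exprn_gt0.
rewrite lerXn2r ?nnegrE//.
- by rewrite divr_ge0.
- by rewrite divr_ge0 ?mulr_ge0// ltW.
rewrite -mulr_sumr.
have := sum_layers_le n mO Cphi (fun m => ltW (ainc m)) a0.
have n0' : 0 < n%:R :> R by rewrite ltr0n.
move=> sl; apply: (@le_trans _ _ (K ^+ 2 * (\int[leb2]_(x in Omega) dens phi x) / n%:R)).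
  by rewrite ler_pM2r ?invr_gt0// ler_wpM2l ?sqr_ge0.
rewrite le_eqVlt; apply/orP; left; apply/eqP; rewrite /K.
move: (\int[leb2]_(x in Omega) dens phi x) => D; clear -n0' h0.
by field; rewrite !gt_eqF.
Qed.

(** The spacing is chosen so that $nh^2 = 64X$: the level $(nh)^2$ becomes $64nX$, and the ratio
    $16X/(nh^2)$ becomes $1/4$. *)
Lemma super_decay_geometric Omega phi (X : R) n : open Omega -> (leb2 Omega < +oo)%E ->
  Cc_infty Omega phi -> 0 < X -> \int[leb2]_(x in Omega) dens phi x <= X ->
  fine (leb2 (super Omega phi (64 * n%:R * X))) <= 4^-1 ^+ n * fine (leb2 Omega).
Proof.
move=> oO Ooo Cphi X0 DX; case: n => [|n].
  rewrite expr0 mul1r mulr0 mul0r le_eqVlt; apply/orP; left; apply/eqP; congr (fine (leb2 _)).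
  by apply/seteqP; split => x; [case|move=> xO; split => //=; rewrite sqr_ge0].
set h : R := Num.sqrt (64 * X / n.+1%:R).
have q0 : 0 < 64 * X / n.+1%:R by rewrite divr_gt0 ?mulr_gt0.
have h0 : 0 < h by rewrite sqrtr_gt0.
have h2 : h ^+ 2 = 64 * X / n.+1%:R by rewrite sqr_sqrtr// ltW.
have EM : n.+1%:R ^+ 2 * (64 * X / n.+1%:R) = 64 * n.+1%:R * X.
  have : n.+1%:R != 0 :> R by rewrite pnatr_eq0.
  by move: (n.+1%:R) => m m0; field.
have := super_decay oO Ooo Cphi h0 (ltn0Sn n).
have -> : (n.+1%:R * h) ^+ 2 = 64 * n.+1%:R * X by rewrite exprMn h2; exact: EM.
move=> H; apply: (le_trans H); apply: ler_wpM2r; first exact: fine_ge0.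
have D0 : 0 <= \int[leb2]_(x in Omega) dens phi x by apply: Rintegral_ge0 => x _; exact: dens_ge0.
have nh : n.+1%:R * h ^+ 2 = 64 * X by rewrite h2 mulrC divfK ?pnatr_eq0.
rewrite nh lerXn2r ?nnegrE ?divr_ge0 ?mulr_ge0 ?(ltW X0)//.
rewrite ler_pdivrMr ?mulr_gt0//; move: DX D0 X0.
by move: (\int[leb2]_(x in Omega) dens phi x) => D; clear; lra.
Qed.

Lemma expR_ln2_natmul n : expR (ln 2 * n%:R) = 2 ^+ n :> R.
Proof. by rewrite mulrC expRM_natl lnK// posrE. Qed.

(** With $n$ the integer part of $\phi^2/(64X)$, the integrand is at most $2^{n+1}$ and the point
    lies in a set of measure at most $4^{-n}|\Omega|$. The products $2^{n+1}4^{-n} = 4 \cdot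
    2^{-(n+1)}$ have sum 4. *)
Lemma trudinger_test Omega phi (X : R) : open Omega -> (leb2 Omega < +oo)%E ->
  Cc_infty Omega phi -> 0 < X -> \int[leb2]_(x in Omega) dens phi x <= X ->
  (\int[leb2]_(x in Omega) (expR (ln 2 * (phi x ^+ 2 / (64 * X))))%:E <=
    (4 * fine (leb2 Omega))%:E)%E.
Proof.
move=> oO Ooo Cphi X0 DX; have mO := open_measurable_plane oO.
have mphi : measurable_fun (Omega : set TT) (phi : TT -> R) by exact: Cc_infty_measurable Cphi.
pose S n := super Omega phi (64 * n%:R * X).
have mS n : measurable (S n) := measurable_super _ mO mphi.
have X64 : 0 < 64 * X by rewrite mulr_gt0.
pose G n (x : TT) : \bar R := (2 ^+ n.+1 * \1_(S n) x)%:E.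
have G0 n x : (0 <= G n x)%E by rewrite lee_fin mulr_ge0 ?exprn_ge0.
have mG n : measurable_fun (Omega : set TT) (G n).
  by apply/measurable_EFinP; apply: measurable_funM => //; exact: measurable_indic.
apply: (@le_trans _ _ (\int[leb2]_(x in Omega) (\sum_(n <oo) G n x))%E).
  apply: ge0_le_integral => //.
  - apply/measurable_EFinP; apply: measurableT_comp => //.
    apply: measurable_funM => //; apply: measurable_funM => //.
    exact: measurable_funX.
  - by apply: ge0_emeasurable_sum => // n x _ _.
  - move=> x xO; pose y := phi x ^+ 2 / (64 * X).
    have y0 : 0 <= y by rewrite divr_ge0 ?sqr_ge0 ?ltW.
    have /andP[ny yn] := truncn_itv y0; set n := Num.truncn y in ny yn.
    apply: (@le_trans _ _ (G n x)).
      rewrite lee_fin indicE mem_set ?mulr1; last first.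
        split => //=; move: ny; rewrite /y ler_pdivlMr//.
        by rewrite mulrA [n%:R * _]mulrC.
      by rewrite -expR_ln2_natmul ler_expR ler_wpM2l ?ln_ge0 ?ler1n// ltW.
    by rewrite (nneseriesD1 (n := n))// leeDl// nneseries_ge0.
rewrite integral_nneseries//.
have Sfin n : leb2 (S n) \is a fin_num.
  rewrite ge0_fin_numE//; apply: le_lt_trans Ooo; apply: le_measure; rewrite ?inE//.
  exact: subIsetl.
apply: (@le_trans _ _ (\sum_(n <oo) ((4 * fine (leb2 Omega)) / (2 ^ n.+1)%:R)%:E)%E); last first.
  by apply: epsilon_trick0; rewrite mulr_ge0// fine_ge0.
apply: lee_nneseries => [n _ _|n _]; first exact: integral_ge0.
have -> : (\int[leb2]_(x in Omega) G n x = (2 ^+ n.+1)%:E * leb2 (S n))%E.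
  rewrite /G; under eq_integral do rewrite EFinM.
  rewrite ge0_integralZl//; last by apply/measurable_EFinP; exact: measurable_indic.
  rewrite integral_indic//; congr (_ * leb2 _)%E.
  by apply/setIidPl; exact: subIsetl.
rewrite -[X in (_ * X <= _)%E]fineK// -EFinM lee_fin.
have := super_decay_geometric n oO Ooo Cphi X0 DX.
move=> /(ler_wpM2l (exprn_ge0 n.+1 (ler0n R 2))) H; apply: (le_trans H).
rewrite le_eqVlt; apply/orP; left; apply/eqP.
have -> : 4^-1 = 2^-1 * 2^-1 :> R by field.
rewrite natrX exprMn !exprS exprVn; move: (fine _) => m.
have : 2 ^+ n != 0 :> R by rewrite expf_neq0.
by move: (2 ^+ n) => c c0; clear -c0; field.
Qed.

(** The bound is asked only from the rank [N] on, because it usually comes from a convergence. *)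
Lemma fatou_le Omega (f_ : nat -> R * R -> R) f (C : \bar R) N : measurable (Omega : set TT) ->
  (forall n, measurable_fun (Omega : set TT) (f_ n : TT -> R)) ->
  measurable_fun (Omega : set TT) (f : TT -> R) ->
  (forall n x, 0 <= f_ n x) -> (forall x, 0 <= f x) ->
  {ae leb2, forall x, Omega x -> f_ n x @[n --> \oo] --> f x} ->
  (forall n, (N <= n)%N -> (\int[leb2]_(x in Omega) (f_ n x)%:E <= C)%E) ->
  (\int[leb2]_(x in Omega) (f x)%:E <= C)%E.
Proof.
move=> mO mf_ mf f_0 f0 ff fC.
pose g n (x : TT) : \bar R := (f_ (n + N)%N x)%:E.
have mg n : measurable_fun (Omega : set TT) (g n) by apply/measurable_EFinP; exact: mf_.
have := fatou leb2 mO mg (fun n x _ => _); move=> /(_ _) F.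
apply: (@le_trans _ _ (\int[leb2]_(x in Omega) limn_einf (g^~ x))%E).
  apply: ae_ge0_le_integral => //.
  - by move=> x _; rewrite lee_fin.
  - exact/measurable_EFinP.
  - move=> x _; rewrite limn_einf_lim; apply: lime_ge; first exact: is_cvg_einfs.
    near=> n; apply: le_ereal_inf_tmp => _ [m _ <-]; rewrite lee_fin; exact: f_0.
  - have -> : (fun x => limn_einf (g^~ x)) = (fun x => - limn_esup ((fun n y => - g n y)^~ x))%E.
      apply/funext => x; rewrite -limn_einfN; congr limn_einf.
      by apply/funext => n; rewrite /= /g /= opprK.
    apply: measurableT_comp => //; apply: measurable_fun_limn_esup => n.
    exact: measurableT_comp.
  - apply: ae_mono ff => x /[apply] c.
    have c' : g n x @[n --> \oo] --> (f x)%:E.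
      by apply: cvg_EFin; [near=> n|rewrite (cvg_shiftn N (fun n => f_ n x))].
    by rewrite (cvg_limn_einf_sup c').1.
apply: (le_trans (F (fun n x => f_0 (n + N)%N x))).
rewrite limn_einf_lim; apply: lime_le; first exact: is_cvg_einfs.
near=> n; apply: (@le_trans _ _ (\int[leb2]_(x in Omega) g n x)%E).
  by apply: ereal_inf_lbound; exists n => /=.
by apply: fC; rewrite leq_addl.
Unshelve. all: by end_near. Qed.

(** The Dirichlet integrals of the approximating test functions converge to a limit at most [X], so
    they are eventually at most $2X$. This doubles the constant 64 to 128. *)
Lemma trudinger Omega w (G : 'I_2 -> R * R -> R) (X : R) : open Omega -> (leb2 Omega < +oo)%E ->
  measurable_fun Omega w -> (forall i, measurable_fun Omega (G i)) ->
  approximable Omega w G -> 0 < X ->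
  \int[leb2]_(x in Omega) (G ord0 x ^+ 2 + G ord_max x ^+ 2) <= X ->
  (\int[leb2]_(x in Omega) (expR (ln 2 * (w x ^+ 2 / (128 * X))))%:E <=
    (4 * fine (leb2 Omega))%:E)%E.
Proof.
move=> oO Ooo mw mG [phi_ [D [Cphi iD cphi bphi]]] X0 GX.
have mO := open_measurable_plane oO.
have mphi n : measurable_fun (Omega : set TT) (phi_ n : TT -> R) by exact: Cc_infty_measurable (Cphi n).
have i2 : leb2.-integrable Omega (EFin \o (fun x => 2 * D x)).
  by have := integrableZl mO 2 iD; apply: eq_integrable.
have md n : measurable_fun (Omega : set TT) (dens (phi_ n) : TT -> R).
  by have /measurable_int/measurable_EFinP := dens_integrable mO (Cphi n).
have mGG : measurable_fun (Omega : set TT) ((fun x => G ord0 x ^+ 2 + G ord_max x ^+ 2) : TT -> R).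
  by apply: measurable_funD; apply: measurable_funX; exact: mG.
have [] := @dominated_convergenceR _ Omega (fun n => dens (phi_ n)) _ (fun x => 2 * D x) mO md mGG i2.
- by apply: ae_mono cphi => x /[apply] -[_ c]; apply: cvgD; apply: cvg_sqr; exact: c.
- apply: ae_mono bphi => x /[apply] b n; have [_ {}b] := b n.
  rewrite ger0_norm ?dens_ge0// /dens mulr_natl mulr2n.
  by apply: lerD; exact: b.
move=> _ _ lim.
have X2 : X < 2 * X by rewrite ltr_pMl// ltr1n.
have [N _ HN] : \forall n \near \oo, \int[leb2]_(x in Omega) dens (phi_ n) x <= 2 * X.
  apply: (cvgr_le _ lim); exact: le_lt_trans GX X2.
have E128 : 128 * X = 64 * (2 * X) by ring.
rewrite E128.
have mexp v : measurable_fun (Omega : set TT) (v : TT -> R) ->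
    measurable_fun (Omega : set TT) ((fun x => expR (ln 2 * (v x ^+ 2 / (64 * (2 * X))))) : TT -> R).
  move=> mv; apply: measurableT_comp => //.
  by apply: measurable_funM => //; apply: measurable_funM => //; exact: measurable_funX.
apply: (@fatou_le _ (fun n x => expR (ln 2 * (phi_ n x ^+ 2 / (64 * (2 * X))))) _ _ N mO).
- by move=> n; exact: mexp.
- exact: mexp.
- by move=> n x; exact: expR_ge0.
- by move=> x; exact: expR_ge0.
- apply: ae_mono cphi => x /[apply] -[c _]; apply: continuous_cvg; first exact: continuous_expR.
  apply: cvgM; first exact: cvg_cst.
  by apply: cvgM; [exact: cvg_sqr|exact: cvg_cst].
- move=> n Nn; apply: trudinger_test => //; first by rewrite mulr_gt0.
  exact: HN.
Qed.

End Trudinger.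

(** * Algebra of the Lame form *)

Section LameAlgebra.
Context {R : realType}.
Implicit Types (a b c d r s delta la mu beta : R).

(** After multiplication by $1 - \delta/2 > 0$ and completion of the square in $b$, the coefficient
    left on $a^2$ is $1 - r^2 - s^2 - \delta$ plus a nonnegative term. *)
Lemma quadratic_form_lb r s delta a b : 0 < delta -> r ^+ 2 + s ^+ 2 + delta <= 1 ->
  delta / 2 * (a ^+ 2 + b ^+ 2) <= (1 - s ^+ 2) * a ^+ 2 + b ^+ 2 + 2 * r * a * b.
Proof.
move=> d0 H.
have s0 := sqr_ge0 s; have r0 := sqr_ge0 r.
pose B := 1 - delta / 2; have B0 : 0 < B by rewrite /B; lra.
rewrite -subr_ge0 -(pmulr_rge0 _ B0).
have -> : B * ((1 - s ^+ 2) * a ^+ 2 + b ^+ 2 + 2 * r * a * b - delta / 2 * (a ^+ 2 + b ^+ 2)) =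
    (B * b + r * a) ^+ 2 + (1 - r ^+ 2 - s ^+ 2 - delta + delta / 2 * (s ^+ 2 + delta / 2)) * a ^+ 2.
  by rewrite /B; field.
have e0 : 0 <= delta / 2 * (s ^+ 2 + delta / 2) by rewrite mulr_ge0 ?addr_ge0//; lra.
apply: addr_ge0; first exact: sqr_ge0.
by apply: mulr_ge0; [lra|exact: sqr_ge0].
Qed.

(** The function $m/(1+m)$ is increasing and equals $s$ at $m = s/(1-s)$, which is $(p-2)/2$ when $s
    = 1 - 2/p$. *)
Lemma ratio_sqr_le (m s : R) : 0 <= m -> 0 <= s -> s < 1 -> m * (1 - s) <= s ->
  (m / (1 + m)) ^+ 2 <= s ^+ 2.
Proof.
move=> m0 s0 s1 ms; rewrite ler_sqr ?nnegrE//; last by rewrite divr_ge0// addr_ge0.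
by rewrite ler_pdivrMr; lra.
Qed.

(* Here u lies along the first axis and [m = beta |u|^2].  With this multiple of the
   determinant both cross terms get the relative coefficient [r]. *)
Lemma lame_lb_aligned la mu r s delta k (m a b c d : R) :
  0 < mu -> 0 < la + 2 * mu -> 0 < delta -> 0 <= s -> s < 1 ->
  r = (la + mu) / (la + 3 * mu) -> r ^+ 2 + s ^+ 2 + delta <= 1 ->
  k <= delta / 2 * mu -> k <= delta / 2 * (la + 2 * mu) ->
  0 <= m -> m * (1 - s) <= s ->
  k * ((a * (1 + m)) ^+ 2 + b ^+ 2 + (c * (1 + m)) ^+ 2 + d ^+ 2)
    - 4 * (mu ^+ 2 / (la + 3 * mu)) * ((1 + m) * (a * d - b * c)) <=
  la * ((a + d) * (a * (1 + 2 * m) + d)) +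
  mu * (2 * (a ^+ 2 * (1 + 2 * m) + d ^+ 2) + c ^+ 2 * (1 + 2 * m) + b ^+ 2 + b * c * (2 + 2 * m)).
Proof.
move=> mu0 la0 d0 s0 s1 rE rsd k1 k2 m0 ms.
have L0 : la + 3 * mu != 0 by rewrite gt_eqF//; lra.
(* [A] and [C] are the entries of the gradient of $w$ along $u$, up to the weight. As $1 + 2m =
   (1+m)^2 - m^2$, the products $a^2(1+2m)$ and $c^2(1+2m)$ become $(1-t)A^2$ and $(1-t)C^2$. *)
pose A := a * (1 + m); pose C := c * (1 + m); pose t := (m / (1 + m)) ^+ 2.
have M0 : 1 + m != 0 by rewrite gt_eqF//; lra.
have ts : t <= s ^+ 2 by exact: ratio_sqr_le.
have E : la * ((a + d) * (a * (1 + 2 * m) + d)) +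
  mu * (2 * (a ^+ 2 * (1 + 2 * m) + d ^+ 2) + c ^+ 2 * (1 + 2 * m) + b ^+ 2 + b * c * (2 + 2 * m)) =
  (la + 2 * mu) * ((1 - t) * A ^+ 2 + d ^+ 2 + 2 * r * A * d) +
  mu * ((1 - t) * C ^+ 2 + b ^+ 2 + 2 * r * C * b)
  - 4 * (mu ^+ 2 / (la + 3 * mu)) * ((1 + m) * (a * d - b * c)).
  by rewrite /t /A /C rE; field; apply/andP.
rewrite E -/A -/C lerB//.
have q x y : delta / 2 * (x ^+ 2 + y ^+ 2) <= (1 - t) * x ^+ 2 + y ^+ 2 + 2 * r * x * y.
  apply: (le_trans (quadratic_form_lb x y d0 rsd)).
  by rewrite !lerD2r ler_wpM2r ?sqr_ge0// lerB.
have -> : k * (A ^+ 2 + b ^+ 2 + C ^+ 2 + d ^+ 2) = k * (A ^+ 2 + d ^+ 2) + k * (C ^+ 2 + b ^+ 2) by ring.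
have h x y z : k <= delta / 2 * z -> 0 < z ->
    k * (x ^+ 2 + y ^+ 2) <= z * ((1 - t) * x ^+ 2 + y ^+ 2 + 2 * r * x * y).
  move=> kz z0; apply: (@le_trans _ _ (z * (delta / 2 * (x ^+ 2 + y ^+ 2)))).
    by rewrite mulrA (mulrC z) ler_wpM2r// addr_ge0 ?sqr_ge0.
  by rewrite ler_pM2l.
by apply: lerD; exact: h.
Qed.

Lemma unit_vector_scaling (u0 u1 : R) : exists n x y,
  [/\ x ^+ 2 + y ^+ 2 = 1, u0 = n * x & u1 = n * y].
Proof.
pose n := Num.sqrt (u0 ^+ 2 + u1 ^+ 2).
have n2 : n ^+ 2 = u0 ^+ 2 + u1 ^+ 2 by rewrite sqr_sqrtr// addr_ge0 ?sqr_ge0.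
case: (eqVneq n 0) => [n0|n0].
  (* At the origin any unit vector serves as the direction. *)
  exists 0, 1, 0; move: n2; rewrite n0 expr0n /= => /esym/eqP.
  rewrite paddr_eq0 ?sqr_ge0// !sqrf_eq0 => /andP[/eqP -> /eqP ->].
  by split; ring.
exists n, (u0 / n), (u1 / n); split; try by field.
by rewrite !expr_div_n -mulrDl -n2 divff// sqrf_eq0.
Qed.

(** The Lamé form, the norm and the determinant are invariant under rotations, and a rotation brings
    $(u_0, u_1)$ to the first axis. Up to the weight, the [p] are the entries of the gradient of $w$
    and the [q] those of the gradient of the test function, in which the radial correction is
    doubled. *)
Lemma lame_lower_bound la mu s delta k beta (g00 g01 g10 g11 u0 u1 : R) :
  0 < mu -> 0 < la + 2 * mu -> 0 < delta -> 0 <= s -> s < 1 ->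
  ((la + mu) / (la + 3 * mu)) ^+ 2 + s ^+ 2 + delta <= 1 ->
  k <= delta / 2 * mu -> k <= delta / 2 * (la + 2 * mu) ->
  0 <= beta -> beta * (u0 ^+ 2 + u1 ^+ 2) * (1 - s) <= s ->
  let z0 := g00 * u0 + g01 * u1 in let z1 := g10 * u0 + g11 * u1 in
  let p00 := g00 + beta * z0 * u0 in let p01 := g01 + beta * z0 * u1 in
  let p10 := g10 + beta * z1 * u0 in let p11 := g11 + beta * z1 * u1 in
  let q00 := g00 + 2 * beta * z0 * u0 in let q01 := g01 + 2 * beta * z0 * u1 in
  let q10 := g10 + 2 * beta * z1 * u0 in let q11 := g11 + 2 * beta * z1 * u1 in
  k * (p00 ^+ 2 + p10 ^+ 2 + (p01 ^+ 2 + p11 ^+ 2))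
    - 4 * (mu ^+ 2 / (la + 3 * mu)) * (p00 * p11 - p01 * p10) <=
  la * ((g00 + g11) * (q00 + q11)) +
  mu * ((g00 * q00 + g01 * q01 + g10 * q10 + g11 * q11) +
        (g00 * q00 + g01 * q10 + g10 * q01 + g11 * q11)).
Proof.
move=> mu0 la0 d0 s0 s1 rsd k1 k2 b0 bt.
have [n [x [y [xy uE vE]]]] := unit_vector_scaling u0 u1.
have y2 : y ^+ 2 = 1 - x ^+ 2 by rewrite -xy; ring.
(* The entries of the matrix [g] in the rotated frame. The inverse formulas that follow hold because
   $x^2 + y^2 = 1$. *)
pose a := g00 * x ^+ 2 + (g01 + g10) * x * y + g11 * y ^+ 2.
pose b := g01 * x ^+ 2 + (g11 - g00) * x * y - g10 * y ^+ 2.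
pose c := g10 * x ^+ 2 + (g11 - g00) * x * y - g01 * y ^+ 2.
pose d := g11 * x ^+ 2 - (g01 + g10) * x * y + g00 * y ^+ 2.
have E00 : g00 = a * x ^+ 2 - (b + c) * x * y + d * y ^+ 2 by rewrite /a /b /c /d; ring: y2.
have E01 : g01 = b * x ^+ 2 + (a - d) * x * y - c * y ^+ 2 by rewrite /a /b /c /d; ring: y2.
have E10 : g10 = c * x ^+ 2 + (a - d) * x * y - b * y ^+ 2 by rewrite /a /b /c /d; ring: y2.
have E11 : g11 = d * x ^+ 2 + (b + c) * x * y + a * y ^+ 2 by rewrite /a /b /c /d; ring: y2.
pose m := beta * n ^+ 2.
have mE : beta * (u0 ^+ 2 + u1 ^+ 2) = m by rewrite /m uE vE !exprMn -mulrDr xy mulr1.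
have m0 : 0 <= m by rewrite mulr_ge0// sqr_ge0.
rewrite mE in bt.
have := lame_lb_aligned a b c d mu0 la0 d0 s0 s1 erefl rsd k1 k2 m0 bt.
move: (mu ^+ 2 / _) => f H /=.
have key (A B C D A' B' C' D' : R) : A = A' -> B = B' -> C = C' -> D = D' ->
   k * A' - 4 * f * B' <= la * C' + mu * D' -> k * A - 4 * f * B <= la * C + mu * D.
  by move=> -> -> -> ->.
apply: (key _ _ _ _ _ _ _ _ _ _ _ _ H); rewrite {H key}.
all: rewrite /m uE vE; move: a b c d E00 E01 E10 E11 => a b c d -> -> -> ->; clear -y2; ring: y2.
Qed.

End LameAlgebra.

(** * Truncations *)

Section Truncation.
Context {R : realType}.
Implicit Types (f g h phi psi u v : R * R -> R) (x : R * R) (i j k : 'I_2).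
Implicit Types (Omega : set (R * R)) (eps al a b t : R).
Local Notation TT := (measurableTypeR R * measurableTypeR R)%type.

(* A smooth approximation of [t], with values in [[eps, eps^-1]]. *)
Definition trunc eps t : R := (t + eps) / (1 + eps * t).

(* The logarithmic derivative of [trunc eps]. *)
Definition trunc_dln eps t : R := (1 - eps ^+ 2) / ((t + eps) * (1 + eps * t)).

(** For [al] equal to $(p-2)/2$ this truncates $|u|^{p-2}$; half that exponent gives the square
    root, which multiplies $u$ in $w$. *)
Definition weight eps al a b : R := trunc eps (a ^+ 2 + b ^+ 2) `^ al.

Lemma trunc_ge eps t : 0 < eps -> eps < 1 -> 0 <= t -> eps <= trunc eps t.
Proof.
move=> e0 e1 t0; have et : 0 <= eps * t by rewrite mulr_ge0// ltW.
rewrite /trunc ler_pdivlMr; last lra.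
have : eps * (eps * t) <= 1 * t by rewrite mulrA ler_wpM2r//; nra.
lra.
Qed.

Lemma trunc_le eps t : 0 < eps -> eps < 1 -> 0 <= t -> trunc eps t <= eps^-1.
Proof.
move=> e0 e1 t0; have et : 0 <= eps * t by rewrite mulr_ge0// ltW.
rewrite /trunc ler_pdivrMr; last lra.
rewrite mulrDr mulr1 mulrA mulVf ?gt_eqF// mul1r addrC lerD2r.
by apply: (@le_trans _ _ 1); [exact: ltW|rewrite invf_ge1//; exact: ltW].
Qed.

Lemma trunc_gt0 eps t : 0 < eps -> eps < 1 -> 0 <= t -> 0 < trunc eps t.
Proof. by move=> e0 e1 t0; exact: (lt_le_trans e0 (trunc_ge e0 e1 t0)). Qed.

Lemma trunc_dln_ge0 eps t : 0 < eps -> eps < 1 -> 0 <= t -> 0 <= trunc_dln eps t.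
Proof.
move=> e0 e1 t0; have et : 0 <= eps * t by rewrite mulr_ge0// ltW.
by rewrite /trunc_dln divr_ge0// ?mulr_ge0; nra.
Qed.

(** On a logarithmic scale the truncation has slope at most 1, the slope of $t$ itself. The
    ellipticity condition for the untruncated power therefore serves for every [eps]. *)
Lemma trunc_dln_le eps t : 0 < eps -> eps < 1 -> 0 <= t -> trunc_dln eps t * t <= 1.
Proof.
move=> e0 e1 t0; have et : 0 <= eps * t by rewrite mulr_ge0// ltW.
have ett : 0 <= eps * t * t by rewrite mulr_ge0.
have eet : 0 <= eps * eps * t by rewrite !mulr_ge0// ltW.
rewrite /trunc_dln mulrAC ler_pdivrMr ?mul1r; last by rewrite mulr_gt0//; lra.
rewrite -subr_ge0.
have -> : (t + eps) * (1 + eps * t) - (1 - eps ^+ 2) * t = eps * t * t + eps + 2 * (eps * eps * t) by ring.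
lra.
Qed.

Lemma sumsq_ge0 a b : 0 <= a ^+ 2 + b ^+ 2.
Proof. by rewrite addr_ge0 ?sqr_ge0. Qed.
Hint Resolve sumsq_ge0 : core.

Section Smooth.
Variables (eps : R) (e0 : 0 < eps) (e1 : eps < 1).

Lemma Ck_sumsq n f g : Ck n f -> Ck n g -> Ck n (fun y => f y ^+ 2 + g y ^+ 2).
Proof. by move=> Cf Cg; apply: CkD; apply: CkM. Qed.

Lemma denominator_gt0 a b : 0 < 1 + eps * (a ^+ 2 + b ^+ 2).
Proof. by rewrite ltr_pwDl// mulr_ge0// ltW. Qed.

Lemma CkV n h : (forall x, 0 < h x) -> Ck n h -> Ck n (fun y => (h y)^-1).
Proof.
move=> h0 Ch; have := Ck_powR (-1) h0 Ch.
by under eq_fun do rewrite powR_inv1 ?ltW//.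
Qed.

Lemma Ck_trunc n f g : Ck n f -> Ck n g -> Ck n (fun y => trunc eps (f y ^+ 2 + g y ^+ 2)).
Proof.
move=> Cf Cg; have Ct := Ck_sumsq Cf Cg.
apply: CkM; first by apply: CkD => //; exact: Ck_cst.
apply: CkV; first by move=> x; exact: denominator_gt0.
by apply: CkD; [exact: Ck_cst|exact: CkZ].
Qed.

Lemma Ck_trunc_dln n f g : Ck n f -> Ck n g ->
  Ck n (fun y => trunc_dln eps (f y ^+ 2 + g y ^+ 2)).
Proof.
move=> Cf Cg; have Ct := Ck_sumsq Cf Cg.
apply: CkM; first exact: Ck_cst.
apply: CkV; first by move=> x; rewrite mulr_gt0 ?denominator_gt0// ltr_wpDl.
apply: CkM; first by apply: CkD => //; exact: Ck_cst.
by apply: CkD; [exact: Ck_cst|exact: CkZ].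
Qed.

Lemma Ck_weight al n f g : Ck n f -> Ck n g -> Ck n (fun y => weight eps al (f y) (g y)).
Proof.
by move=> Cf Cg; apply: Ck_powR; [move=> x; exact: trunc_gt0|exact: Ck_trunc].
Qed.

Lemma is_derive_trunc t : 0 <= t -> is_derive t 1 (trunc eps) ((1 - eps ^+ 2) / (1 + eps * t) ^+ 2).
Proof.
move=> t0; have d0 : 1 + eps * t != 0 by rewrite gt_eqF// ltr_pwDl// mulr_ge0// ltW.
rewrite /trunc; apply: is_derive_eq.
rewrite /GRing.scale /= !(add0r, addr0, mulr1, mulr0, mulr1n).
by field.
Qed.

Lemma dpd_weight al i f g x a b : dpd i f x a -> dpd i g x b ->
  dpd i (fun y => weight eps al (f y) (g y)) x
    (weight eps al (f x) (g x) * (2 * al * trunc_dln eps (f x ^+ 2 + g x ^+ 2))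
       * (f x * a + g x * b)).
Proof.
move=> fa gb.
have ht := dpdD (dpdM fa fa) (dpdM gb gb).
have hb := dpd_comp ht (is_derive_trunc (sumsq_ge0 (f x) (g x))).
have := dpd_powR al (trunc_gt0 e0 e1 (sumsq_ge0 (f x) (g x))) hb.
congr dpd; have T0 := trunc_gt0 e0 e1 (sumsq_ge0 (f x) (g x)).
rewrite -!expr2 /weight powRB; last by rewrite (gt_eqF T0) implybT.
rewrite powRr1; last exact: ltW.
rewrite {2}/trunc /trunc_dln; move: (_ `^ al) => P.
have := denominator_gt0 (f x) (g x); have : 0 < f x ^+ 2 + g x ^+ 2 + eps by rewrite ltr_wpDl.
move: (f x) (g x) => c d /lt0r_neq0 H1 /lt0r_neq0 H2.
by field; rewrite H1 H2.
Qed.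

Lemma weight_gt0 al a b : 0 < weight eps al a b.
Proof. by rewrite powR_gt0// trunc_gt0. Qed.

Lemma weight_le al a b : 0 <= al -> weight eps al a b <= eps^-1 `^ al.
Proof.
move=> al0; rewrite ge0_ler_powR//; [| |exact: trunc_le].
all: by rewrite nnegrE ltW// ?trunc_gt0// invr_gt0.
Qed.

Definition cut al a b : R := weight eps al a b * a.
(** [cut0] and [cut1] are the partial derivatives of [cut], in the form that the chain rule takes as
    data. *)
Definition cut0 al a b : R :=
  weight eps al a b * (1 + 2 * al * trunc_dln eps (a ^+ 2 + b ^+ 2) * a ^+ 2).
Definition cut1 al a b : R :=
  weight eps al a b * (2 * al * trunc_dln eps (a ^+ 2 + b ^+ 2) * (a * b)).

Lemma Ck_cut al n f g : Ck n f -> Ck n g -> Ck n (fun y => cut al (f y) (g y)).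
Proof. by move=> Cf Cg; apply: CkM => //; exact: Ck_weight. Qed.

Lemma dpd_cut al i f g x a b : dpd i f x a -> dpd i g x b ->
  dpd i (fun y => cut al (f y) (g y)) x (cut0 al (f x) (g x) * a + cut1 al (f x) (g x) * b).
Proof.
move=> fa gb; have := dpdM (dpd_weight al fa gb) fa; congr dpd.
by rewrite /cut0 /cut1; ring.
Qed.

Lemma continuous2_cut al : continuous2 (cut al).
Proof. exact: (Ck_continuous (Ck_cut al (Ck_fst 0) (Ck_snd 0))). Qed.

Lemma continuous2_weight al : continuous2 (weight eps al).
Proof. exact: (Ck_continuous (Ck_weight al (Ck_fst 0) (Ck_snd 0))). Qed.

Lemma continuous2_trunc_dln : continuous2 (fun a b => trunc_dln eps (a ^+ 2 + b ^+ 2)).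
Proof. exact: (Ck_continuous (Ck_trunc_dln (Ck_fst 0) (Ck_snd 0))). Qed.

Lemma continuous2_cut0 al : continuous2 (cut0 al).
Proof.
apply: (@Ck_continuous _ 0); apply: CkM; first exact: Ck_weight (Ck_fst 0) (Ck_snd 0).
apply: CkD; first exact: Ck_cst.
apply: CkM; last by apply: CkM; exact: Ck_fst.
by apply: CkM; [exact: Ck_cst|exact: Ck_trunc_dln (Ck_fst 0) (Ck_snd 0)].
Qed.

Lemma continuous2_cut1 al : continuous2 (cut1 al).
Proof.
apply: (@Ck_continuous _ 0); apply: CkM; first exact: Ck_weight (Ck_fst 0) (Ck_snd 0).
apply: CkM; last by apply: CkM; [exact: Ck_fst|exact: Ck_snd].
by apply: CkM; [exact: Ck_cst|exact: Ck_trunc_dln (Ck_fst 0) (Ck_snd 0)].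
Qed.

(** The partial derivatives are bounded although they contain products such as $a^2$ and $ab$: these
    are at most $a^2 + b^2$ in absolute value, and the logarithmic derivative times $a^2 + b^2$ is
    at most 1. *)
Lemma approximable_cut al Omega u v (gu gv : 'I_2 -> R * R -> R) : 0 <= al ->
  open Omega -> approximable Omega u gu -> approximable Omega v gv ->
  approximable Omega (fun x => cut al (u x) (v x))
    (fun i x => cut0 al (u x) (v x) * gu i x + cut1 al (u x) (v x) * gv i x).
Proof.
move=> al0 oO Au Av.
pose M := eps^-1 `^ al; have M0 : 0 <= M by exact: powR_ge0.
pose L := M * (1 + 2 * al).
have ML : M <= L by rewrite /L ler_peMr//; lra.
have W a b : `|weight eps al a b| <= M.
  by rewrite ger0_norm; [exact: weight_le|exact: ltW (weight_gt0 _ _ _)].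
have S a b c : 0 <= c -> c <= a ^+ 2 + b ^+ 2 -> 0 <= trunc_dln eps (a ^+ 2 + b ^+ 2) * c <= 1.
  move=> c0 cab; have s0 := trunc_dln_ge0 e0 e1 (sumsq_ge0 a b).
  rewrite mulr_ge0//=; apply: le_trans (trunc_dln_le e0 e1 (sumsq_ge0 a b)).
  by rewrite ler_wpM2l.
apply: (@approximable_comp _ Omega (cut al) (cut0 al) (cut1 al) L) => //.
- move=> phi psi Cphi Cpsi; split.
    apply: (Cc_infty_comp2 Cphi Cpsi); first by rewrite /cut mulr0.
    by move=> n; apply: Ck_cut; [exact: Cc_infty_Ck Cphi|exact: Cc_infty_Ck Cpsi].
  by move=> i x; apply: dpdE; apply: dpd_cut; [exact: Cc_infty_dpd Cphi|exact: Cc_infty_dpd Cpsi].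
- exact: continuous2_cut.
- exact: continuous2_cut0.
- exact: continuous2_cut1.
- move=> a b; rewrite /cut exprMn.
  have : weight eps al a b ^+ 2 <= L ^+ 2.
    by rewrite ler_sqr ?nnegrE ?(ltW (weight_gt0 _ _ _))//; [exact: le_trans (weight_le _ _ al0) ML|exact: le_trans ML].
  have := sqr_ge0 a; have := sqr_ge0 b; have := sqr_ge0 L; move: (weight _ _ _ _ ^+ 2) (L ^+ 2) (a ^+ 2) (b ^+ 2).
  by clear => w l c d l0 d0 c0 wl; nra.
- move=> a b; rewrite /cut0 normrM; apply: ler_pM => //.
  have := S a b (a ^+ 2) (sqr_ge0 a); rewrite lerDl => /(_ (sqr_ge0 b)).
  rewrite -(mulrA (2 * al)); move: (trunc_dln _ _ * _) => c /andP[c0 c1].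
  by rewrite ger0_norm; [rewrite lerD2l ler_piMr|rewrite addr_ge0]; rewrite ?mulr_ge0.
- move=> a b; rewrite /cut1 normrM; apply: ler_pM => //.
  have ab2 : `|a * b| <= a ^+ 2 + b ^+ 2.
    rewrite ler_norml; have := sqr_ge0 (a - b); have := sqr_ge0 (a + b).
    by have := sqr_ge0 a; have := sqr_ge0 b; clear; move=> *; apply/andP; split; nra.
  have H := S a b _ (normr_ge0 _) ab2.
  have s0 := trunc_dln_ge0 e0 e1 (sumsq_ge0 a b).
  have al20 : 0 <= 2 * al by lra.
  rewrite -(mulrA (2 * al)) normrM (ger0_norm al20) normrM (ger0_norm s0); move: H.
  move: (trunc_dln _ _ * _) => c /andP[c0 c1].
  apply: (@le_trans _ _ (2 * al)); last lra.
  by rewrite ler_piMr//; lra.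
Qed.

End Smooth.
End Truncation.

(** * Energy estimate *)

Section Energy.
Context {R : realType}.
Implicit Types (f g h phi psi : R * R -> R) (x : R * R) (i j k : 'I_2).
Implicit Types (Omega : set (R * R)) (eps al t : R) (u : 'I_2 -> R * R -> R).
Implicit Types (G : 'I_2 -> 'I_2 -> R * R -> R).
Local Notation TT := (measurableTypeR R * measurableTypeR R)%type.

Definition vweight eps al u x : R := weight eps al (u ord0 x) (u ord_max x).
Definition vdln eps u x : R := trunc_dln eps (u ord0 x ^+ 2 + u ord_max x ^+ 2).
(** Half of the $k$-th derivative of $|u|^2$ when [G] is the gradient of [u]. *)
Definition radial G u k x : R := G k ord0 x * u ord0 x + G k ord_max x * u ord_max x.
Definition weighted eps al u j x : R := vweight eps al u x * u j x.
(** The gradient of [weighted] as the chain rule gives it; the weight is factored out because all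
    the quadratic quantities below are homogeneous in it. *)
Definition weighted_grad eps al u G k j x : R :=
  vweight eps al u x * (G k j x + 2 * al * vdln eps u x * radial G u k x * u j x).

Lemma vweight_gt0 eps al u x : 0 < eps -> eps < 1 -> 0 < vweight eps al u x.
Proof. by move=> e0 e1; exact: weight_gt0. Qed.

Lemma vweight_sqr eps al u x : vweight eps (al / 2) u x ^+ 2 = vweight eps al u x.
Proof.
by rewrite /vweight /weight -powR_mulrn ?powR_ge0// -powRrM -mulrA mulVf ?mulr1// pnatr_eq0.
Qed.

Lemma approximable_weighted eps al Omega u G : 0 < eps -> eps < 1 -> 0 <= al -> open Omega ->
  (forall j, approximable Omega (u j) (fun k => G k j)) ->
  forall j, approximable Omega (weighted eps al u j) (fun k => weighted_grad eps al u G k j).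
Proof.
move=> e0 e1 al0 oO Au j.
have key a b : (forall x, weight eps al (u a x) (u b x) = vweight eps al u x) ->
    (forall x, u a x ^+ 2 + u b x ^+ 2 = u ord0 x ^+ 2 + u ord_max x ^+ 2) ->
    (forall k x, G k a x * u a x + G k b x * u b x = radial G u k x) ->
    approximable Omega (weighted eps al u a) (fun k => weighted_grad eps al u G k a).
  move=> E1 E2 E3; have := approximable_cut e0 e1 al0 oO (Au a) (Au b).
  rewrite /cut /weighted; under eq_fun do rewrite E1.
  congr approximable; apply/funext => k; apply/funext => x.
  by rewrite /cut0 /cut1 /weighted_grad E1 E2 -E3 /vdln; ring.
elim/ord2P: j; apply: key => // [x|x|k x].
- by rewrite /vweight /weight addrC.
- by rewrite addrC.
- by rewrite addrC.
Qed.

Lemma measurable_vweight eps al Omega u : 0 < eps -> eps < 1 -> open Omega ->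
  (forall j, measurable_fun Omega (u j)) -> measurable_fun Omega (vweight eps al u).
Proof.
move=> e0 e1 oO mu; apply: (continuous2_measurable (F := weight eps al)).
- exact: open_measurable_plane.
- exact: continuous2_weight.
- exact: mu.
- exact: mu.
Qed.

Lemma measurable_weighted_grad eps al Omega u G : 0 < eps -> eps < 1 -> open Omega ->
  (forall j, measurable_fun Omega (u j)) -> (forall k j, measurable_fun Omega (G k j)) ->
  forall k j, measurable_fun Omega (weighted_grad eps al u G k j).
Proof.
move=> e0 e1 oO mu mG k j.
have mO := open_measurable_plane oO.
have md : measurable_fun Omega (vdln eps u).
  apply: (continuous2_measurable (F := fun a b => trunc_dln eps (a ^+ 2 + b ^+ 2)) mO).
  - exact: continuous2_trunc_dln.
  - exact: mu.
  - exact: mu.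
have mM f g : measurable_fun Omega f -> measurable_fun Omega g ->
  measurable_fun Omega (fun x => f x * g x) by exact: measurable_funM.
have mD f g : measurable_fun Omega f -> measurable_fun Omega g ->
  measurable_fun Omega (fun x => f x + g x) by exact: measurable_funD.
apply: (mM); first exact: measurable_vweight.
apply: (mD); first exact: mG.
apply: (mM); last exact: mu.
apply: (mM); first by apply: (mM) => //; exact: measurable_cst.
by apply: (mD); apply: (mM); [exact: mG|exact: mu|exact: mG|exact: mu].
Qed.

Lemma measurable_weighted eps al Omega u : 0 < eps -> eps < 1 -> open Omega ->
  (forall j, measurable_fun Omega (u j)) -> forall j, measurable_fun Omega (weighted eps al u j).
Proof.
by move=> e0 e1 oO mu j; apply: measurable_funM; [exact: measurable_vweight|exact: mu].
Qed.

Lemma lame_sum (la mu : R * R -> R) (g q : 'I_2 -> 'I_2 -> R) x :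
  \sum_(h < 2) \sum_(k < 2) \sum_(i < 2) \sum_(j < 2)
     lame_coef la mu h k i j x * g k j * q h i =
  la x * ((g ord0 ord0 + g ord_max ord_max) * (q ord0 ord0 + q ord_max ord_max)) +
  mu x * ((g ord0 ord0 * q ord0 ord0 + g ord0 ord_max * q ord0 ord_max +
           g ord_max ord0 * q ord_max ord0 + g ord_max ord_max * q ord_max ord_max) +
          (g ord0 ord0 * q ord0 ord0 + g ord0 ord_max * q ord_max ord0 +
           g ord_max ord0 * q ord0 ord_max + g ord_max ord_max * q ord_max ord_max)).
Proof.
rewrite !sum_ord2 /lame_coef /=; ring.
Qed.

(** The difference coincides almost everywhere with its absolute value, whose integral is
    nonnegative. *)
Lemma ae_le_Rintegral (D : set TT) (f g : TT -> R) : measurable D ->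
  leb2.-integrable D (EFin \o f) -> leb2.-integrable D (EFin \o g) ->
  {ae leb2, forall x, D x -> f x <= g x} ->
  \int[leb2]_(x in D) f x <= \int[leb2]_(x in D) g x.
Proof.
move=> mD fi gi fg.
have hi : leb2.-integrable D (EFin \o (fun x => g x - f x)).
  by have := integrableB mD gi fi; apply: eq_integrable.
rewrite -subr_ge0 -RintegralB//.
have -> : \int[leb2]_(x in D) (g x - f x) = \int[leb2]_(x in D) `|g x - f x|.
  rewrite /Rintegral; congr fine; apply: ae_eq_integral => //.
  - exact: measurable_int hi.
  - by have /measurable_int := integrable_abse hi.
  - by apply: ae_mono fg => x /[apply] H; rewrite ger0_norm// subr_ge0.
by apply: Rintegral_ge0.
Qed.

Lemma integrable_coef_prod Omega (a f g : R * R -> R) (M : R) : open Omega ->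
  measurable_fun Omega a -> measurable_fun Omega f -> measurable_fun Omega g ->
  {ae leb2, forall x, Omega x -> `|a x| <= M} ->
  leb2.-integrable Omega (EFin \o (fun x => f x ^+ 2)) ->
  leb2.-integrable Omega (EFin \o (fun x => g x ^+ 2)) ->
  leb2.-integrable Omega (EFin \o (fun x => a x * f x * g x)).
Proof.
move=> oO ma mf mg aM f2 g2.
have mO := open_measurable_plane oO.
have iD : leb2.-integrable Omega (EFin \o (fun x => M * (f x ^+ 2 + g x ^+ 2))).
  have := integrableZl mO M (integrableD mO f2 g2); apply: eq_integrable => //.
apply: (integrable_dominated mO _ iD).
  by apply: measurable_funM; [apply: measurable_funM; [exact: ma|exact: mf]|exact: mg].
apply: ae_mono aM => x /[apply] H; rewrite -mulrA normrM; apply: ler_pM => //.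
rewrite ler_norml; move: (f x) (g x) => a1 b1.
have := sqr_ge0 (a1 - b1); have := sqr_ge0 (a1 + b1).
by have := sqr_ge0 a1; have := sqr_ge0 b1; clear; move=> *; apply/andP; split; nra.
Qed.

Lemma integrable_sumR Omega (f_ : 'I_2 -> R * R -> R) : open Omega ->
  (forall i, leb2.-integrable Omega (EFin \o f_ i)) ->
  leb2.-integrable Omega (EFin \o (fun x => \sum_(i < 2) f_ i x)).
Proof.
move=> oO fi; have mO := open_measurable_plane oO.
have := integrableD mO (fi ord0) (fi ord_max); apply: eq_integrable => //.
by move=> x _ /=; rewrite sum_ord2 EFinD.
Qed.

End Energy.

(** * Pointwise energy inequalities *)

Section EnergyEstimate.
Context {R : realType}.
Implicit Types (f g h phi psi : R * R -> R) (x : R * R) (i j k : 'I_2).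
Implicit Types (Omega : set (R * R)) (eps al t : R) (u : 'I_2 -> R * R -> R).
Implicit Types (G F : 'I_2 -> 'I_2 -> R * R -> R).
Local Notation TT := (measurableTypeR R * measurableTypeR R)%type.

(** The difference is $2\beta z^2 + \beta^2z^2|u|^2$. This makes $\Theta|\nabla u|^2$ at most
    $|\nabla w|^2$. *)
Lemma row_norm_le (beta g0 g1 u0 u1 : R) : 0 <= beta ->
  let z := g0 * u0 + g1 * u1 in
  g0 ^+ 2 + g1 ^+ 2 <= (g0 + beta * z * u0) ^+ 2 + (g1 + beta * z * u1) ^+ 2.
Proof.
move=> b0 /=; set z := g0 * u0 + g1 * u1; rewrite -subr_ge0.
have -> : (g0 + beta * z * u0) ^+ 2 + (g1 + beta * z * u1) ^+ 2 - (g0 ^+ 2 + g1 ^+ 2) =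
  2 * (beta * z ^+ 2) + (beta * z) ^+ 2 * (u0 ^+ 2 + u1 ^+ 2) by rewrite /z; ring.
have := mulr_ge0 b0 (sqr_ge0 z).
by have := mulr_ge0 (sqr_ge0 (beta * z)) (addr_ge0 (sqr_ge0 u0) (sqr_ge0 u1)); lra.
Qed.

(** It compares the gradient of the test function $\Theta u$ with that of $w$. With the factor 4 the
    terms quadratic in [beta] cancel, and $3|g|^2 + 4\beta z^2$ remains. *)
Lemma row_norm_double_le (beta g0 g1 u0 u1 : R) : 0 <= beta ->
  let z := g0 * u0 + g1 * u1 in
  (g0 + 2 * beta * z * u0) ^+ 2 + (g1 + 2 * beta * z * u1) ^+ 2 <=
  4 * ((g0 + beta * z * u0) ^+ 2 + (g1 + beta * z * u1) ^+ 2).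
Proof.
move=> b0 /=; set z := g0 * u0 + g1 * u1; rewrite -subr_ge0.
have -> : 4 * ((g0 + beta * z * u0) ^+ 2 + (g1 + beta * z * u1) ^+ 2) -
  ((g0 + 2 * beta * z * u0) ^+ 2 + (g1 + 2 * beta * z * u1) ^+ 2) =
  3 * (g0 ^+ 2 + g1 ^+ 2) + 4 * (beta * z ^+ 2) by rewrite /z; ring.
have := mulr_ge0 b0 (sqr_ge0 z).
by have := sqr_ge0 g0; have := sqr_ge0 g1; lra.
Qed.

(** The weight $k/16$ becomes $k/4$ after the factor 4 of [row_norm_double_le]. *)
Lemma mul_le_weighted_sqr (k a b : R) : 0 < k -> a * b <= 4 / k * a ^+ 2 + k / 16 * b ^+ 2.
Proof.
move=> k0; have k0' : k != 0 by rewrite gt_eqF.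
rewrite -subr_ge0.
have -> : 4 / k * a ^+ 2 + k / 16 * b ^+ 2 - a * b = (8 * a - k * b) ^+ 2 / (16 * k) by field.
by rewrite divr_ge0 ?sqr_ge0// mulr_ge0// ltW.
Qed.

Definition fnorm2 F x : R := \sum_(i < 2) \sum_(j < 2) F i j x ^+ 2.

Section Pointwise.
Variables (eps : R) (e0 : 0 < eps) (e1 : eps < 1) (q : R) (q0 : 0 <= q).

Let beta_ge0 u x : 0 <= q * vdln eps u x.
Proof. by rewrite mulr_ge0// trunc_dln_ge0// addr_ge0 ?sqr_ge0. Qed.

Lemma half_weighted_gradE u G k j x : weighted_grad eps (q / 2) u G k j x =
  vweight eps (q / 2) u x * (G k j x + q * vdln eps u x * radial G u k x * u j x).
Proof. by rewrite /weighted_grad; congr (_ * (_ + _)); field. Qed.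

Lemma weighted_gradE u G k j x : weighted_grad eps q u G k j x =
  vweight eps (q / 2) u x ^+ 2 * (G k j x + 2 * (q * vdln eps u x) * radial G u k x * u j x).
Proof. by rewrite /weighted_grad vweight_sqr; congr (_ * (_ + _)); ring. Qed.

Lemma mnorm2_weighted_ge u G x :
  vweight eps q u x * mnorm2 G x <= mnorm2 (weighted_grad eps (q / 2) u G) x.
Proof.
rewrite /mnorm2 !half_weighted_gradE -(vweight_sqr eps q).
have B := beta_ge0 u x.
have := row_norm_le (G ord0 ord0 x) (G ord0 ord_max x) (u ord0 x) (u ord_max x) B.
have := row_norm_le (G ord_max ord0 x) (G ord_max ord_max x) (u ord0 x) (u ord_max x) B.
rewrite /radial /=; move: (q * _) (vweight _ _ _ _) (G _ _ _) (G _ _ _) (G _ _ _) (G _ _ _) (u _ _) (u _ _).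
clear => be w g11 g10 g01 g00 u0 u1.
move: (g11 + _) (g10 + _) (g01 + _) (g00 + _) => a b c d H1 H2.
rewrite !exprMn -!mulrDr ler_wpM2l ?sqr_ge0//; lra.
Qed.

Lemma source_le F u G (k : R) x : 0 < k ->
  \sum_(i < 2) \sum_(j < 2) F i j x * weighted_grad eps q u G i j x <=
  k / 4 * mnorm2 (weighted_grad eps (q / 2) u G) x + 4 / k * (vweight eps q u x * fnorm2 F x).
Proof.
move=> k0; rewrite /mnorm2 /fnorm2 !sum_ord2 !half_weighted_gradE !weighted_gradE -(vweight_sqr eps q).
have B := beta_ge0 u x.
have := row_norm_double_le (G ord0 ord0 x) (G ord0 ord_max x) (u ord0 x) (u ord_max x) B.
have := row_norm_double_le (G ord_max ord0 x) (G ord_max ord_max x) (u ord0 x) (u ord_max x) B.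
rewrite /radial /=; move: (q * _) (vweight _ _ _ _) => be w.
move: (G ord0 ord0 x) (G ord0 ord_max x) (G ord_max ord0 x) (G ord_max ord_max x) (u ord0 x) (u ord_max x).
move: (F ord0 ord0 x) (F ord0 ord_max x) (F ord_max ord0 x) (F ord_max ord_max x).
clear -k0 => f00 f01 f10 f11 g00 g01 g10 g11 u0 u1.
move: (g00 + 2 * _ * _ * _) (g01 + 2 * _ * _ * _) (g10 + 2 * _ * _ * _) (g11 + 2 * _ * _ * _).
move: (g00 + _) (g01 + _) (g10 + _) (g11 + _) => p00 p01 p10 p11 q00 q01 q10 q11 H1 H2.
have y0 := mul_le_weighted_sqr f00 q00 k0; have y1 := mul_le_weighted_sqr f01 q01 k0.
have y2 := mul_le_weighted_sqr f10 q10 k0; have y3 := mul_le_weighted_sqr f11 q11 k0.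
have K : k / 16 * (q00 ^+ 2 + q01 ^+ 2 + (q10 ^+ 2 + q11 ^+ 2)) <=
         k / 16 * (4 * (p00 ^+ 2 + p01 ^+ 2 + (p10 ^+ 2 + p11 ^+ 2))).
  by apply: ler_wpM2l; lra.
have H : f00 * q00 + f01 * q01 + (f10 * q10 + f11 * q11) <=
  k / 4 * (p00 ^+ 2 + p10 ^+ 2 + (p01 ^+ 2 + p11 ^+ 2)) +
  4 / k * (f00 ^+ 2 + f01 ^+ 2 + (f10 ^+ 2 + f11 ^+ 2)).
  by move: (4 / k) y0 y1 y2 y3 => c y0 y1 y2 y3; clear H1 H2; lra.
have := ler_wpM2l (sqr_ge0 w) H; move: (4 / k) (k / 4) => c d {}H.
by rewrite (le_trans _ (le_trans H _))// le_eqVlt; apply/orP; left; apply/eqP; ring.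
Qed.

(* [k] stands for the product of kappa and [1 - (1 - 2 / p)^2]. *)
Definition lame_admissible (la mu s delta k : R) :=
  [/\ 0 < mu, 0 < la + 2 * mu,
      ((la + mu) / (la + 3 * mu)) ^+ 2 + s ^+ 2 + delta <= 1,
      k <= delta / 2 * mu & k <= delta / 2 * (la + 2 * mu)].

(** Both sides carry the common factor $\Theta$. Once it is removed, the inequality is
    [lame_lower_bound] with [beta] equal to [q] times the logarithmic derivative of the truncation,
    so that [beta] times $|u|^2$ is at most [q]. *)
Lemma lame_weighted_ge (la mu : R * R -> R) u G (s delta k : R) x :
  0 < delta -> 0 <= s -> s < 1 -> q * (1 - s) <= s ->
  lame_admissible (la x) (mu x) s delta k ->
  k * mnorm2 (weighted_grad eps (q / 2) u G) x
    - 4 * (mu x ^+ 2 / (la x + 3 * mu x) * mdet (weighted_grad eps (q / 2) u G) x) <=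
  \sum_(h < 2) \sum_(k < 2) \sum_(i < 2) \sum_(j < 2)
    lame_coef la mu h k i j x * G k j x * weighted_grad eps q u G h i x.
Proof.
move=> d0 s0 s1 qs [mu0 la0 rsd k1 k2].
rewrite (lame_sum la mu (fun i j => G i j x) (fun i j => weighted_grad eps q u G i j x)).
rewrite /mnorm2 /mdet !half_weighted_gradE !weighted_gradE.
have B := beta_ge0 u x.
have Bs : q * vdln eps u x * (u ord0 x ^+ 2 + u ord_max x ^+ 2) * (1 - s) <= s.
  apply: le_trans qs; apply: ler_wpM2r; first by rewrite subr_ge0 ltW.
  rewrite -mulrA ler_piMr//; apply: trunc_dln_le => //.
  by rewrite addr_ge0 ?sqr_ge0.
have := lame_lower_bound (G ord0 ord0 x) (G ord0 ord_max x) (G ord_max ord0 x) (G ord_max ord_max x)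
  mu0 la0 d0 s0 s1 rsd k1 k2 B Bs.
rewrite /radial /=; move: (q * vdln _ _ _) (vweight _ _ _ _) => be w.
move: (G ord0 ord0 x) (G ord0 ord_max x) (G ord_max ord0 x) (G ord_max ord_max x) (u ord0 x) (u ord_max x).
move: (la x) (mu x) (_ / _).
clear => l m f g00 g01 g10 g11 u0 u1.
move: (g00 + 2 * _ * _ * _) (g01 + 2 * _ * _ * _) (g10 + 2 * _ * _ * _) (g11 + 2 * _ * _ * _).
move: (g00 + _ * _ * _) (g01 + _ * _ * _) (g10 + _ * _ * _) (g11 + _ * _ * _) => p00 p01 p10 p11 q00 q01 q10 q11 H.
have {}H := ler_wpM2l (sqr_ge0 w) H.
rewrite (le_trans _ (le_trans H _))// le_eqVlt; apply/orP; left; apply/eqP; ring.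
Qed.

End Pointwise.
End EnergyEstimate.

(** * The integrated energy estimate *)

Section EnergyIntegral.
Context {R : realType}.
Implicit Types (f g phi psi : R * R -> R) (x : R * R) (h i j : 'I_2).
Implicit Types (Omega : set (R * R)) (eps al t : R) (u : 'I_2 -> R * R -> R).
Implicit Types (G F : 'I_2 -> 'I_2 -> R * R -> R).
Local Notation TT := (measurableTypeR R * measurableTypeR R)%type.

Lemma lame_coef_bound (la mu : R * R -> R) (M : R) h (k : 'I_2) i j x :
  `|la x| <= M -> `|mu x| <= M -> `|lame_coef la mu h k i j x| <= 3 * M.
Proof.
rewrite /lame_coef !ler_norml => /andP[a1 a2] /andP[b1 b2].
case: (i == h); case: (j == k); case: (i == j); case: (h == k); case: (i == k); case: (h == j);
  rewrite /= ?mulr0n ?mulr1n; apply/andP; split; move: a1 a2 b1 b2; clear; lra.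
Qed.

Lemma measurable_lame_coef Omega (la mu : R * R -> R) h (k : 'I_2) i j :
  measurable_fun Omega la -> measurable_fun Omega mu ->
  measurable_fun Omega (lame_coef la mu h k i j).
Proof.
move=> mla mmu.
apply: measurable_funD; last by apply: measurable_funM => //; exact: measurable_cst.
by apply: measurable_funM; [apply: measurable_funM => //|]; exact: measurable_cst.
Qed.

Lemma H10_measurable Omega f : H10 Omega f -> measurable_fun Omega f.
Proof. by move=> [[[]]]. Qed.

Lemma H10_wpd_L2 Omega f i : open Omega -> H10 Omega f ->
  measurable_fun Omega (wpd Omega i f) /\
  leb2.-integrable Omega (EFin \o (fun x => wpd Omega i f x ^+ 2)).
Proof.
move=> oO [[_ H] _]; have [_ [m n]] := H i; split => //.
by apply/(integrable_sqr (open_measurable_plane oO) m); rewrite -L2norm_lty.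
Qed.

Lemma integrable_ae_sqr Omega f g : open Omega -> measurable_fun Omega f ->
  {ae leb2, forall x, Omega x -> g x = f x} ->
  leb2.-integrable Omega (EFin \o (fun x => g x ^+ 2)) ->
  leb2.-integrable Omega (EFin \o (fun x => f x ^+ 2)).
Proof.
move=> oO mf fg ig; apply: (integrable_dominated (open_measurable_plane oO) _ ig).
  exact: measurable_funX.
by apply: ae_mono fg => x /[apply] ->; rewrite ger0_norm ?sqr_ge0.
Qed.

Lemma integrable_sum2 Omega (c : 'I_2 -> 'I_2 -> R * R -> R) : open Omega ->
  (forall i j, leb2.-integrable Omega (EFin \o c i j)) ->
  leb2.-integrable Omega (EFin \o (fun x => \sum_(i < 2) \sum_(j < 2) c i j x)).
Proof.
move=> oO ci; apply: (@integrable_sumR _ Omega (fun i x => \sum_(j < 2) c i j x) oO) => i.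
exact: (@integrable_sumR _ Omega (c i) oO).
Qed.

Lemma ae_ord2 (P : 'I_2 -> TT -> Prop) : (forall i, {ae leb2, forall x, P i x}) ->
  {ae leb2, forall x, forall i, P i x}.
Proof.
move=> aP; apply: ae_mono2 (aP ord0) (aP ord_max) => x H0 H1 i.
by elim/ord2P: i.
Qed.

Lemma fnorm2_ge F i j x : F i j x ^+ 2 <= fnorm2 F x.
Proof.
rewrite /fnorm2 !sum_ord2.
move: i j; do 2 (elim/ord2P); move: (sqr_ge0 (F ord0 ord0 x)) (sqr_ge0 (F ord0 ord_max x))
    (sqr_ge0 (F ord_max ord0 x)) (sqr_ge0 (F ord_max ord_max x)); clear; lra.
Qed.

(** The budget for [k]: one half absorbs the determinant, one quarter the source, and the quarter
    left over yields the constant $(4/k)/(k/4) = 16/k^2$. *)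
Lemma energy_balance (k a b c d : R) : 0 < k -> k * a - 4 * b <= d ->
  d <= k / 4 * a + 4 / k * c -> 4 * `|b| <= k / 2 * a -> a <= 16 / k ^+ 2 * c.
Proof.
move=> k0 H1 H2 H3.
have {}H3 : 4 * b <= k / 2 * a by rewrite (le_trans _ H3)// ler_wpM2l// ler_norm.
have k2 : 0 < k / 4 by rewrite divr_gt0.
rewrite -(ler_pM2l k2).
have -> : k / 4 * (16 / k ^+ 2 * c) = 4 / k * c by field; rewrite gt_eqF.
lra.
Qed.

Section Estimate.
Variables (Omega : set (R * R)) (la mu : R * R -> R) (s delta k q M : R).
Hypotheses (oO : open Omega) (mla : measurable_fun Omega la) (mmu : measurable_fun Omega mu).
Hypotheses (laM : {ae leb2, forall x, Omega x -> `|la x| <= M}).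
Hypotheses (muM : {ae leb2, forall x, Omega x -> `|mu x| <= M}).
Hypotheses (adm : {ae leb2, forall x, Omega x -> lame_admissible (la x) (mu x) s delta k}).
Let f x := mu x ^+ 2 / (la x + 3 * mu x).
Hypotheses (mf : measurable_fun Omega f).
Hypotheses (fM : {ae leb2, forall x, Omega x -> `|f x| <= M}).
Hypotheses (d0 : 0 < delta) (s0 : 0 <= s) (s1 : s < 1) (q0 : 0 <= q) (qs : q * (1 - s) <= s) (k0 : 0 < k).
Hypotheses (det : forall (v : 'I_2 -> R * R -> R) G,
  (forall i j, measurable_fun Omega (G i j)) ->
  (forall j, approximable Omega (v j) (fun i => G i j)) ->
  4 * `|\int[leb2]_(x in Omega) (f x * mdet G x)| <= k / 2 * \int[leb2]_(x in Omega) mnorm2 G x).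

(** The constant depends on [k] alone, so the estimate is uniform in [eps]. Integrability is part of
    the conclusion because a real-valued integral takes a default value when the integral is
    infinite, and an upper bound for it would then say nothing. *)
Lemma energy_estimate eps F u : 0 < eps -> eps < 1 ->
  (forall i j, measurable_fun Omega (F i j)) ->
  leb2.-integrable Omega (EFin \o fnorm2 F) ->
  dirichlet_solution Omega la mu F u ->
  leb2.-integrable Omega (EFin \o mnorm2 (weighted_grad eps (q / 2) u (wgrad Omega u))) /\
  \int[leb2]_(x in Omega) mnorm2 (weighted_grad eps (q / 2) u (wgrad Omega u)) x <=
  16 / k ^+ 2 * \int[leb2]_(x in Omega) (vweight eps q u x * fnorm2 F x).
Proof.
move=> e0 e1 mF iF [Hu eq]; have mO := open_measurable_plane oO.
have q20 : 0 <= q / 2 by rewrite divr_ge0.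
set G := wgrad Omega u.
have mu_ j : measurable_fun Omega (u j) by exact: H10_measurable.
have mG i j : measurable_fun Omega (G i j) by exact: (H10_wpd_L2 i oO (Hu j)).1.
have iG i j : leb2.-integrable Omega (EFin \o (fun x => G i j x ^+ 2)).
  exact: (H10_wpd_L2 i oO (Hu j)).2.
have Au j : approximable Omega (u j) (fun i => G i j) by exact: H10_approximable.
(* Used with the exponent [q] for the test function and with [q / 2] for $w$. *)
have W al : 0 <= al -> forall j, H10 Omega (weighted eps al u j) /\
    forall i, {ae leb2, forall x, Omega x -> wpd Omega i (weighted eps al u j) x = weighted_grad eps al u G i j x}.
  move=> al0 j; apply: approximable_H10 => //.
  - exact: measurable_weighted.
  - by move=> i; exact: measurable_weighted_grad.
  - exact: approximable_weighted.
pose P := weighted_grad eps (q / 2) u G.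
have mP i j : measurable_fun Omega (P i j) by exact: measurable_weighted_grad.
have iP i j : leb2.-integrable Omega (EFin \o (fun x => P i j x ^+ 2)).
  have [Hw E] := W _ q20 j.
  exact: integrable_ae_sqr (mP i j) (E i) (H10_wpd_L2 i oO Hw).2.
have iPP : leb2.-integrable Omega (EFin \o mnorm2 P).
  have := integrableD mO (integrableD mO (iP ord0 ord0) (iP ord_max ord0))
    (integrableD mO (iP ord0 ord_max) (iP ord_max ord_max)).
  by apply: eq_integrable.
split; first exact: iPP.
have idet : leb2.-integrable Omega (EFin \o (fun x => f x * mdet P x)).
  have h a b := integrable_coef_prod oO mf (mP a.1 a.2) (mP b.1 b.2) fM (iP a.1 a.2) (iP b.1 b.2).
  have := integrableB mO (h (ord0, ord0) (ord_max, ord_max)) (h (ord0, ord_max) (ord_max, ord0)).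
  by apply: eq_integrable => // x _ /=; rewrite -EFinB /mdet mulrBr !mulrA.
pose v j := weighted eps q u j.
have Hv j : H10 Omega (v j) by exact: (W _ q0 j).1.
have Ev i j : {ae leb2, forall x, Omega x -> wpd Omega i (v j) x = weighted_grad eps q u G i j x}.
  exact: (W _ q0 j).2.
have mdv i j : measurable_fun Omega (wpd Omega i (v j)) by exact: (H10_wpd_L2 i oO (Hv j)).1.
have idv i j : leb2.-integrable Omega (EFin \o (fun x => wpd Omega i (v j) x ^+ 2)).
  exact: (H10_wpd_L2 i oO (Hv j)).2.
have := eq v Hv; set I1 := Rintegral _ _ _; set I2 := Rintegral _ _ _ => I12.
have iFi i j : leb2.-integrable Omega (EFin \o (fun x => F i j x ^+ 2)).
  apply: (integrable_dominated (D := fnorm2 F) mO _ iF); first exact: measurable_funX (mF i j).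
  by apply: aeW => x _; rewrite ger0_norm ?sqr_ge0//; exact: fnorm2_ge.
have m1 : measurable_fun Omega (fun=> 1 : R) by exact: measurable_cst.
have b1 : {ae leb2, forall x, Omega x -> `|1 : R| <= 1} by apply: aeW => x _; rewrite normr1.
have iI2 : leb2.-integrable Omega (EFin \o (fun x => \sum_(i < 2) \sum_(j < 2) F i j x * wpd Omega i (v j) x)).
  apply: (integrable_sum2 (c := fun i j x => F i j x * wpd Omega i (v j) x) oO) => i j.
  have := integrable_coef_prod oO m1 (mF i j) (mdv i j) b1 (iFi i j) (idv i j).
  by apply: eq_integrable => // x _ /=; rewrite mul1r.
have iI1 : leb2.-integrable Omega (EFin \o (fun x => \sum_(h < 2) \sum_(k < 2) \sum_(i < 2) \sum_(j < 2)
        lame_coef la mu h k i j x * wpd Omega k (u j) x * wpd Omega h (v i) x)).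
  pose c h l i j x := lame_coef la mu h l i j x * wpd Omega l (u j) x * wpd Omega h (v i) x.
  apply: (integrable_sum2 (c := fun h l x => \sum_(i < 2) \sum_(j < 2) c h l i j x) oO) => h l.
  apply: (integrable_sum2 (c := c h l) oO) => i j.
  have mc := measurable_lame_coef h l i j mla mmu.
  have bc : {ae leb2, forall x, Omega x -> `|lame_coef la mu h l i j x| <= 3 * M}.
    by apply: ae_mono2 laM muM => x H1 H2 Ox; apply: lame_coef_bound; [exact: H1|exact: H2].
  exact: (integrable_coef_prod oO mc (mG l j) (mdv h i) bc (iG l j) (idv h i)).
have mW : measurable_fun Omega (vweight eps q u) by exact: measurable_vweight.
have mFF : measurable_fun Omega (fnorm2 F) by have /measurable_int/measurable_EFinP := iF.
have fF0 x : 0 <= fnorm2 F x by rewrite sumr_ge0// => i _; rewrite sumr_ge0// => j _; exact: sqr_ge0.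
have iWF : leb2.-integrable Omega (EFin \o (fun x => vweight eps q u x * fnorm2 F x)).
  apply: (integrable_dominated (D := fun x => eps^-1 `^ q * fnorm2 F x) mO).
  - exact: measurable_funM.
  - have := integrableZl mO (eps^-1 `^ q) iF; exact: eq_integrable.
  - apply: aeW => x _; rewrite normrM (ger0_norm (fF0 x)) ger0_norm; last exact/ltW/vweight_gt0.
    by apply: ler_wpM2r => //; exact: weight_le.
have aeEv : {ae leb2, forall x, Omega x -> forall i j, wpd Omega i (v j) x = weighted_grad eps q u G i j x}.
  have E1 i := ae_ord2 (Ev i); apply: ae_mono (ae_ord2 E1) => x H Ox i j.
  exact: H i j Ox.
have L : k * (\int[leb2]_(x in Omega) mnorm2 P x) - 4 * (\int[leb2]_(x in Omega) (f x * mdet P x)) <= I1.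
  have i1 : leb2.-integrable Omega (EFin \o (fun x => k * mnorm2 P x)).
    by have := integrableZl mO k iPP; exact: eq_integrable.
  have i2 : leb2.-integrable Omega (EFin \o (fun x => 4 * (f x * mdet P x))).
    by have := integrableZl mO 4 idet; exact: eq_integrable.
  rewrite -RintegralZl// -RintegralZl// -RintegralB//.
  - apply: ae_le_Rintegral => //.
    + by have := integrableB mO i1 i2; exact: eq_integrable.
    + apply: ae_mono2 adm aeEv => x H1 H2 Ox.
      have := lame_weighted_ge e0 e1 q0 u G d0 s0 s1 qs (H1 Ox).
      congr (_ <= _); apply: eq_bigr => h _; apply: eq_bigr => l _; apply: eq_bigr => i _.
      by apply: eq_bigr => j _; rewrite H2.
have U : I2 <= k / 4 * (\int[leb2]_(x in Omega) mnorm2 P x) +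
    4 / k * (\int[leb2]_(x in Omega) (vweight eps q u x * fnorm2 F x)).
  have i1 : leb2.-integrable Omega (EFin \o (fun x => k / 4 * mnorm2 P x)).
    by have := integrableZl mO (k / 4) iPP; exact: eq_integrable.
  have i2 : leb2.-integrable Omega (EFin \o (fun x => 4 / k * (vweight eps q u x * fnorm2 F x))).
    by have := integrableZl mO (4 / k) iWF; exact: eq_integrable.
  rewrite -RintegralZl// -RintegralZl// -RintegralD//.
  - apply: ae_le_Rintegral => //.
    + by have := integrableD mO i1 i2; exact: eq_integrable.
    + apply: ae_mono aeEv => x H2 Ox.
      have := source_le e0 e1 q0 F u G x k0.
      congr (_ <= _); apply: eq_bigr => i _; apply: eq_bigr => j _.
      by rewrite H2.
have D := det mP (approximable_weighted e0 e1 q20 oO Au).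
(* The inner term is [I1 <= I2], read off from the equality [I12] given by the weak equation. *)
exact: (energy_balance k0 (le_trans L (eq_rect _ (fun y => I1 <= y) (lexx I1) _ I12)) U D).
Qed.
End Estimate.
End EnergyIntegral.

(** * Almost everywhere bounds for the coefficients *)

Section Coefficients.
Context {R : realType}.
Implicit Types (f g : R * R -> R) (x : R * R) (Omega : set (R * R)).
Local Notation TT := (measurableTypeR R * measurableTypeR R)%type.

Lemma ess_inf_on_le Omega f :
  {ae leb2, forall x, Omega x -> (ess_inf_on Omega f <= (f x)%:E)%E}.
Proof.
apply: ae_mono (@ess_inf_le _ _ R leb2 (patch (fun=> +oo%E) Omega (EFin \o f))) => x + Ox.
by rewrite {2}/patch mem_set.
Qed.

Lemma ess_sup_on_ge Omega f :
  {ae leb2, forall x, Omega x -> ((f x)%:E <= ess_sup_on Omega f)%E}.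
Proof.
apply: ae_mono (@ess_sup_ge _ _ R leb2 (patch (fun=> -oo%E) Omega (EFin \o f))) => x + Ox.
by rewrite {1}/patch mem_set.
Qed.

Lemma Linfty_bounded Omega f : Linfty Omega f ->
  exists M, {ae leb2, forall x, Omega x -> `|f x| <= M}.
Proof.
move=> [_]; rewrite unlock /=; case: ifPn => [_ fo|].
  exists (fine (ess_sup leb2 (abse \o (EFin \o f \_ Omega)))).
  apply: ae_mono (@ess_sup_ge _ _ R leb2 (abse \o (EFin \o f \_ Omega))) => x + Ox.
  move: fo; rewrite /= patchE mem_set//; case: (ess_sup _ _) => [r|//|//] _.
  by rewrite lee_fin.
(* The norm is defined by cases on whether the whole space has positive measure. In the other case
   every property holds almost everywhere. *)
rewrite -leNgt => m0; exists 0.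
have {}m0 : leb2 [set: TT] = 0%E by apply/eqP; rewrite eq_le m0 measure_ge0.
by exists setT; split => //; exact: measurableT.
Qed.

(** Writing $1/f$ as $f \cdot (f^2)^{-1}$ reduces the claim to powers of a nonnegative function. The
    identity persists at the zeros of [f], where the inverse is 0 by convention. *)
Lemma measurable_fun_inverse (D : set TT) (f : TT -> R) : measurable_fun D f ->
  measurable_fun D (fun x => (f x)^-1).
Proof.
move=> mf; have -> : (fun x => (f x)^-1) = (fun x => f x * (f x ^+ 2) `^ (-1)).
  apply/funext => x; rewrite powR_inv1 ?sqr_ge0//.
  have [->|f0] := eqVneq (f x) 0; first by rewrite invr0 mul0r.
  by field.
apply: measurable_funM => //; apply: (measurableT_comp (measurable_powR (R:=R) (-1))).
exact: measurable_funX.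
Qed.

Lemma bounded_loc_integrable Omega f (M : R) : open Omega -> measurable_fun Omega f ->
  {ae leb2, forall x, Omega x -> `|f x| <= M} -> loc_integrable Omega f.
Proof.
move=> oO mf fM; split => // K KO cK; have mK := compact_measurable_plane cK.
apply: (integrable_dominated (D := fun=> M) mK).
- exact: (measurable_funS (open_measurable_plane oO) KO mf).
- apply: measurable_bounded_integrable => //.
    by apply: bounded_leb2_lty => //; exact: compact_bounded.
  by exists `|M|; split; rewrite ?num_real// => t t1 y _ /=; rewrite ltW.
- by apply: ae_mono fM => x H Kx; exact: H (KO _ Kx).
Qed.

Section Lame.
Variables (Omega : set (R * R)) (la mu : R * R -> R) (s delta kappa : R).
Hypotheses (d0 : 0 < delta) (s0 : 0 <= s) (s1 : s < 1).
Hypothesis mu_pos : (0 < ess_inf_on Omega mu)%E.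
Hypothesis la_pos : (0 < ess_inf_on Omega (fun x => la x + 2 * mu x)%R)%E.
Hypothesis delta_lt : (delta%:E <
     1 - ess_sup_on Omega (fun x => (((la x + mu x) / (la x + 3 * mu x)) ^+ 2)%R)
       - (s ^+ 2)%:E)%E.
Hypothesis kappa_lt : (kappa%:E < (delta / (2 * (1 - s ^+ 2)))%:E *
     Order.min (ess_inf_on Omega mu) (ess_inf_on Omega (fun x => (la x + 2 * mu x)%R)))%E.

Let s2 : 0 < 1 - s ^+ 2.
Proof. by rewrite subr_gt0 expr_lt1// ltW. Qed.

Lemma kappa_bound (m : \bar R) (y : R) :
  (Order.min (ess_inf_on Omega mu) (ess_inf_on Omega (fun x => (la x + 2 * mu x)%R)) <= m)%E ->
  (m <= y%:E)%E -> kappa * (1 - s ^+ 2) <= delta / 2 * y.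
Proof.
move=> H1 H2; have c0 : 0 < delta / (2 * (1 - s ^+ 2)) by rewrite divr_gt0// mulr_gt0.
have : (kappa%:E <= (delta / (2 * (1 - s ^+ 2)))%:E * y%:E)%E.
  apply: (le_trans (ltW kappa_lt)); apply: lee_wpmul2l; first by rewrite lee_fin ltW.
  exact: le_trans H1 H2.
rewrite -EFinM lee_fin -(ler_pM2r s2) => /le_trans; apply.
rewrite le_eqVlt; apply/orP; left; apply/eqP.
by field; rewrite gt_eqF.
Qed.

Lemma lame_admissible_ae :
  {ae leb2, forall x, Omega x -> lame_admissible (la x) (mu x) s delta (kappa * (1 - s ^+ 2))}.
Proof.
have H1 := ess_inf_on_le Omega mu.
have H2 := ess_inf_on_le Omega (fun x => la x + 2 * mu x)%R.
have H3 := ess_sup_on_ge Omega (fun x => ((la x + mu x) / (la x + 3 * mu x)) ^+ 2)%R.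
apply: ae_mono2 (ae_mono2 (fun x a b => conj a b) H1 H2) H3 => x [{}H1 {}H2] {}H3 Ox.
move: {H1 H2 H3} (H1 Ox) (H2 Ox) (H3 Ox) => H1 H2 H3.
split.
- by rewrite -lte_fin; exact: lt_le_trans mu_pos H1.
- by rewrite -lte_fin; exact: lt_le_trans la_pos H2.
(* The essential supremum is finite: $-\infty$ is excluded by the pointwise bound, $+\infty$ by the
   choice of [delta]. *)
- move: H3 delta_lt; case: (ess_sup_on _ _) => [S|//|//].
  by rewrite lee_fin -!EFinB lte_fin; lra.
- by apply: kappa_bound H1; rewrite ge_min lexx.
- by apply: kappa_bound H2; rewrite ge_min lexx orbT.
Qed.

Hypotheses (mla : Linfty Omega la) (mmu : Linfty Omega mu).

(** Since $\lambda + 2\mu > 0$, one has $\lambda + 3\mu > \mu > 0$, so that $\mu^2/(\lambda+3\mu)$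
    lies between 0 and $\mu$. *)
Lemma lame_bounds : exists M,
  [/\ {ae leb2, forall x, Omega x -> `|la x| <= M},
      {ae leb2, forall x, Omega x -> `|mu x| <= M} &
      {ae leb2, forall x, Omega x -> `|mu x ^+ 2 / (la x + 3 * mu x)| <= M}].
Proof.
have [M1 H1] := Linfty_bounded mla; have [M2 H2] := Linfty_bounded mmu.
have mM a b c : a <= b -> a <= Num.max b c :> R by move=> ab; rewrite le_max ab.
exists (Num.max M2 M1); split.
- by apply: ae_mono H1 => x H Ox; rewrite le_max (H Ox) orbT.
- by apply: ae_mono H2 => x H Ox; rewrite le_max (H Ox).
- apply: ae_mono2 H2 lame_admissible_ae => x H /[swap] Ox /(_ Ox)[m0 l0 _ _ _].
  apply: mM; apply: le_trans (H Ox); rewrite (gtr0_norm m0).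
  have L0 : 0 < la x + 3 * mu x by lra.
  rewrite ger0_norm; last by rewrite divr_ge0 ?sqr_ge0// ltW.
  by rewrite ler_pdivrMr// expr2 ler_pM2l//; lra.
Qed.

End Lame.
End Coefficients.

(** * Orlicz estimate *)

Section Orlicz.
Context {R : realType}.
Implicit Types (a b c t q sigma theta X eps : R).
Local Notation TT := (measurableTypeR R * measurableTypeR R)%type.

Lemma ln_addE_ge1 a : 0 <= a -> 1 <= ln (a + expR 1).
Proof.
move=> a0; rewrite -{1}(expRK 1) ler_ln ?posrE ?expR_gt0//; first by rewrite lerDr.
by rewrite ltr_wpDl// expR_gt0.
Qed.

Lemma powR_le_add1 y sigma : 0 <= y -> 0 <= sigma -> sigma <= 1 -> y `^ sigma <= 1 + y.
Proof.
move=> y0 s0 s1; have [y1|/ltW y1] := leP 1 y.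
  by apply: (le_trans (ler1_powR y1 s1)); rewrite lerDr.
apply: (@le_trans _ _ (1 `^ sigma)); first by rewrite ge0_ler_powR ?nnegrE.
by rewrite powR1 lerDl.
Qed.

(** If $y$ is at most $2/c$ times the logarithm, the first term alone suffices. Otherwise $a \le
    e^{cy/2}$, and $y^\sigma \le 1 + y \le (1 + 2/c)e^{cy/2}$ supplies the other half of the
    exponential. *)
Lemma young_log a y sigma c : 0 <= a -> 0 <= y -> 0 <= sigma -> sigma <= 1 -> 0 < c ->
  a * y `^ sigma <=
  (2 / c) `^ sigma * (a * ln (a + expR 1) `^ sigma) + (1 + 2 / c) * expR (c * y).
Proof.
move=> a0 y0 s0 s1 c0; set l := ln (a + expR 1).
have c2 : 0 <= 2 / c by rewrite divr_ge0// ltW.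
have l0 : 0 <= l by rewrite (le_trans ler01)// ln_addE_ge1.
have P1 : 0 <= (2 / c) `^ sigma * (a * l `^ sigma) by rewrite !mulr_ge0 ?powR_ge0.
have P2 : 0 <= (1 + 2 / c) * expR (c * y) by rewrite mulr_ge0 ?expR_ge0// addr_ge0.
have [yl|yl] := leP y (2 / c * l).
  apply: ler_wpDr => //; rewrite mulrCA -powRM// ler_wpM2l// ge0_ler_powR ?nnegrE//.
  by rewrite mulr_ge0.
apply: ler_wpDl => //.
have ay : a <= expR (c * y / 2).
  have : l <= c * y / 2.
    move: yl; rewrite -(ltr_pM2l (x := c / 2)) ?divr_gt0// mulrA.
    have -> : c / 2 * (2 / c) = 1 by field; rewrite gt_eqF.
    by rewrite mul1r mulrAC => /ltW.
  rewrite -ler_expR lnK ?posrE ?ltr_wpDl ?expR_gt0//; apply: le_trans.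
  by rewrite lerDl expR_ge0.
have yy : y `^ sigma <= (1 + 2 / c) * expR (c * y / 2).
  apply: (le_trans (powR_le_add1 y0 s0 s1)).
  apply: (@le_trans _ _ ((1 + 2 / c) * (1 + c * y / 2))); last first.
    by rewrite ler_wpM2l ?addr_ge0// expR_ge1Dx.
  rewrite -subr_ge0.
  have -> : (1 + 2 / c) * (1 + c * y / 2) - (1 + y) = 2 / c + c * y / 2 by field; rewrite gt_eqF.
  by rewrite addr_ge0// divr_ge0// mulr_ge0// ltW.
apply: (@le_trans _ _ (expR (c * y / 2) * ((1 + 2 / c) * expR (c * y / 2)))).
  by apply: ler_pM => //; exact: powR_ge0.
by rewrite mulrCA -expRD -splitr.
Qed.

(** The rate $c$ for which $2c(w_0^2 + w_1^2)/X$ is the mean of the two Trudinger exponents $\ln 2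
    \cdot w_j^2/(128X)$; the mean is what separates the two components. *)
Definition trudinger_rate : R := ln 2 / 512.

Lemma trudinger_rate_gt0 : 0 < trudinger_rate.
Proof. by apply: divr_gt0; [apply: ln_gt0; exact: ltr1n|exact: ltr0n]. Qed.

Lemma expR_mean_le a b : expR ((a + b) / 2) <= expR a + expR b.
Proof.
have [ab|/ltW ab] := leP a b.
- by rewrite ler_wpDl ?expR_ge0// ler_expR; lra.
- by rewrite ler_wpDr ?expR_ge0// ler_expR; lra.
Qed.

(** Here [b] is the truncation of $|u|^2$. The relation $(1+q)\sigma = q$ gives $b^q = X^\sigma
    y^\sigma$ with $y = b^{1+q}/X$; Young's inequality applies to [fn / theta] and $y$, and $y$ is
    controlled by $|w|^2/X$ up to an additive constant because [e <= X]. *)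
Lemma source_pointwise b q sigma (e X theta fn w0 w1 : R) :
  0 < b -> 0 <= q -> 0 <= sigma -> sigma <= 1 -> (1 + q) * sigma = q ->
  0 < X -> e <= X -> 0 < theta -> 0 <= fn ->
  b `^ (1 + q) <= 2 * (w0 ^+ 2 + w1 ^+ 2) + e ->
  let c := trudinger_rate in
  b `^ q * fn <=
   (theta * X `^ sigma * (2 / c) `^ sigma) * (fn / theta * ln (fn / theta + expR 1) `^ sigma) +
   (theta * X `^ sigma * ((1 + 2 / c) * expR c)) *
     (expR (ln 2 * (w0 ^+ 2 / (128 * X))) + expR (ln 2 * (w1 ^+ 2 / (128 * X)))).
Proof.
move=> b0 q0 s0 s1 qs X0 eX t0 f0 H; set c := trudinger_rate => /=.
pose y := b `^ (1 + q) / X; pose a := fn / theta.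
have y0 : 0 <= y by rewrite divr_ge0 ?powR_ge0// ltW.
have a0 : 0 <= a by rewrite divr_ge0// ltW.
have -> : b `^ q * fn = theta * X `^ sigma * (a * y `^ sigma).
  have -> : b `^ q = X `^ sigma * y `^ sigma.
    rewrite -powRM ?(ltW X0)//; have -> : X * y = b `^ (1 + q) by rewrite /y mulrC divfK// gt_eqF.
    by rewrite -powRrM qs.
  rewrite /a; move: (X `^ sigma) (y `^ sigma) => A B; field; rewrite gt_eqF//.
have c0 : 0 < c := trudinger_rate_gt0.
rewrite -!(mulrA (theta * _)) -mulrDr; apply: ler_wpM2l.
  by rewrite mulr_ge0 ?powR_ge0// ltW.
apply: (le_trans (young_log a0 y0 s0 s1 c0)).
rewrite -[X in _ <= _ + X]mulrA; apply: lerD; first exact: lexx.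
apply: ler_wpM2l; first by rewrite addr_ge0// divr_ge0// ltW.
pose al (w : R) := ln 2 * (w ^+ 2 / (128 * X)).
have : c * y <= c + (al w0 + al w1) / 2.
  have -> : c + (al w0 + al w1) / 2 = c * ((2 * (w0 ^+ 2 + w1 ^+ 2) + X) / X).
    by rewrite /c /trudinger_rate /al; field; rewrite gt_eqF.
  rewrite ler_pM2l// /y ler_pM2r ?invr_gt0//; apply: (le_trans H); lra.
rewrite -ler_expR => /le_trans; apply; rewrite expRD ler_wpM2l ?expR_ge0//.
exact: expR_mean_le.
Qed.

Lemma powR1D a q : 0 < a -> a `^ (1 + q) = a * a `^ q.
Proof. by move=> a0; rewrite powRD ?(gt_eqF a0) ?implybT// powRr1// ltW. Qed.

Lemma powR1B a q : 0 < a -> a `^ (1 - q) = a / a `^ q.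
Proof. by move=> a0; rewrite powRB ?(gt_eqF a0) ?implybT// powRr1// ltW. Qed.

(** The truncation is at most $t + \varepsilon$, hence at most $2t$ or at most $2\varepsilon$. The
    error term cannot be dropped: at $t = 0$ the truncation equals $\varepsilon$ while $w$
    vanishes. *)
Lemma trunc_powR_le eps t q : 0 < eps -> eps < 1 -> 0 <= t -> 0 <= q ->
  trunc eps t `^ (1 + q) <= 2 * (trunc eps t `^ q * t) + (2 * eps) `^ (1 + q).
Proof.
move=> e0 e1 t0 q0; have b0 := trunc_gt0 e0 e1 t0.
have bt : trunc eps t <= t + eps.
  have et : 0 <= eps * t by rewrite mulr_ge0// ltW.
  by rewrite /trunc ler_pdivrMr; [rewrite ler_peMr; lra|lra].
have q1 : 0 <= 1 + q by lra.
have [et|te] := leP eps t.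
  apply: ler_wpDr; first exact: powR_ge0.
  rewrite powR1D// mulrC (mulrCA 2); apply: ler_wpM2l; first exact: powR_ge0.
  by lra.
apply: ler_wpDl; first by rewrite !mulr_ge0 ?powR_ge0.
by rewrite ge0_ler_powR ?nnegrE ?(ltW b0)//; lra.
Qed.

(** Either $X \le 2e$, or the power term is at least $X/2$ and division by $X^\sigma$ concludes,
    since $1 - \sigma = 1/(1+q)$. *)
Lemma absorb X (A e : R) sigma q : 0 < X -> 0 <= q -> 0 <= A -> 0 <= e ->
  (1 + q) * sigma = q -> X <= A * X `^ sigma + e -> X <= (2 * A) `^ (1 + q) + 2 * e.
Proof.
move=> X0 q0 A0 e0 qs H.
have P0 := powR_ge0 (2 * A) (1 + q).
have [Xe|eX] := leP X (2 * e); first by lra.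
have {}H : X <= 2 * A * X `^ sigma by lra.
have X1 : X `^ (1 - sigma) <= 2 * A by rewrite powR1B// ler_pdivrMr// powR_gt0.
have s1 : (1 - sigma) * (1 + q) = 1 by rewrite mulrBl mul1r (mulrC sigma) qs; ring.
have : X <= (2 * A) `^ (1 + q).
  have -> : X = (X `^ (1 - sigma)) `^ (1 + q) by rewrite -powRrM s1 powRr1// ltW.
  by apply: ge0_ler_powR => //; rewrite ?nnegrE ?powR_ge0 ?mulr_ge0//; lra.
lra.
Qed.

End Orlicz.

(** * The weighted source and the bound uniform in the truncation *)

Section WeightedSource.
Context {R : realType}.
Implicit Types (f g : R * R -> R) (x : R * R) (Omega : set (R * R)).
Implicit Types (u : 'I_2 -> R * R -> R) (F G : 'I_2 -> 'I_2 -> R * R -> R).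
Implicit Types (eps q sigma theta X A : R) (i j : 'I_2).
Local Notation TT := (measurableTypeR R * measurableTypeR R)%type.

Lemma fine_le_EFin (y : \bar R) (r : R) : (0 <= y)%E -> (y <= r%:E)%E -> fine y <= r.
Proof. by case: y. Qed.

(** For [sigma] equal to $(p-2)/p$ this is the Young function $\widetilde N$ at $|F|^2/\theta$, the
    integrand of the Luxemburg norm. *)
Definition orlicz_density F theta sigma x : R :=
  fnorm2 F x / theta * ln (fnorm2 F x / theta + expR 1) `^ sigma.

Lemma fnorm2_ge0 F x : 0 <= fnorm2 F x.
Proof. by rewrite sumr_ge0// => i _; rewrite sumr_ge0// => j _; exact: sqr_ge0. Qed.

Lemma orlicz_density_ge0 F theta sigma x : 0 < theta -> 0 <= orlicz_density F theta sigma x.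
Proof. by move=> t0; rewrite mulr_ge0 ?powR_ge0// divr_ge0 ?fnorm2_ge0// ltW. Qed.

Lemma measurable_fnorm2 Omega F : (forall i j, measurable_fun Omega (F i j)) ->
  measurable_fun Omega (fnorm2 F).
Proof.
move=> mF; have -> : fnorm2 F = fun x => (F ord0 ord0 x ^+ 2 + F ord0 ord_max x ^+ 2) +
    (F ord_max ord0 x ^+ 2 + F ord_max ord_max x ^+ 2).
  by apply/funext => x; rewrite /fnorm2 !sum_ord2.
by apply: measurable_funD; apply: measurable_funD; apply: measurable_funX; exact: mF.
Qed.

Lemma measurable_orlicz_density Omega F theta sigma :
  (forall i j, measurable_fun Omega (F i j)) ->
  measurable_fun Omega (orlicz_density F theta sigma).
Proof.
move=> mF; have m1 : measurable_fun Omega (fun x => fnorm2 F x / theta).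
  by apply: measurable_funM; [exact: measurable_fnorm2|exact: measurable_cst].
apply: measurable_funM; first exact: m1.
apply: (measurableT_comp (measurable_powR (R:=R) sigma)).
apply: (measurableT_comp (measurable_ln (R:=R))).
by apply: measurable_funD; [exact: m1|exact: measurable_cst].
Qed.

(* The constant produced by Young's inequality and the exponential integrability
   of the truncations, on a domain of area [m]. *)
Definition source_constant sigma (m : R) : R :=
  (2 / trudinger_rate) `^ sigma +
  (1 + 2 / trudinger_rate) * expR trudinger_rate * (8 * m).

Lemma source_constant_ge0 sigma (m : R) : 0 <= m -> 0 <= source_constant sigma m.
Proof.
move=> m0; rewrite addr_ge0 ?powR_ge0//; apply: mulr_ge0; last by rewrite mulr_ge0.
rewrite mulr_ge0 ?expR_ge0// addr_ge0// divr_ge0//.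
exact: ltW trudinger_rate_gt0.
Qed.

Lemma col_le_mnorm2 G j x : G ord0 j x ^+ 2 + G ord_max j x ^+ 2 <= mnorm2 G x.
Proof.
rewrite /mnorm2; elim/ord2P: j.
- by rewrite lerDl addr_ge0 ?sqr_ge0.
- by rewrite lerDr addr_ge0 ?sqr_ge0.
Qed.

Lemma exp_weighted_integral eps q Omega u G X j : 0 < eps -> eps < 1 -> 0 <= q ->
  open Omega -> (leb2 Omega < +oo)%E ->
  (forall j, measurable_fun Omega (u j)) -> (forall i j, measurable_fun Omega (G i j)) ->
  (forall j, approximable Omega (u j) (fun i => G i j)) -> 0 < X ->
  leb2.-integrable Omega (EFin \o mnorm2 (weighted_grad eps (q / 2) u G)) ->
  \int[leb2]_(x in Omega) mnorm2 (weighted_grad eps (q / 2) u G) x <= X ->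
  (\int[leb2]_(x in Omega) (expR (ln 2 * (weighted eps (q / 2) u j x ^+ 2 / (128 * X))))%:E <=
    (4 * fine (leb2 Omega))%:E)%E.
Proof.
move=> e0 e1 q0 oO Ooo mu mG Au X0 iP PX; have mO := open_measurable_plane oO.
have q20 : 0 <= q / 2 by rewrite divr_ge0.
pose P := weighted_grad eps (q / 2) u G.
have mP a b : measurable_fun Omega (P a b) by exact: measurable_weighted_grad.
have mw := measurable_weighted (q / 2) e0 e1 oO mu j.
apply: (trudinger oO Ooo mw (fun i => mP i j) (approximable_weighted e0 e1 q20 oO Au j) X0).
apply: le_trans PX; apply: ae_le_Rintegral => //.
  apply: (integrable_dominated mO _ iP).
    by apply: measurable_funD; apply: measurable_funX; exact: mP.
  apply: aeW => x _; rewrite ger0_norm ?sumsq_le// ?addr_ge0 ?sqr_ge0//.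
  exact: col_le_mnorm2.
by apply: aeW => x _; exact: col_le_mnorm2.
Qed.

Lemma integral_lincomb_le (D : set TT) (f g h k : TT -> R) (c d r s t : R) : measurable D ->
  measurable_fun D f -> measurable_fun D g -> measurable_fun D h -> measurable_fun D k ->
  (forall x, 0 <= f x) -> (forall x, 0 <= g x) -> (forall x, 0 <= h x) -> (forall x, 0 <= k x) ->
  0 <= c -> 0 <= d -> (forall x, f x <= c * g x + d * (h x + k x)) ->
  (\int[leb2]_(x in D) (g x)%:E <= r%:E)%E -> (\int[leb2]_(x in D) (h x)%:E <= s%:E)%E ->
  (\int[leb2]_(x in D) (k x)%:E <= t%:E)%E ->
  (\int[leb2]_(x in D) (f x)%:E <= (c * r + d * (s + t))%:E)%E.
Proof.
move=> mD mf mg mh mk f0 g0 h0 k0 c0 d0 fle gr hs kt.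
have mhk : measurable_fun D (fun x => h x + k x) by exact: measurable_funD.
have mcg : measurable_fun D (fun x => c * g x) by apply: measurable_funM => //; exact: measurable_cst.
have mdhk : measurable_fun D (fun x => d * (h x + k x)).
  by apply: measurable_funM => //; exact: measurable_cst.
apply: (@le_trans _ _ (\int[leb2]_(x in D) ((c * g x)%:E + (d * (h x + k x))%:E))%E).
  apply: ge0_le_integral => //.
  - by move=> x _; rewrite lee_fin.
  - exact/measurable_EFinP.
  - by apply/measurable_EFinP; exact: measurable_funD.
  - by move=> x _; rewrite -EFinD lee_fin.
rewrite ge0_integralD//; last 4 first.
- by move=> x _; rewrite lee_fin mulr_ge0.
- exact/measurable_EFinP.
- by move=> x _; rewrite lee_fin mulr_ge0// addr_ge0.
- exact/measurable_EFinP.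
under eq_integral do rewrite EFinM.
rewrite ge0_integralZl//; last 2 first.
- exact/measurable_EFinP.
- by move=> x _; rewrite lee_fin.
under [X in (_ + X)%E]eq_integral do rewrite EFinM EFinD.
rewrite ge0_integralZl//; last 2 first.
- by apply/measurable_EFinP.
- by move=> x _; rewrite -EFinD lee_fin addr_ge0.
rewrite ge0_integralD//; last 4 first.
- by move=> x _; rewrite lee_fin.
- exact/measurable_EFinP.
- by move=> x _; rewrite lee_fin.
- exact/measurable_EFinP.
rewrite EFinD !EFinM EFinD; apply: leeD; first by apply: lee_wpmul2l; rewrite ?lee_fin.
by apply: lee_wpmul2l; rewrite ?lee_fin//; exact: leeD.
Qed.

(** The Orlicz density has integral at most 1, and each component of $w$ contributes an exponential
    integral of at most $4|\Omega|$; hence the 8 in [source_constant]. *)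
Lemma source_integral_le eps q sigma theta Omega u G F X : 0 < eps -> eps < 1 -> 0 <= q ->
  0 <= sigma -> sigma <= 1 -> (1 + q) * sigma = q ->
  open Omega -> (leb2 Omega < +oo)%E ->
  (forall j, measurable_fun Omega (u j)) -> (forall i j, measurable_fun Omega (G i j)) ->
  (forall j, approximable Omega (u j) (fun i => G i j)) ->
  (forall i j, measurable_fun Omega (F i j)) ->
  leb2.-integrable Omega (EFin \o mnorm2 (weighted_grad eps (q / 2) u G)) ->
  0 < X -> (2 * eps) `^ (1 + q) <= X ->
  \int[leb2]_(x in Omega) mnorm2 (weighted_grad eps (q / 2) u G) x <= X ->
  0 < theta -> (\int[leb2]_(x in Omega) (orlicz_density F theta sigma x)%:E <= 1)%E ->
  \int[leb2]_(x in Omega) (vweight eps q u x * fnorm2 F x) <=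
    theta * X `^ sigma * source_constant sigma (fine (leb2 Omega)).
Proof.
move=> e0 e1 q0 s0 s1 qs oO Ooo mu mG Au mF iP X0 eX PX t0 F1.
have mO := open_measurable_plane oO.
have E j := exp_weighted_integral j e0 e1 q0 oO Ooo mu mG Au X0 iP PX.
pose e j x := expR (ln 2 * (weighted eps (q / 2) u j x ^+ 2 / (128 * X))).
have e_0 j x : 0 <= e j x by exact: expR_ge0.
have me j : measurable_fun Omega (e j).
  apply: (measurableT_comp (@measurable_expR R)); apply: measurable_funM; first exact: measurable_cst.
  apply: measurable_funM; last exact: measurable_cst.
  by apply: measurable_funX; exact: measurable_weighted.
have mN := measurable_orlicz_density theta sigma mF.
pose c := @trudinger_rate R; have c0 : 0 < c := trudinger_rate_gt0.
pose C1 := theta * X `^ sigma * (2 / c) `^ sigma.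
pose C2 := theta * X `^ sigma * ((1 + 2 / c) * expR c).
have tX : 0 <= theta * X `^ sigma by rewrite mulr_ge0 ?powR_ge0// ltW.
have C10 : 0 <= C1 by rewrite mulr_ge0 ?powR_ge0.
have C20 : 0 <= C2 by rewrite mulr_ge0// mulr_ge0 ?expR_ge0// addr_ge0// divr_ge0// ltW.
have N0 x := orlicz_density_ge0 F sigma x t0.
have W0 x : 0 <= vweight eps q u x * fnorm2 F x.
  by rewrite mulr_ge0 ?fnorm2_ge0// ltW// vweight_gt0.
have H x : vweight eps q u x * fnorm2 F x <=
    C1 * orlicz_density F theta sigma x + C2 * (e ord0 x + e ord_max x).
  apply: (source_pointwise _ q0 s0 s1 qs X0 eX t0 (fnorm2_ge0 F x)).
    by apply: trunc_gt0 => //; exact: sumsq_ge0.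
  apply: (le_trans (trunc_powR_le e0 e1 (sumsq_ge0 _ _) q0)).
  rewrite lerD2r ler_pM2l// le_eqVlt; apply/orP; left; apply/eqP.
  by rewrite /weighted !exprMn vweight_sqr -mulrDr.
apply: fine_le_EFin; first by apply: integral_ge0 => x _; rewrite lee_fin.
have mWF : measurable_fun Omega (fun x => vweight eps q u x * fnorm2 F x).
  by apply: measurable_funM; [exact: measurable_vweight|exact: measurable_fnorm2].
have := integral_lincomb_le mO mWF mN (me ord0) (me ord_max) W0 N0 (e_0 ord0) (e_0 ord_max)
  C10 C20 H F1 (E ord0) (E ord_max).
congr (_ <= _%:E)%E; rewrite /source_constant -/c /C1 /C2; ring.
Qed.

Lemma weighted_energy_bound eps q sigma theta Omega u G F A : 0 < eps -> eps < 1 -> 0 <= q ->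
  0 <= sigma -> sigma <= 1 -> (1 + q) * sigma = q ->
  open Omega -> (leb2 Omega < +oo)%E ->
  (forall j, measurable_fun Omega (u j)) -> (forall i j, measurable_fun Omega (G i j)) ->
  (forall j, approximable Omega (u j) (fun i => G i j)) ->
  (forall i j, measurable_fun Omega (F i j)) ->
  leb2.-integrable Omega (EFin \o mnorm2 (weighted_grad eps (q / 2) u G)) -> 0 <= A ->
  \int[leb2]_(x in Omega) mnorm2 (weighted_grad eps (q / 2) u G) x <=
    A * \int[leb2]_(x in Omega) (vweight eps q u x * fnorm2 F x) ->
  0 < theta -> (\int[leb2]_(x in Omega) (orlicz_density F theta sigma x)%:E <= 1)%E ->
  \int[leb2]_(x in Omega) mnorm2 (weighted_grad eps (q / 2) u G) x <=
    (2 * (A * theta * source_constant sigma (fine (leb2 Omega)))) `^ (1 + q)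
    + 2 * (2 * eps) `^ (1 + q).
Proof.
move=> e0 e1 q0 s0 s1 qs oO Ooo mu mG Au mF iP A0 WA t0 F1.
set W := Rintegral _ _ _ in WA *; set D := source_constant _ _.
have W0 : 0 <= W by apply: Rintegral_ge0 => x _; exact: mnorm2_ge0.
have ep : 0 < (2 * eps) `^ (1 + q) by rewrite powR_gt0// mulr_gt0.
(* The added error makes [X] positive even when [W] is 0, and at least as large as the error, as the
   source estimate requires. *)
pose X := W + (2 * eps) `^ (1 + q).
have X0 : 0 < X by rewrite ltr_wpDl.
have eX : (2 * eps) `^ (1 + q) <= X by rewrite lerDr.
have WX : W <= X by rewrite lerDl ltW.
have S := source_integral_le e0 e1 q0 s0 s1 qs oO Ooo mu mG Au mF iP X0 eX WX t0 F1.
have D0 : 0 <= D by apply: source_constant_ge0; exact: fine_ge0.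
apply: (le_trans WX); apply: absorb qs _ => //.
- by rewrite !mulr_ge0// ltW.
- exact: ltW.
- rewrite -/X {1}/X lerD2r; apply: (le_trans WA).
  have -> : A * theta * D * X `^ sigma = A * (theta * X `^ sigma * D) by ring.
  exact: ler_wpM2l.
Qed.

End WeightedSource.

(** * Removal of the truncation *)

Section Limit.
Context {R : realType}.
Implicit Types (f g : R * R -> R) (x : R * R) (Omega : set (R * R)).
Implicit Types (u : 'I_2 -> R * R -> R) (F G : 'I_2 -> 'I_2 -> R * R -> R).
Implicit Types (eps q sigma theta X A : R) (i j : 'I_2).
Local Notation TT := (measurableTypeR R * measurableTypeR R)%type.

(** The shift by 2 keeps $\varepsilon < 1$ and $2\varepsilon \le 1$; the latter gives
    $(2\varepsilon)^{1+q} \le 2\varepsilon$. *)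
Definition level_eps (n : nat) : R := n.+2%:R^-1.

Lemma level_eps_gt0 n : 0 < level_eps n.
Proof. by rewrite invr_gt0 ltr0n. Qed.

Lemma level_eps_lt1 n : level_eps n < 1.
Proof. by rewrite invf_lt1 ?ltr0n// ltr1n. Qed.

Lemma level_eps_le_half n : 2 * level_eps n <= 1.
Proof. by rewrite /level_eps ler_pdivrMr ?ltr0n// mul1r ler_nat. Qed.

Lemma cvg_level_eps : level_eps n @[n --> \oo] --> 0.
Proof. by have := @cvg_harmonic R; rewrite -(cvg_shiftS (@harmonic R : nat -> R)). Qed.

Lemma powR_continuous (a y : R) : 0 < y -> {for y, continuous (fun z : R => z `^ a)}.
Proof.
move=> y0; have d := is_derive1_powR a y0.
by apply: differentiable_continuous; apply/derivable1_diffP; exact: ex_derive.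
Qed.

Lemma trunc_cvg t : 0 <= t -> trunc (level_eps n) t @[n --> \oo] --> t.
Proof.
move=> t0; rewrite [X in _ --> X](_ : t = (t + 0) / (1 + 0 * t)); last by rewrite addr0 mul0r addr0 divr1.
apply: cvgM; first by apply: cvgD; [exact: cvg_cst|exact: cvg_level_eps].
apply: cvgV; first by rewrite mul0r addr0 oner_eq0.
apply: cvgD; first exact: cvg_cst.
by apply: cvgM; [exact: cvg_level_eps|exact: cvg_cst].
Qed.

(** The case $t = 0$ is apart: powers are continuous at 0 from the right only for a positive
    exponent, and for [q = 0] both sides are 1. *)
Lemma trunc_powR_cvg t q : 0 <= t -> 0 <= q ->
  trunc (level_eps n) t `^ q @[n --> \oo] --> t `^ q.
Proof.
move=> t0 q0.
have [->|qn0] := eqVneq q 0.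
  by rewrite powRr0; under eq_fun do rewrite powRr0; exact: cvg_cst.
have qp : 0 < q by rewrite lt_neqAle eq_sym qn0.
have [->|tn0] := eqVneq t 0.
  rewrite powR0//; apply: (cvg_comp (fun n => trunc (level_eps n) 0) _ _ (powR_cvg0 qp)) => A /= H.
  have L : \forall n \near \oo, 0 < trunc (level_eps n) 0 -> A (trunc (level_eps n) 0).
    exact: trunc_cvg (lexx 0) _ H.
  change (\forall n \near \oo, A (trunc (level_eps n) 0)).
  apply: filterS L => n; apply.
  by apply: trunc_gt0 => //; [exact: level_eps_gt0|exact: level_eps_lt1].
have tp : 0 < t by rewrite lt_neqAle eq_sym tn0.
by apply: (continuous_cvg _ (powR_continuous (a := q) tp)); exact: trunc_cvg.
Qed.

Lemma mnorm2E G x : mnorm2 G x = fnorm2 G x.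
Proof. by rewrite /mnorm2 /fnorm2 !sum_ord2; ring. Qed.

Lemma mat_norm_sqr F x : mat_norm F x ^+ 2 = fnorm2 F x.
Proof. by rewrite sqr_sqrtr//; exact: fnorm2_ge0. Qed.

Lemma vec_norm_powR u x (p : R) :
  vec_norm u x `^ (p - 2) = (u ord0 x ^+ 2 + u ord_max x ^+ 2) `^ ((p - 2) / 2).
Proof.
rewrite /vec_norm sum_ord2 -powR12_sqrt ?sumsq_ge0// -powRrM; congr (_ `^ _); ring.
Qed.

Lemma measurable_sumsq_powR Omega u q : open Omega -> (forall j, measurable_fun Omega (u j)) ->
  measurable_fun Omega (fun x => (u ord0 x ^+ 2 + u ord_max x ^+ 2) `^ q).
Proof.
move=> oO mu; apply: (measurableT_comp (measurable_powR (R:=R) q)).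
by apply: measurable_funD; apply: measurable_funX; exact: mu.
Qed.

Lemma weighted_limit_bound q Omega u G (B : R) : 0 <= q -> open Omega ->
  (forall j, measurable_fun Omega (u j)) -> (forall i j, measurable_fun Omega (G i j)) ->
  (forall eps, 0 < eps -> eps < 1 ->
    leb2.-integrable Omega (EFin \o mnorm2 (weighted_grad eps (q / 2) u G))) ->
  (forall eps, 0 < eps -> eps < 1 ->
    \int[leb2]_(x in Omega) mnorm2 (weighted_grad eps (q / 2) u G) x <=
    B + 2 * (2 * eps) `^ (1 + q)) ->
  (\int[leb2]_(x in Omega) ((u ord0 x ^+ 2 + u ord_max x ^+ 2) `^ q * fnorm2 G x)%:E <= B%:E)%E.
Proof.
move=> q0 oO mu mG iP PB; have mO := open_measurable_plane oO.
apply/lee_addgt0Pr => e e0.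
(* For such indices the error is at most $2(2\varepsilon)^{1+q} \le 4\varepsilon < e$. *)
have e4 : 0 < e / 4 by rewrite divr_gt0.
have [N _ HN] : \forall n \near \oo, level_eps n < e / 4.
  exact: (cvgr_lt _ cvg_level_eps).
have mF : measurable_fun Omega (fnorm2 G) by exact: measurable_fnorm2.
apply: (@fatou_le _ Omega (fun n x => vweight (level_eps n) q u x * fnorm2 G x) _ _ N mO).
- move=> n; apply: measurable_funM => //.
  by apply: measurable_vweight => //; [exact: level_eps_gt0|exact: level_eps_lt1].
- by apply: measurable_funM => //; exact: measurable_sumsq_powR.
- move=> n x; rewrite mulr_ge0 ?fnorm2_ge0// ltW// vweight_gt0//; [exact: level_eps_gt0|exact: level_eps_lt1].
- by move=> x; rewrite mulr_ge0 ?fnorm2_ge0 ?powR_ge0.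
- apply: aeW => x _; apply: cvgM; last exact: cvg_cst.
  by apply: trunc_powR_cvg => //; exact: sumsq_ge0.
- move=> n Nn; have n0 := level_eps_gt0 n; have n1 := level_eps_lt1 n.
  have i := iP _ n0 n1.
  apply: (@le_trans _ _ (\int[leb2]_(x in Omega) (mnorm2 (weighted_grad (level_eps n) (q / 2) u G) x)%:E)%E).
    apply: ge0_le_integral => //.
    + by move=> x _; rewrite lee_fin mulr_ge0 ?fnorm2_ge0// ltW// vweight_gt0.
    + by apply/measurable_EFinP; apply: measurable_funM => //; exact: measurable_vweight.
    + exact: measurable_int i.
    + by move=> x _; rewrite lee_fin -mnorm2E; exact: mnorm2_weighted_ge.
  rewrite -[leLHS](fineK (integrable_fin_num mO i)) -EFinD lee_fin.
  apply: (le_trans (PB _ n0 n1)); rewrite lerD2l.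
  have := HN n Nn => /= H.
  have n2 : 0 < 2 * level_eps n by rewrite mulr_gt0.
  have : (2 * level_eps n) `^ (1 + q) <= 2 * level_eps n.
    by apply: ge1r_powR; [rewrite n2 level_eps_le_half|lra].
  lra.
Qed.

End Limit.

(** * The Luxemburg norm of the source *)

Section Luxemburg.
Context {R : realType}.
Implicit Types (f g : R * R -> R) (x : R * R) (Omega : set (R * R)).
Implicit Types (u : 'I_2 -> R * R -> R) (F G : 'I_2 -> 'I_2 -> R * R -> R).
Implicit Types (p q sigma theta : R) (i j : 'I_2).
Local Notation TT := (measurableTypeR R * measurableTypeR R)%type.

(** Each inequality is solved for [theta], giving the lower bound $(I/K)^{1/r}$, which passes to the
    infimum. Nonemptiness of [S] keeps the infimum finite, so the power can be undone in the
    reals. *)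
Lemma le_ereal_inf_powR (S : set R) (I : \bar R) (K r : R) : 0 < K -> 0 < r -> (0 <= I)%E ->
  S !=set0 -> (forall theta, S theta -> 0 < theta /\ (I <= (K * theta `^ r)%:E)%E) ->
  (I <= K%:E * ereal_inf [set theta%:E | theta in S] `^ r)%E.
Proof.
move=> K0 r0 + [t0 St0] H; have [t00 It0] := H _ St0.
case: I H It0 => [i|//|//] H _; rewrite lee_fin => i0.
have iK : 0 <= i / K by rewrite divr_ge0// ltW.
set L := ereal_inf _.
have LB : (((i / K) `^ r^-1)%:E <= L)%E.
  apply: le_ereal_inf_tmp => _ [theta St <-]; rewrite lee_fin.
  have [th0] := H _ St; rewrite lee_fin => ih.
  have -> : theta = (theta `^ r) `^ r^-1.
    by rewrite -powRrM divff ?gt_eqF// powRr1// ltW.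
  apply: ge0_ler_powR; rewrite ?nnegrE ?powR_ge0 ?invr_ge0 ?(ltW r0)//.
  by rewrite ler_pdivrMr// mulrC.
have UB : (L <= t0%:E)%E by apply: ereal_inf_lbound; exists t0.
move: LB UB; case: L => [l|//|//]; rewrite lee_fin => il _.
rewrite poweR_EFin -EFinM lee_fin mulrC -ler_pdivrMr//.
have -> : i / K = ((i / K) `^ r^-1) `^ r by rewrite -powRrM mulVf ?gt_eqF// powRr1.
apply: ge0_ler_powR => //; rewrite ?nnegrE ?powR_ge0// ?(ltW r0)//.
exact: le_trans (powR_ge0 _ _) il.
Qed.

Lemma Ntilde_density p F theta x :
  Ntilde p (`|mat_norm F x ^+ 2| / theta) = orlicz_density F theta ((p - 2) / p) x.
Proof. by rewrite mat_norm_sqr ger0_norm ?fnorm2_ge0. Qed.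

Lemma Ntilde_integral p F theta Omega :
  (\int[leb2]_(x in Omega) (Ntilde p (`|mat_norm F x ^+ 2| / theta))%:E =
   \int[leb2]_(x in Omega) (orlicz_density F theta ((p - 2) / p) x)%:E)%E.
Proof. by apply: eq_integral => x _; rewrite Ntilde_density. Qed.

(** The integrability hypothesis contains the logarithm of $|F|$, the Luxemburg norm that of
    $|F|^2$. The comparison is $m^2 + e \le (m+e)^2$. *)
Lemma ln_sqr_le (m : R) : 0 <= m -> ln (m ^+ 2 + expR 1) <= 2 * ln (m + expR 1).
Proof.
move=> m0; have e1 : 1 <= expR 1 :> R by rewrite -[leLHS]expR0 ler_expR.
have me : 0 < m + expR 1 by rewrite ltr_wpDl// expR_gt0.
rewrite mulr_natl -lnXn// ler_ln ?posrE ?exprn_gt0//; last by rewrite ltr_wpDl ?sqr_ge0// expR_gt0.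
rewrite -subr_ge0.
have -> : (m + expR 1) ^+ 2 - (m ^+ 2 + expR 1) = 2 * (m * expR 1) + expR 1 * (expR 1 - 1) by ring.
by rewrite addr_ge0// ?mulr_ge0 ?expR_ge0// subr_ge0.
Qed.

(** For [theta] at least 1 the division inside the logarithm can only lower it, and replacing
    $|F|^2$ by $|F|$ there costs the factor $2^\sigma$. *)
Lemma orlicz_density_le F theta sigma x : 1 <= theta -> 0 <= sigma ->
  orlicz_density F theta sigma x <=
  2 `^ sigma / theta * (mat_norm F x ^+ 2 * ln (mat_norm F x + expR 1) `^ sigma).
Proof.
move=> t1 s0; rewrite /orlicz_density mat_norm_sqr.
have t0 : 0 < theta by apply: lt_le_trans t1.
have f0 := fnorm2_ge0 F x; have m0 : 0 <= mat_norm F x by exact: sqrtr_ge0.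
have ft0 : 0 <= fnorm2 F x / theta by rewrite divr_ge0// ltW.
have -> : 2 `^ sigma / theta * (fnorm2 F x * ln (mat_norm F x + expR 1) `^ sigma) =
  fnorm2 F x / theta * (2 `^ sigma * ln (mat_norm F x + expR 1) `^ sigma).
  by move: (_ `^ _) (_ `^ _) => a b; field; rewrite gt_eqF.
apply: ler_wpM2l => //; rewrite -powRM//; last by rewrite (le_trans ler01)// ln_addE_ge1.
have l1 := ln_addE_ge1 ft0; have l2 := ln_addE_ge1 m0.
apply: ge0_ler_powR; rewrite ?nnegrE//; [lra|lra|].
apply: le_trans (ln_sqr_le m0); rewrite mat_norm_sqr ler_ln ?posrE.
- by rewrite lerD2r ler_pdivrMr// ler_peMr.
- by rewrite ltr_wpDl// expR_gt0.
- by rewrite ltr_wpDl// expR_gt0.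
Qed.

Section Source.
Variables (Omega : set (R * R)) (F : 'I_2 -> 'I_2 -> R * R -> R) (sigma : R).
Hypotheses (oO : open Omega) (s0 : 0 <= sigma).
Hypothesis mF : forall i j, measurable_fun Omega (F i j).
Hypothesis Ffin : (\int[leb2]_(x in Omega)
  (mat_norm F x ^+ 2 * (ln (mat_norm F x + expR 1)) `^ sigma)%R%:E < +oo)%E.

Let H x := mat_norm F x ^+ 2 * ln (mat_norm F x + expR 1) `^ sigma.

Let H0 x : 0 <= H x.
Proof. by rewrite mulr_ge0 ?sqr_ge0 ?powR_ge0. Qed.

Let mH : measurable_fun Omega H.
Proof.
have m2 := measurable_fnorm2 mF.
have m : measurable_fun Omega (mat_norm F).
  have -> : mat_norm F = fun x => fnorm2 F x `^ 2^-1.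
    by apply/funext => x; rewrite powR12_sqrt// fnorm2_ge0.
  exact: (measurableT_comp (measurable_powR (R:=R) 2^-1)).
apply: measurable_funM; first exact: measurable_funX.
apply: (measurableT_comp (measurable_powR (R:=R) sigma)).
apply: (measurableT_comp (measurable_ln (R:=R))).
by apply: measurable_funD; [exact: m|exact: measurable_cst].
Qed.

Let iH : leb2.-integrable Omega (EFin \o H).
Proof.
apply/integrableP; split; first exact/measurable_EFinP.
apply: le_lt_trans Ffin; rewrite le_eqVlt; apply/orP; left; apply/eqP.
by apply: eq_integral => x _ /=; rewrite ger0_norm.
Qed.

(** The logarithm is at least 1, so $|F|^2$ is at most the integrand assumed integrable. *)
Lemma source_integrable : leb2.-integrable Omega (EFin \o fnorm2 F).
Proof.
apply: (integrable_dominated (open_measurable_plane oO) _ iH); first exact: measurable_fnorm2.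
apply: aeW => x _; rewrite ger0_norm ?fnorm2_ge0// /H mat_norm_sqr ler_peMr ?fnorm2_ge0//.
rewrite -[leLHS](powRr0 (ln (mat_norm F x + expR 1))) ler_powR//.
by apply: ln_addE_ge1; exact: sqrtr_ge0.
Qed.

Lemma luxemburg_admissible : exists2 theta, 0 < theta &
  (\int[leb2]_(x in Omega) (orlicz_density F theta sigma x)%:E <= 1)%E.
Proof.
have mO := open_measurable_plane oO.
pose N := fine (\int[leb2]_(x in Omega) (H x)%:E)%E.
have N0 : 0 <= N by rewrite fine_ge0// integral_ge0// => x _; rewrite lee_fin.
have NE : (\int[leb2]_(x in Omega) (H x)%:E = N%:E)%E by rewrite fineK// integrable_fin_num.
(* Taken at least 1 for [orlicz_density_le], and larger than the factor $2^\sigma N$ that remains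
   after integration. *)
pose theta := 1 + 2 `^ sigma * N.
have t1 : 1 <= theta by rewrite lerDl mulr_ge0 ?powR_ge0.
have t0 : 0 < theta by apply: lt_le_trans t1.
exists theta => //.
have c0 : 0 <= 2 `^ sigma / theta by rewrite divr_ge0 ?powR_ge0// ltW.
apply: (@le_trans _ _ (\int[leb2]_(x in Omega) ((2 `^ sigma / theta)%:E * (H x)%:E))%E).
  apply: ge0_le_integral => //.
  - by move=> x _; rewrite lee_fin orlicz_density_ge0.
  - by apply/measurable_EFinP; exact: measurable_orlicz_density.
  - by apply/measurable_EFinP; apply: measurable_funM => //; exact: measurable_cst.
  - by move=> x _; rewrite -EFinM lee_fin; exact: orlicz_density_le.
rewrite ge0_integralZl//; last 2 first.
- exact/measurable_EFinP.
- by move=> x _; rewrite lee_fin.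
rewrite NE -EFinM lee_fin mulrAC ler_pdivrMr// mul1r /theta.
by rewrite lerDr.
Qed.

End Source.
End Luxemburg.

(** * Assembly of the estimates *)

Theorem mainTheorem3 (R : realType) (Omega : set (R * R))
  (lambda mu : R * R -> R) (p delta kappa C0 : R)
  (Omega_domain : domain Omega)
  (Omega_bounded : bounded_set Omega)
  (lambda_Linfty : Linfty Omega lambda)
  (mu_Linfty : Linfty Omega mu)
  (mu_pos : (0 < ess_inf_on Omega mu)%E)
  (lambda2mu_pos : (0 < ess_inf_on Omega (fun x => (lambda x + 2 * mu x)%R))%E)
  (p_ge2 : 2 <= p)
  (p_cond : (((1 - 2 / p) ^+ 2)%:E <
     1 - ess_sup_on Omega
           (fun x => (((lambda x + mu x) / (lambda x + 3 * mu x)) ^+ 2)%R))%E)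
  (delta_gt0 : 0 < delta)
  (delta_lt : (delta%:E <
     1 - ess_sup_on Omega
           (fun x => (((lambda x + mu x) / (lambda x + 3 * mu x)) ^+ 2)%R)
       - ((1 - 2 / p) ^+ 2)%:E)%E)
  (kappa_gt0 : 0 < kappa)
  (kappa_lt : (kappa%:E <
     (delta / (2 * (1 - (1 - 2 / p) ^+ 2)))%:E *
     Order.min (ess_inf_on Omega mu)
               (ess_inf_on Omega (fun x => (lambda x + 2 * mu x)%R)))%E)
  (C0_gt0 : 0 < C0)
  (C0_commutator : commutator_constant Omega C0)
  (bmo_small : (bmo_norm Omega (fun x => (mu x ^+ 2 / (lambda x + 3 * mu x))%R)
     <= (kappa / (2 * C0) * (1 - (1 - 2 / p) ^+ 2))%:E)%E) :
  exists K : R,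
    forall (F : 'I_2 -> 'I_2 -> R * R -> R) (u : 'I_2 -> R * R -> R),
    (forall i j, measurable_fun Omega (F i j)) ->
    (\int[leb2]_(x in Omega)
       (mat_norm F x ^+ 2 *
        (ln (mat_norm F x + expR 1)) `^ ((p - 2) / p))%R%:E < +oo)%E ->
    dirichlet_solution Omega lambda mu F u ->
    (\int[leb2]_(x in Omega)
       (mat_norm (wgrad Omega u) x ^+ 2 *
        (vec_norm u x `^ (p - 2) + 1))%R%:E < +oo)%E
    /\
    (\int[leb2]_(x in Omega)
       (mat_norm (wgrad Omega u) x ^+ 2 * vec_norm u x `^ (p - 2))%R%:E
     <= K%:E *
        luxemburg (Ntilde p) Omega (fun x => (mat_norm F x ^+ 2)%R) `^ (p / 2))%E.
Proof.
have [oO _ _] := Omega_domain; have mO := open_measurable_plane oO.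
have Ooo : (leb2 Omega < +oo)%E by exact: bounded_leb2_lty.
have p0 : 0 < p by lra.
(* [q] is the exponent of $|u|^2$ in the weight. The numbers [s] and [sigma] both equal $q/(1+q)$:
   [s] enters through ellipticity, [sigma] through the power of the logarithm. *)
pose s := 1 - 2 / p; pose q := (p - 2) / 2; pose sigma := (p - 2) / p.
have s0 : 0 <= s by rewrite subr_ge0 ler_pdivrMr// mul1r.
have s1 : s < 1 by rewrite /s gtrBl divr_gt0.
have q0 : 0 <= q by rewrite divr_ge0// subr_ge0.
have qs : q * (1 - s) <= s.
  by rewrite le_eqVlt; apply/orP; left; apply/eqP; rewrite /q /s; field; rewrite gt_eqF.
have sg0 : 0 <= sigma by rewrite divr_ge0 ?subr_ge0// ltW.
have sg1 : sigma <= 1 by rewrite ler_pdivrMr// mul1r; lra.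
have q1 : 1 + q = p / 2 by rewrite /q; field.
have qsg : (1 + q) * sigma = q by rewrite /sigma /q; field; rewrite gt_eqF.
pose k := kappa * (1 - s ^+ 2).
have s2 : 0 < 1 - s ^+ 2 by rewrite subr_gt0 expr_lt1// ltW.
have k0 : 0 < k by rewrite mulr_gt0.
have adm := lame_admissible_ae delta_gt0 s0 s1 mu_pos lambda2mu_pos delta_lt kappa_lt.
have [M [laM muM fM]] := lame_bounds delta_gt0 s0 s1 mu_pos lambda2mu_pos delta_lt kappa_lt
  lambda_Linfty mu_Linfty.
have [mla _] := lambda_Linfty; have [mmu _] := mu_Linfty.
pose f x := mu x ^+ 2 / (lambda x + 3 * mu x).
have mf : measurable_fun Omega f.
  apply: measurable_funM; first exact: measurable_funX.
  apply: measurable_fun_inverse; apply: measurable_funD; first exact: mla.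
  by apply: measurable_funM; [exact: measurable_cst|exact: mmu].
have Bf : BMO Omega f.
  split; first exact: bounded_loc_integrable mf fM.
  by apply: (le_lt_trans bmo_small); rewrite ltry.
have B0 : 0 <= kappa / (2 * C0) * (1 - s ^+ 2).
  by rewrite mulr_ge0 ?divr_ge0 ?mulr_ge0// ltW.
(* The smallness of the BMO norm is calibrated so that the commutator costs exactly half of [k]. *)
have kE : C0 * (kappa / (2 * C0) * (1 - s ^+ 2)) = k / 2 by rewrite /k; field; rewrite gt_eqF.
have det (v : 'I_2 -> R * R -> R) G : (forall i j, measurable_fun Omega (G i j)) ->
    (forall j, approximable Omega (v j) (fun i => G i j)) ->
    4 * `|\int[leb2]_(x in Omega) (f x * mdet G x)| <= k / 2 * \int[leb2]_(x in Omega) mnorm2 G x.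
  by move=> mG Av; rewrite -kE; exact: (approximable_det_bound oO C0_gt0 B0 C0_commutator Bf bmo_small fM mG Av).
pose D := source_constant sigma (fine (leb2 Omega)).
have D0 : 0 <= D by apply: source_constant_ge0; exact: fine_ge0.
pose A := 16 / k ^+ 2; have A0 : 0 <= A by rewrite divr_ge0 ?sqr_ge0.
(* The added 1 makes [K] positive, so that one can divide by it when passing to the infimum over
   [theta]. Only the coefficients, [p], [kappa] and the area of [Omega] enter [K]. *)
pose K := (2 * (A * D)) `^ (p / 2) + 1.
have K0 : 0 < K by rewrite ltr_wpDl ?powR_ge0.
exists K => F u mF Ffin sol; have [Hu _] := sol.
have iF := source_integrable oO sg0 mF Ffin.
pose G := wgrad Omega u.
have mu_ j : measurable_fun Omega (u j) by exact: H10_measurable.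
have mG i j : measurable_fun Omega (G i j) by exact: (H10_wpd_L2 i oO (Hu j)).1.
have Au j : approximable Omega (u j) (fun i => G i j) by exact: H10_approximable.
have En eps (e0 : 0 < eps) (e1 : eps < 1) := energy_estimate oO mla mmu laM muM adm mf fM
  delta_gt0 s0 s1 q0 qs k0 det e0 e1 mF iF sol.
pose I := (\int[leb2]_(x in Omega) (mat_norm G x ^+ 2 * vec_norm u x `^ (p - 2))%:E)%E.
have IE : I = (\int[leb2]_(x in Omega) ((u ord0 x ^+ 2 + u ord_max x ^+ 2) `^ q * fnorm2 G x)%:E)%E.
  by apply: eq_integral => x _; rewrite mat_norm_sqr vec_norm_powR mulrC.
have I0 : (0 <= I)%E by apply: integral_ge0 => x _; rewrite lee_fin mulr_ge0 ?sqr_ge0 ?powR_ge0.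
have bound theta : 0 < theta ->
    (\int[leb2]_(x in Omega) (orlicz_density F theta sigma x)%:E <= 1)%E ->
    (I <= (K * theta `^ (p / 2))%:E)%E.
  move=> t0 F1; rewrite IE.
  apply: (@le_trans _ _ ((2 * (A * theta * D)) `^ (1 + q))%:E).
    apply: weighted_limit_bound => // eps e0 e1; first exact: (En eps e0 e1).1.
    have [i e] := En eps e0 e1.
    exact: (weighted_energy_bound e0 e1 q0 sg0 sg1 qsg oO Ooo mu_ mG Au mF i A0 e t0 F1).
  have -> : 2 * (A * theta * D) = 2 * (A * D) * theta by ring.
  have AD0 : 0 <= 2 * (A * D) by rewrite mulr_ge0// mulr_ge0.
  rewrite q1 powRM ?(ltW t0)//.
  by rewrite lee_fin ler_wpM2r ?powR_ge0// lerDl.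
(* A single admissible [theta] already gives the finiteness of the weighted integral, and it makes
   the set in the Luxemburg norm nonempty. *)
have [theta t0 F1] := luxemburg_admissible oO sg0 mF Ffin.
split.
  have iG : leb2.-integrable Omega (EFin \o fnorm2 G).
    have h i j : leb2.-integrable Omega (EFin \o (fun x => G i j x ^+ 2)).
      exact: (H10_wpd_L2 i oO (Hu j)).2.
    exact: (integrable_sum2 (c := fun i j x => G i j x ^+ 2) oO).
  pose h x := (u ord0 x ^+ 2 + u ord_max x ^+ 2) `^ q * fnorm2 G x.
  have h0 x : 0 <= h x by rewrite mulr_ge0 ?powR_ge0 ?fnorm2_ge0.
  have mh : measurable_fun Omega h.
    by apply: measurable_funM; [exact: measurable_sumsq_powR|exact: measurable_fnorm2].
  have -> : (\int[leb2]_(x in Omega) (mat_norm G x ^+ 2 * (vec_norm u x `^ (p - 2) + 1))%:E =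
      \int[leb2]_(x in Omega) ((h x)%:E + (fnorm2 G x)%:E))%E.
    apply: eq_integral => x _; rewrite -EFinD mat_norm_sqr vec_norm_powR /h; congr EFin.
    by rewrite mulrDr mulr1 mulrC.
  rewrite ge0_integralD//; last 4 first.
  - by move=> x _; rewrite lee_fin.
  - exact/measurable_EFinP.
  - by move=> x _; rewrite lee_fin fnorm2_ge0.
  - exact: measurable_int iG.
  apply: lte_add_pinfty.
    by rewrite -IE; apply: (le_lt_trans (bound _ t0 F1)); rewrite ltry.
  by rewrite -[ltLHS](fineK (integrable_fin_num mO iG)) ltry.
apply: le_ereal_inf_powR => //; first by rewrite divr_gt0.
  by exists theta; split; [exact: t0|rewrite /= Ntilde_integral].
move=> t [tt0 tF]; split; first exact: tt0.
by apply: (bound t tt0); rewrite -Ntilde_integral.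
Qed.
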